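(* Let $n\geq 2$, let $\Omega\subset\mathbb{R}^n$ be an open set of finite positive measure $V$ with Dirichlet eigenvalues $\lambda_1\leq\lambda_2\leq\cdots$, and let $\nu:(0,\infty)\to[0,\infty)$ be a measurable function with $\nu(t)\leq N_\Omega(t)$ for almost every $t>0$. For each integer $k\geq 1$ let \[ J_k(L)=\int_0^L\min\{k-1,\nu(t)\}\,\mathrm{d}t ,\qquad L>0. \] Then for every $k\geq 1$ the equation \[ \Phi_k(L):=\mathcal{M}_k(L)+J_k(L)-kL=0 \] has a unique positive solution $L_k^{\mathrm{hyb}}$, and \[ \lambda_k\geq L_k^{\mathrm{hyb}}\geq L_k^{(0)},\qquad L_k^{(0)}:=c_nW_k. \] The second inequality is strict if and only if $J_k(L_k^{(0)})>0$. More generally, for any other valid lower bound $B_k\leq\lambda_k$, put $L_*:=\max\{L_k^{(0)},B_k\}$; then \[ L_k^{\mathrm{hyb}}>L_*\quad\Longleftrightarrow\quad \mathcal{M}_k(L_* )+J_k(L_* )>kL_*. \]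
   Context: The eigenvalues $0<\lambda_1\leq\lambda_2\leq\cdots\nearrow\infty$ of the Dirichlet Laplacian on $\Omega$ are listed in nondecreasing order and repeated according to multiplicity. The strict counting function is $N_\Omega(t)=\#\{j:\lambda_j<t\}$. Write $\omega_n=|B_1(0)|$, $C_n=(2\pi)^2\omega_n^{-2/n}$, and \[ W_k=C_nV^{-2/n}k^{2/n}. \] For $L>0$ define \[ \mathcal{M}_k(L)=\inf\left\{\int_{\mathbb{R}^n}|\xi|^2f(\xi)\,\mathrm{d}\xi:\ f \text{ measurable},\ 0\leq f(\xi)\leq\frac{V}{(2\pi)^n}\min\{1,L/|\xi|^2\},\ \int_{\mathbb{R}^n}f\,\mathrm{d}\xi=k\right\}, \] where the upper bound at $\xi=0$ is interpreted as $V/(2\pi)^n$. The constants $c_n$ are defined as follows. For $n\geq 3$, let $x_n>1$ be the unique solution in $(1,\infty)$ of $(n-2)x^n-nx^{n-2}+\frac{8}{n+2}=0$, and set $K_n=\frac{n x_n^{n-2}-2}{n-2}$, $c_n=K_n^{-2/n}$. For $n=2$, let $y_2>1$ be the unique solution in $(1,\infty)$ of $y-\log y=\frac32$, and set $K_2=1+\log y_2=y_2-\frac12$, $c_2=K_2^{-1}$. *)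

(* Defs.v *)
From HB Require Import structures.
From mathcomp Require Import all_boot all_order all_algebra.
From mathcomp Require Import all_classical all_reals all_analysis.

Set Implicit Arguments.
Unset Strict Implicit.
Unset Printing Implicit Defensive.
Import Order.TTheory GRing.Theory Num.Theory.
Import numFieldNormedType.Exports.
Local Open Scope classical_set_scope.
Local Open Scope ring_scope.

(* R^n is 'rV[R]_n, with the product sigma-algebra (as the library does for
   n.-tuple T). *)

Section measurable_row.
Context {d} {T : measurableType d} (n : nat).

Definition row_coord (i : 'I_n) (x : 'rV[T]_n) : T := x ord0 i.

Let row_set0 : g_sigma_preimage row_coord set0.
Proof. exact: sigma_algebra0. Qed.

Let row_setC A : g_sigma_preimage row_coord A ->
  g_sigma_preimage row_coord (~` A).
Proof. exact: sigma_algebraC. Qed.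

Let row_bigcup (F : (set 'rV[T]_n)^nat) :
  (forall i, g_sigma_preimage row_coord (F i)) ->
  g_sigma_preimage row_coord (\bigcup_i (F i)).
Proof. exact: sigma_algebra_bigcup. Qed.

HB.instance Definition _ := @isMeasurable.Build (measure_tuple_display d)
  'rV[T]_n (g_sigma_preimage row_coord) row_set0 row_setC row_bigcup.

End measurable_row.

Section measurable_row_theory.
Context {d} {T : measurableType d} (n : nat).

Lemma measurable_row_coord (i : 'I_n) :
  measurable_fun setT (@row_coord _ T n i).
Proof.
move=> _ Y mY; rewrite setTI; apply: sub_sigma_algebra => /=.
rewrite -bigcup_seq/=; exists i => /=; first by rewrite mem_index_enum.
by exists Y => //; rewrite setTI.
Qed.

Lemma measurable_to_row d' (U : measurableType d')
    (f : U -> 'rV[T]_n) :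
  (forall i, measurable_fun setT (@row_coord _ T n i \o f)) ->
  measurable_fun setT f.
Proof.
move=> mf.
have H : g_sigma_preimage (fun i => @row_coord _ T n i \o f)
    `<=` measurable.
  apply: smallest_sub; first exact: sigma_algebra_measurable.
  case: n => [|m] in f mf *; first by rewrite big_ord0.
  rewrite -bigcup_mkord_ord; apply: bigcup_sub => i Ii.
  by move=> A [B mB <-]; exact: mf.
rewrite g_sigma_preimage_comp in H.
by move=> _ A mA; apply: H; exists A.
Qed.

End measurable_row_theory.

Section lebesgue_step.
Context {R : realType} (n : nat).
Local Open Scope ereal_scope.

Definition row_cons (p : measurableTypeR R * 'rV[R]_n) :
    'rV[R]_n.+1 :=
  \row_i (if unlift ord0 i is Some j then p.2 ord0 j else p.1).

Let row_head (x : 'rV[R]_n.+1) :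
    measurableTypeR R * 'rV[R]_n :=
  (x ord0 ord0, \row_j x ord0 (lift ord0 j)).

Let row_consK : cancel row_cons row_head.
Proof.
move=> [a v]; rewrite /row_head /row_cons; congr pair; first by rewrite !mxE unlift_none.
by apply/rowP => j; rewrite !mxE liftK.
Qed.

Lemma measurable_row_cons : measurable_fun setT row_cons.
Proof.
apply: measurable_to_row => i; case: (unliftP ord0 i) => [j ->|->].
  rewrite (_ : _ \o _ = @row_coord _ R n j \o snd).
    by apply: measurableT_comp; [exact: measurable_row_coord|].
  by apply/funext => p /=; rewrite /row_coord /row_cons mxE liftK.
rewrite (_ : _ \o _ = fst)//.
by apply/funext => p /=; rewrite /row_coord /row_cons mxE unlift_none.
Qed.

Let measurable_row_head : measurable_fun setT row_head.
Proof.
have mh : measurable_fun setT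
    (fun x : 'rV[R]_n.+1 => x ord0 ord0 : measurableTypeR R).
  exact: (measurable_row_coord ord0).
suff mt : measurable_fun setT
    (fun x : 'rV[R]_n.+1 => \row_j x ord0 (lift ord0 j)).
  exact: measurable_fun_pair mh mt.
apply: measurable_to_row => j.
rewrite (_ : _ \o _ = row_coord (lift ord0 j)).
  exact: measurable_row_coord.
by apply/funext => p /=; rewrite /row_coord mxE.
Qed.

Variable mu : {sigma_finite_measure set 'rV[R]_n -> \bar R}.

Definition lebesgue_step : set 'rV[R]_n.+1 -> \bar R :=
  pushforward (@lebesgue_measure R \x mu) row_cons.

Let lebesgue_step0 : lebesgue_step set0 = 0.
Proof. by rewrite /lebesgue_step /pushforward preimage_set0 measure0. Qed.

Let lebesgue_step_ge0 A : 0 <= lebesgue_step A.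
Proof. rewrite /lebesgue_step /pushforward; exact: measure_ge0. Qed.

Let lebesgue_step_sigma_additive : semi_sigma_additive lebesgue_step.
Proof.
move=> F mF tF mUF; rewrite /lebesgue_step /pushforward preimage_bigcup.
apply: measure_semi_sigma_additive.
- by move=> i; rewrite -[X in measurable X]setTI; exact: measurable_row_cons.
- apply/trivIsetP => /= i j _ _ ij; rewrite -preimage_setI.
  by move/trivIsetP : tF => /(_ _ _ _ _ ij) ->//; rewrite preimage_set0.
- by rewrite -preimage_bigcup -[X in measurable X]setTI; exact: measurable_row_cons.
Qed.

HB.instance Definition _ := isMeasure.Build _ _ _
  lebesgue_step lebesgue_step0 lebesgue_step_ge0 lebesgue_step_sigma_additive.

Let lebesgue_step_sigma_finite : sigma_finite setT lebesgue_step.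
Proof.
have [F FT Foo] : sigma_finite setT (@lebesgue_measure R \x mu).
  have /sigma_finiteP[F [TF ndF Foo]] := sigma_finiteT (@lebesgue_measure R).
  have /sigma_finiteP[G [TG ndG Goo]] := sigma_finiteT mu.
  exists (fun k => F k `*` G k).
    rewrite -setXTT TF TG predeqE => -[x y]; split.
      move=> [/= [i _ Fx] [j _ Gy]]; exists (maxn i j) => //; split.
      - by move: x Fx; exact/subsetPset/ndF/leq_maxl.
      - by move: y Gy; exact/subsetPset/ndG/leq_maxr.
    by move=> [i _ []/= ? ?]; split; exists i.
  move=> k; have [? ?] := Foo k; have [? ?] := Goo k.
  split; first exact: measurableX.
  by rewrite product_measure1E// lte_mul_pinfty// ge0_fin_numE.
exists (fun k => row_head @^-1` (F k)).
  by rewrite -preimage_bigcup -FT preimage_setT.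
move=> k; have [mFk Fkoo] := Foo k; split.
  by rewrite -[X in measurable X]setTI; exact: measurable_row_head.
rewrite /lebesgue_step /pushforward -comp_preimage.
by rewrite (_ : row_head \o row_cons = id)//; apply/funext => p; exact: row_consK.
Qed.

HB.instance Definition _ := Measure_isSigmaFinite.Build _ _ _
  lebesgue_step lebesgue_step_sigma_finite.

End lebesgue_step.

(* Lebesgue measure on R^n, as the n-fold product of the Lebesgue measure
   on R. *)
Fixpoint lebesgue_row (R : realType) (n : nat) :
    {sigma_finite_measure set 'rV[R]_n -> \bar R} :=
  match n with
  | 0 => \d_(0 : 'rV[R]_0)
  | m.+1 => lebesgue_step (lebesgue_row R m)
  end.

Section box.
Context {R : realType}.
Local Open Scope ereal_scope.

Lemma lebesgue_row_box (n : nat) (A : 'I_n -> set R) :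
  (forall i, measurable (A i)) ->
  lebesgue_row R n [set x | forall i, A i (x ord0 i)] =
  \prod_(i < n) lebesgue_measure (A i : set (measurableTypeR R)).
Proof.
elim: n A => [|n IH] A mA.
  rewrite big_ord0 /= /dirac indicE mem_set//=; by case.
rewrite big_ord_recl/= -IH; last by move=> i; exact: mA.
rewrite /lebesgue_step /pushforward.
rewrite (_ : @row_cons R n @^-1` _ =
    A ord0 `*` [set x : 'rV[R]_n | forall i, A (lift ord0 i) (x ord0 i)]).
  rewrite product_measure1E//; first exact: (mA ord0).
  pose B i := @row_coord _ R n i @^-1` A (lift ord0 i).
  rewrite (_ : [set x | _] = \bigcap_(i in [set` enum 'I_n]) B i).
    apply: fin_bigcap_measurable => // i _; rewrite /B -[X in measurable X]setTI.
    by apply: measurable_row_coord.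
  apply/seteqP; split => x /= H i; first by move=> _; exact: H.
  by apply: (H i) => /=; rewrite mem_enum.
apply/seteqP; split => [[a v]/= H|[a v]/= [Ha Hv] i].
  split; first by have := H ord0; rewrite /row_cons mxE unlift_none.
  by move=> i; have := H (lift ord0 i); rewrite /row_cons mxE liftK.
by rewrite /row_cons mxE; case: unliftP => [j ->|->].
Qed.

End box.

Section dirichlet_laplacian.
Context {R : realType} (n : nat).
Implicit Types (Omega : set 'rV[R]_n) (u v phi : 'rV[R]_n -> R)
  (g h : 'I_n -> 'rV[R]_n -> R) (lam : nat -> R) (mu t : R).

Definition partial (i : 'I_n) u : 'rV[R]_n -> R :=
  fun x => 'D_(delta_mx ord0 i) u x.

Definition smooth u : Prop :=
  forall s : seq 'I_n, let w := foldr partial u s in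
  continuous w /\ forall x i, derivable w x (delta_mx ord0 i).

Definition test_function Omega phi : Prop :=
  smooth phi /\
  let supp := closure [set x | phi x != 0] in compact supp /\ supp `<=` Omega.

(* u belongs to H^1_0(Omega), the H^1-closure of the test functions, and g is
   its weak gradient. *)
Definition H10 Omega u g : Prop :=
  [/\ measurable_fun Omega u,
      forall i, measurable_fun Omega (g i) &
      exists phi : nat -> 'rV[R]_n -> R,
      [/\ forall m, test_function Omega (phi m),
          (fun m => (\int[lebesgue_row R n]_(x in Omega)
             ((phi m x - u x) ^+ 2)%:E)%E) @ \oo --> 0%E &
          forall i, (fun m => (\int[lebesgue_row R n]_(x in Omega)
             ((partial i (phi m) x - g i x) ^+ 2)%:E)%E) @ \oo --> 0%E]].

(* u solves - Delta u = mu u in the form sense; u = 0 is allowed. *)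
Definition dirichlet_solution Omega mu u : Prop :=
  exists g, H10 Omega u g /\
  forall v h, H10 Omega v h ->
    \sum_(i < n) \int[lebesgue_row R n]_(x in Omega) (g i x * h i x) =
    mu * \int[lebesgue_row R n]_(x in Omega) (u x * v x).

(* The space of solutions, up to equality almost everywhere on Omega, has a
   basis of d elements. *)
Definition dirichlet_multiplicity Omega mu (d : nat) : Prop :=
  exists b : 'I_d -> 'rV[R]_n -> R,
  [/\ forall i, dirichlet_solution Omega mu (b i),
      forall u, dirichlet_solution Omega mu u -> exists a : 'I_d -> R,
        {ae lebesgue_row R n, forall x, Omega x ->
          u x = \sum_(i < d) a i * b i x} &
      forall a : 'I_d -> R,
        {ae lebesgue_row R n, forall x, Omega x ->
          \sum_(i < d) a i * b i x = 0} -> forall i, a i = 0].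

(* lam 1 <= lam 2 <= ... lists the Dirichlet eigenvalues of Omega, each as
   often as its multiplicity; lam 0 is unused. *)
Definition dirichlet_eigenvalues Omega lam : Prop :=
  [/\ 0 < lam 1%N,
      forall i j, (1 <= i <= j)%N -> lam i <= lam j,
      lam @ \oo --> +oo &
      forall mu, exists d, dirichlet_multiplicity Omega mu d /\
        ([set j | (1 <= j)%N /\ lam j = mu] #= `I_d)%card].

Definition counting_lt lam t : \bar R :=
  counting [set j | (1 <= j)%N /\ lam j < t].

End dirichlet_laplacian.

Section constants.
Context {R : realType}.
Implicit Types (n k : nat) (V : R).

Definition sqnorm n (x : 'rV[R]_n) : R := \sum_(i < n) x ord0 i ^+ 2.

Definition omega n : R := fine (lebesgue_row R n [set x | sqnorm x < 1]).

Definition weyl_const n : R := (2 * pi) ^+ 2 * omega n `^ (- (2 / n%:R)).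

Definition weyl n V k : R :=
  weyl_const n * V `^ (- (2 / n%:R)) * k%:R `^ (2 / n%:R).

(* The solutions selected by [xget] exist and are unique. *)
Definition x_const n : R :=
  xget 0 [set x | 1 < x /\
    (n%:R - 2) * x ^+ n - n%:R * x ^+ (n - 2) + 8 / (n%:R + 2) = 0].

Definition y_const : R := xget 0 [set y | 1 < y /\ y - ln y = 3 / 2].

Definition K_const n : R :=
  if n == 2 then 1 + ln y_const
  else (n%:R * x_const n ^+ (n - 2) - 2) / (n%:R - 2).

Definition c_const n : R :=
  if n == 2 then (K_const 2)^-1 else K_const n `^ (- (2 / n%:R)).

Definition L0 n V k : R := c_const n * weyl n V k.

End constants.

(* R with the sigma-algebra of Lebesgue measurable sets *)
Definition lebesgueTypeR (R : realType) : Type :=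
  caratheodory_type ((wlength (idfun : R -> R))^*)%mu.

Section hybrid.
Context {R : realType} (n : nat).
Implicit Types (k : nat) (V L : R) (nu : R -> R) (f : 'rV[R]_n -> R).

(* The bound at the origin is V / (2 pi)^n, whereas L / 0 = 0 in the library. *)
Definition envelope V L (xi : 'rV[R]_n) : R :=
  V / (2 * pi) ^+ n *
  (if xi == 0 then 1 else Num.min 1 (L / sqnorm xi)).

Definition admissible V k L f : Prop :=
  [/\ measurable_fun setT f,
      forall xi, 0 <= f xi <= envelope V L xi &
      (\int[lebesgue_row R n]_xi (f xi)%:E)%E = k%:R%:E].

Definition Mmin V k L : \bar R :=
  ereal_inf [set (\int[lebesgue_row R n]_xi (sqnorm xi * f xi)%:E)%E
    | f in admissible V k L].

Definition Jint nu k L : R :=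
  \int[@completed_lebesgue_measure R]_(t in `]0, L[)
    Num.min (k%:R - 1) (nu t).

Definition Phi V nu k L : \bar R :=
  (Mmin V k L + (Jint nu k L)%:E - (k%:R * L)%:E)%E.

End hybrid.

(* Main.v *)
Require Import Defs.
From mathcomp Require Import all_boot all_order all_algebra.
From mathcomp Require Import all_classical all_reals all_analysis.
From mathcomp Require Import measurable_realfun.
From mathcomp Require Import ring lra zify.

Set Implicit Arguments.
Unset Strict Implicit.
Unset Printing Implicit Defensive.
Import Order.TTheory GRing.Theory Num.Theory.
Import numFieldNormedType.Exports.
Local Open Scope classical_set_scope.
Local Open Scope ring_scope.

(** Write M(L) for the minimal energy, J(L) for the integral of the truncated
    counting function, Phi(L) = M(L) + J(L) - k L, and S for the sum of the
    first k eigenvalues.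

    Raising L raises the envelope, so M is nonincreasing, while J grows with
    slope at most k - 1: Phi decreases with slope at most -1.  The envelope is
    concave in L, hence M is convex and so locally Lipschitz, and Phi is
    continuous.  The sign of Phi(L) therefore tells on which side of the root
    a given L > 0 lies, and every assertion about the root is the sign of Phi
    at lam_k, at L0, or at max(L0, B).  What has to be shown is that
    Phi(L0) = J(L0), which is >= 0, and that Phi(lam_k) <= 0.

    The value at L0.  By [bathtub], the minimum M(L) is attained by the
    envelope cut off at the radius r where its mass is k.  The mass and the
    energy of the cut-off envelope are radial integrals, computed in
    [mass_formula] and [energy_formula].  With r = x sqrt(L0), the mass
    condition says that L0 is the closed-form bound, and the equation that
    defines x_n (or y_2 = x^2 in dimension 2) says that the energy is k L0;
    this is [Mmin_L0].

    The value at lam_k.  It is the sum of two inequalities.  For t <= lam_k the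
    number of eigenvalues below t is a sum of k indicator functions, whose
    integral over (0, lam_k) is k lam_k - S; so J(lam_k) <= k lam_k - S, which
    is [Jint_le_eigenvalues].  And M(lam_k) <= S by the method of Berezin, Li
    and Yau.  Take orthonormal eigenfunctions u_1, ..., u_k and let F be the
    sum of the squared moduli of their Fourier transforms.  Bessel's inequality
    in L^2(Omega), applied to a plane wave of frequency xi, gives F(xi) <= V.
    The gradients of the u_j are orthogonal too, with squared norms lam_j, and
    Bessel's inequality applied to xi times the plane wave gives
    |xi|^2 F(xi) <= lam_k V.  Hence F / (2 pi)^n lies below the envelope with
    L = lam_k, and it has mass k and energy S.

    Only one consequence of Plancherel's theorem is needed in this last step:
    for all real mu, and u in H^1_0 with gradient g,
    (2 pi)^n (mu |u|^2 - |g|^2) is at most the integral of (mu - |xi|^2)_+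
    against the squared Fourier transform of u.  Summed over the
    eigenfunctions, it is [berezin_li_yau]; taking mu = r^2, with r the cut-off
    radius of the minimiser, turns it into M(lam_k) <= S
    ([Mmin_dual_bound]).  For test functions it is [berezin_test]: damping the
    frequency integral by exp(- c (|xi_1| + ... + |xi_n|)) makes Fubini's
    theorem applicable and turns it into a convolution with an explicit
    positive kernel ([regularizedE]), which concentrates as c tends to 0
    ([regularized_lim]).  [H10_properties] passes to the H^1 limit. *)

(** * Borel sets and Lebesgue measure on row vectors *)

Section rows.
Context {R : realType}.

Definition rat_box n (p : 'rV[rat]_n * nat) : set 'rV[R]_n :=
  [set x | forall i, `|ratr (p.1 ord0 i) - x ord0 i| < p.2.+1%:R^-1].

Lemma measurable_cylinder n (A : 'I_n -> set R) :
  (forall i, measurable (A i)) ->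
  measurable [set x : 'rV[R]_n | forall i, A i (x ord0 i)].
Proof.
move=> mA.
pose B i := @row_coord _ R n i @^-1` A i.
rewrite (_ : [set x | _] = \bigcap_(i in [set` enum 'I_n]) B i).
  apply: fin_bigcap_measurable => // i _; rewrite /B -[X in measurable X]setTI.
  by apply: measurable_row_coord.
apply/seteqP; split => x /= H i; first by move=> _; exact: H.
by apply: (H i) => /=; rewrite mem_enum.
Qed.

(** An open set is the union of the boxes with rational centre and
    radius 1 / (m + 1) that it contains, and there are countably many of
    them. *)
Lemma open_measurable_row n (U : set 'rV[R]_n) : open U -> measurable U.
Proof.
move=> oU.
have -> : U = \bigcup_(p : 'rV[rat]_n * nat)
    (if `[< rat_box p `<=` U >] then rat_box p else set0).
  apply/seteqP; split=> [x Ux|x [p _]]; last by case: asboolP => // pU; exact: pU.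
  move/open_nbhs_nbhs : (conj oU Ux) => /nbhs_ballP[e /= e0 xeU].
  have [m me] : exists m : nat, m.+1%:R^-1 < e / 2.
    have h2 : 0 < e / 2 by rewrite divr_gt0.
    have [m _ mP] := near_infty_natSinv_lt (PosNum h2).
    by exists m; apply: mP => /=.
  have /choice[f fP] : forall i : 'I_n, exists q : rat, `|ratr q - x ord0 i| < m.+1%:R^-1.
    move=> i; have xx : x ord0 i - m.+1%:R^-1 < x ord0 i + m.+1%:R^-1.
      by rewrite ltrBlDr -addrA ltrDl addr_gt0.
    have [q] := rat_in_itvoo xx.
    by rewrite in_itv /= => qP; exists q; rewrite ltr_distl.
  exists (\row_i f i, m) => //; case: asboolP => [_ i /=|]; first by rewrite mxE.
  case=> y yP; apply: xeU; split=> // i j; rewrite ord1.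
  rewrite /ball /= (@le_lt_trans _ _ (`|x ord0 j - ratr (f j)| + `|ratr (f j) - y ord0 j|))//.
    by rewrite (le_trans _ (ler_normD _ _))// addrA subrK.
  by rewrite (splitr e) ltrD// ?(lt_trans _ me)// ?[`|x _ _ - _|]distrC//; have := yP j; rewrite /= mxE.
apply: countable_bigcupT_measurable => [|p]; first exact: countableP.
case: asboolP => _ //; apply: (@measurable_cylinder n (fun i => [set t : R | `|ratr (p.1 ord0 i) - t| < p.2.+1%:R^-1])) => i.
by apply: measurable_realfun.open_measurable; exact: (@ball_open R R^o).
Qed.

Lemma continuous_measurable_row n (f : 'rV[R]_n -> R) :
  continuous f -> measurable_fun setT f.
Proof.
move=> cf; apply: (measurability _ (RGenOInfty.measurableE R)) => //.
move=> _ [_ [x ->] <-]; rewrite setTI; apply: open_measurable_row.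
by apply: open_comp => //; move=> y _; exact: cf.
Qed.

(** Lebesgue measure is determined by its values on half-open intervals,
    and on these c times its pushforward under t |-> a + c t agrees with
    it. *)
Lemma ge0_integral_affine1 (a c : R) (f : R -> \bar R) : 0 < c ->
  measurable_fun setT f -> (forall x, (0 <= f x)%E) ->
  (c%:E * \int[@lebesgue_measure R]_t f (a + c * t)%R =
   \int[@lebesgue_measure R]_t f t)%E.
Proof.
move=> c0 mf f0.
pose phi := (fun t : measurableTypeR R => a + c * t : measurableTypeR R).
have mphi : measurable_fun setT phi.
  by apply: measurable_funD => //; exact: measurable_funM.
rewrite -(@ge0_integral_pushforward _ _ _ _ R phi mphi (@lebesgue_measure R) setT)//.
have c0' : 0 <= c by exact: ltW.
rewrite -(@ge0_integral_mscale _ _ R _ setT measurableT (NngNum c0'))//.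
apply: eq_measure_integral => A mA _.
apply/esym/lebesgue_measure_unique => // _ [[u v]] _ <-.
change (lebesgue_measure `]u, v] = c%:E * lebesgue_measure (phi @^-1` `]u, v]))%E.
have -> : phi @^-1` `]u, v]%classic = `](u - a) / c, (v - a) / c]%classic.
  by apply/seteqP; split => t /=; rewrite !in_itv /= /phi;
    rewrite ltr_pdivrMr// ler_pdivlMr// ltrBlDl lerBrDl (mulrC t).
rewrite !lebesgue_measure_itv /= !lte_fin ltr_pM2r ?invr_gt0// ltrD2r.
case: ifPn => _; last by rewrite mule0.
by rewrite -EFinB -EFinM -mulrBl opprB addrA subrK mulrCA divff ?gt_eqF// mulr1.
Qed.

Lemma ge0_integral_row_cons n (f : 'rV[R]_n.+1 -> \bar R) :
  measurable_fun setT f -> (forall x, (0 <= f x)%E) ->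
  (\int[lebesgue_row R n.+1]_x f x =
   \int[@lebesgue_measure R]_a \int[lebesgue_row R n]_v f (row_cons (a, v)))%E.
Proof.
move=> mf f0 /=.
rewrite /lebesgue_step ge0_integral_pushforward//; last exact: measurable_row_cons.
rewrite preimage_setT fubini_tonelli1//; last by move=> p; exact: f0.
by apply: measurableT_comp => //; exact: measurable_row_cons.
Qed.

Lemma measurable_row_affine n (x : 'rV[R]_n) (c : R) :
  measurable_fun setT (fun w : 'rV[R]_n => x + c *: w).
Proof.
apply: measurable_to_row => i; rewrite (_ : _ \o _ = fun w => x ord0 i + c * row_coord i w).
  apply: measurable_funD => //; apply: measurable_funM => //; exact: measurable_row_coord.
by apply/funext => w /=; rewrite /row_coord !mxE.
Qed.

(** Induction on the dimension: Tonelli splits off one coordinate, to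
    which the one-dimensional formula applies. *)
Lemma ge0_integral_affine n (x : 'rV[R]_n) (c : R) (f : 'rV[R]_n -> \bar R) : 0 < c ->
  measurable_fun setT f -> (forall x, (0 <= f x)%E) ->
  ((c ^+ n)%:E * \int[lebesgue_row R n]_w f (x + c *: w)%R =
   \int[lebesgue_row R n]_y f y)%E.
Proof.
move=> c0; elim: n x f => [|n IH] x f mf f0.
  rewrite expr0 mul1e; apply: eq_integral => w _; congr f; apply/matrixP => i []//.
have mfc : measurable_fun setT (fun w : 'rV[R]_n.+1 => f (x + c *: w)).
  by apply: measurableT_comp => //; exact: measurable_row_affine.
rewrite !ge0_integral_row_cons// exprS EFinM -muleA.
rewrite -ge0_integralZl//; last 3 first.
- apply: (measurable_fun_fubini_tonelli_F (fun p => f (x + c *: row_cons p))) => //.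
  by apply: (measurableT_comp mfc); exact: measurable_row_cons.
- by move=> a _; exact: integral_ge0.
- by rewrite lee_fin exprn_ge0// ltW.
have mfr : measurable_fun setT (fun p : measurableTypeR R * 'rV[R]_n => f (row_cons p)).
  by apply: (measurableT_comp mf); exact: measurable_row_cons.
rewrite -(@ge0_integral_affine1 (x ord0 ord0) c (fun a => \int[lebesgue_row R n]_v f (row_cons (a, v)))%E)//; last 2 first.
- exact: (measurable_fun_fubini_tonelli_F (fun p => f (row_cons p))).
- by move=> a; exact: integral_ge0.
congr (_ * _)%E; apply: eq_integral => a _.
rewrite -[RHS](IH (\row_j x ord0 (lift ord0 j)) (fun v => f (row_cons (x ord0 ord0 + c * a, v))))//; last first.
  exact: (measurableT_comp mfr (pair1_measurable (x ord0 ord0 + c * a : measurableTypeR R))).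
congr (_ * _)%E; apply: eq_integral => v _; congr f; apply/rowP => i.
by rewrite !mxE /=; case: unliftP => [j ->|->]; rewrite ?mxE.
Qed.

Lemma ge0_integral_row_prod n (g : 'I_n -> R -> R) :
  (forall i, measurable_fun setT (g i)) -> (forall i t, 0 <= g i t) ->
  (\int[lebesgue_row R n]_x (\prod_i g i (x ord0 i))%:E =
   \prod_i \int[@lebesgue_measure R]_t (g i t)%:E)%E.
Proof.
elim: n g => [|n IH] g mg g0.
  under eq_integral do rewrite big_ord0.
  by rewrite big_ord0 /= integral_dirac// diracT mul1e.
have mp m (h : 'I_m -> R -> R) : (forall i, measurable_fun setT (h i)) ->
    measurable_fun setT (fun x : 'rV[R]_m => (\prod_i h i (x ord0 i))%:E).
  move=> mh; apply/measurable_EFinP; apply: measurable_prod => i _.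
  by apply: (measurableT_comp (mh i)); exact: measurable_row_coord.
rewrite ge0_integral_row_cons//; [|exact: mp|by move=> x; rewrite lee_fin prodr_ge0].
rewrite big_ord_recl -IH// -ge0_integralZr//; last 3 first.
- by apply/measurable_EFinP; exact: mg.
- by move=> t _; rewrite lee_fin.
- by apply: integral_ge0 => x _; rewrite lee_fin prodr_ge0.
apply: eq_integral => a _; rewrite -ge0_integralZl//; last 3 first.
- by apply: (mp _ (fun i => g (lift ord0 i))).
- by move=> x _; rewrite lee_fin prodr_ge0.
- by rewrite lee_fin.
apply: eq_integral => v _; rewrite big_ord_recl EFinM; congr (_ * _)%E.
  by rewrite mxE unlift_none.
by congr EFin; apply: eq_bigr => i _; rewrite mxE liftK.
Qed.

End rows.

(** * Integrals of exp(-|t|) (1 + cos t) and of 2 / (1 + t^2) on the line *)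

Section kernel.
Context {R : realType}.
Notation mu := (@lebesgue_measure R).

Lemma ge0_integral_halves (g : R -> R) : measurable_fun setT g -> (forall t, 0 <= g t) ->
  (\int[mu]_t (g t)%:E = \int[mu]_(t in `[0%R, +oo[) (g t)%:E +
     \int[mu]_(t in `[0%R, +oo[) (g (- t)%R)%:E)%E.
Proof.
move=> mg g0.
have mg' : measurable_fun setT (fun t => (g t)%:E) by exact/measurable_EFinP.
have -> : [set: R] = `]-oo, 0%R] `|` `]0%R, +oo[.
  by rewrite -set_itvNyy -(@itv_bndbnd_setU _ _ -oo%O (BRight (0:R)) +oo%O).
rewrite ge0_integral_setU//=; last 3 first.
- exact: measurable_funTS.
- by move=> x _; rewrite lee_fin.
- rewrite disj_set2E; apply/eqP/seteqP; split => // x [] /=; rewrite !in_itv /= andbT.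
  by move=> x0 /(le_lt_trans x0); rewrite ltxx.
rewrite addeC; congr (_ + _)%E.
  by rewrite integral_itv_obnd_cbnd//; exact: measurable_funTS.
rewrite (@ge0_integration_by_substitution0 R (fun t => (g (- t))%:E)).
- by apply: eq_integral => t _; rewrite opprK.
- by apply: (measurableT_comp mg'); exact: oppr_measurable.
- by move=> r; rewrite lee_fin.
Qed.

Lemma one_cos_ge0 (x : R) : 0 <= 1 + cos x.
Proof. by have := cos_geN1 x; rewrite -subr_ge0 opprK addrC. Qed.

Lemma is_derive_continuous (f : R -> R) (x d : R) :
  is_derive x 1 f d -> f y @[y --> x] --> f x.
Proof.
by move=> h; apply: differentiable_continuous; apply/derivable1_diffP; exact: ex_derive.
Qed.

Lemma is_derive_expcos (z b t : R) :
  is_derive t 1 (fun t => expR (- t) * (z * sin (t * z + b) - cos (t * z + b)) / (1 + z ^+ 2))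
    (expR (- t) * cos (t * z + b)).
Proof.
apply: is_derive_eq.
rewrite /GRing.scale /=.
have h : 1 + z ^+ 2 != 0 by rewrite gt_eqF// ltr_pwDl// sqr_ge0.
by field.
Qed.

(** The summand 1 keeps the integrand nonnegative, so that the
    fundamental theorem on a half-line and Tonelli's theorem apply with
    no integrability condition; it is subtracted again in
    [Rintegral_expw_cos]. *)
Lemma integral_exp_half (z b : R) :
  (\int[mu]_(t in `[0%R, +oo[) (expR (- t) * (1 + cos (t * z + b)))%:E =
   (1 + (cos b - z * sin b) / (1 + z ^+ 2))%:E)%E.
Proof.
pose F t := - expR (- t) + expR (- t) * (z * sin (t * z + b) - cos (t * z + b)) / (1 + z ^+ 2).
have dF (t : R) : is_derive t 1 F (expR (- t) * (1 + cos (t * z + b))).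
  have H := is_derive_expcos z b t.
  rewrite /F; apply: is_derive_eq.
  by rewrite /GRing.scale /= mulrDr; congr (_ + _); ring.
have cexp : continuous (fun t : R => expR (- t) * (1 + cos (t * z + b))).
  move=> t; apply: differentiable_continuous; apply/derivable1_diffP.
  exact: ex_derive.
rewrite (@ge0_continuous_FTC2y _ _ F 0 0).
- rewrite -EFinB; congr EFin; rewrite /F !mul0r !add0r oppr0 expR0; field.
  by rewrite gt_eqF// ltr_pwDl// sqr_ge0.
- by move=> t _; rewrite mulr_ge0 ?expR_ge0 ?one_cos_ge0.
- exact: continuous_subspaceT.
- have h : 0 < 1 + z ^+ 2 by rewrite ltr_pwDl// sqr_ge0.
  have -> : 0 = - 0 + 0 * (1 + z ^+ 2)^-1 :> R by rewrite mul0r oppr0 addr0.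
  apply: cvgD; first by apply: cvgN; exact: cvgr_expR.
  apply: cvgM; last exact: cvg_cst.
  apply/norm_cvg0P.
  apply: (@squeeze_cvgr _ _ _ _ (fun=> 0) (fun t => expR (- t) * (`|z| + 1))); last 2 first.
    exact: cvg_cst.
    by rewrite -(mul0r (`|z| + 1)); apply: cvgM; [exact: cvgr_expR|exact: cvg_cst].
  apply: nearW => t; rewrite normr_ge0 /= normrM (ger0_norm (expR_ge0 _)) ler_wpM2l ?expR_ge0//.
  rewrite (le_trans (ler_normB _ _))// lerD//.
    rewrite normrM ler_piMr// ler_norml; have := sin_geN1 (t * z + b); have := sin_le1 (t * z + b).
    by move=> -> ->.
  rewrite ler_norml; have := cos_geN1 (t * z + b); have := cos_le1 (t * z + b).
  by move=> -> ->.
- by move=> t _; apply: ex_derive.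
- by apply: cvg_at_right_filter; apply: is_derive_continuous (dF 0).
- by move=> t _; rewrite derive1E; apply: derive_val.
Qed.

Lemma measurable_expabs_cos (z b : R) :
  measurable_fun setT (fun t : R => expR (- `|t|) * (1 + cos (t * z + b))).
Proof.
apply: measurable_funM.
  apply: (measurableT_comp (@measurable_expR R)); apply: (measurableT_comp (@oppr_measurable R setT)).
  exact: normr_measurable.
apply: measurable_funD => //.
apply: (@measurableT_comp _ _ _ _ _ _ cos); first by apply: continuous_measurable_fun; exact: continuous_cos.
by apply: measurable_funD => //; apply: measurable_funM.
Qed.

Lemma integral_expabs_cos (z b : R) :
  (\int[mu]_t (expR (- `|t|) * (1 + cos (t * z + b)))%:E =
   (2 + cos b * (2 / (1 + z ^+ 2)))%:E)%E.
Proof.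
rewrite ge0_integral_halves; last 2 first.
- exact: measurable_expabs_cos.
- by move=> t; rewrite mulr_ge0 ?expR_ge0// one_cos_ge0.
have -> : (\int[mu]_(t in `[0%R, +oo[) (expR (- `|t|) * (1 + cos (t * z + b)))%:E =
   (1 + (cos b - z * sin b) / (1 + z ^+ 2))%:E)%E.
  rewrite -integral_exp_half; apply: eq_integral => t; rewrite inE/= in_itv/= andbT => t0.
  by rewrite ger0_norm.
have -> : (\int[mu]_(t in `[0%R, +oo[) (expR (- `|- t|) * (1 + cos (- t * z + b)))%:E =
   (1 + (cos b + z * sin b) / (1 + z ^+ 2))%:E)%E.
  have := integral_exp_half (- z) b; rewrite sqrrN mulNr opprK => <-.
  apply: eq_integral => t; rewrite inE/= in_itv/= andbT => t0.
  by rewrite normrN ger0_norm// mulrN mulNr.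
by rewrite -EFinD; congr EFin; field; rewrite gt_eqF// ltr_pwDl// sqr_ge0.
Qed.

Lemma integral_expabs : (\int[mu]_t (expR (- `|t|))%:E = 2%:E)%E.
Proof.
have := integral_expabs_cos 0 0.
rewrite cos0 expr0n /= addr0 divr1 mul1r.
rewrite (_ : \int[mu]_x _ = \int[mu]_x (2%:E * (expR (- `|x|))%:E))%E; last first.
  by apply: eq_integral => x _; rewrite mulr0 add0r cos0 -EFinM; congr EFin; ring.
rewrite ge0_integralZl//; last first.
  apply/measurable_EFinP; apply: (measurableT_comp (@measurable_expR R)).
  apply: (measurableT_comp (@oppr_measurable R setT)).
  exact: normr_measurable.
move=> h; have : (2^-1%:E * (2%:E * \int[mu]_t (expR (- `|t|))%:E) = 2^-1%:E * (2 + 2)%:E)%E.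
  by rewrite h.
by rewrite muleA -!EFinM mulVf// mul1e => ->; congr EFin; field.
Qed.

Lemma integral_poisson1 : (\int[mu]_t (2 / (1 + t ^+ 2))%:E = (2 * pi)%:E)%E.
Proof.
have p1 (t : R) : 0 < 1 + t ^+ 2 by rewrite ltr_pwDl// sqr_ge0.
have cf : continuous (fun t : R => 2 / (1 + t ^+ 2)).
  move=> t; apply: cvgM; first exact: cvg_cst.
  apply: cvgV; first by rewrite gt_eqF.
  by apply: cvgD; [exact: cvg_cst|exact: exprn_continuous].
rewrite ge0_symfun_integralT//; last 2 first.
- by move=> t; rewrite divr_ge0// ltW.
- by move=> t /=; rewrite sqrrN.
have -> : [set x : R | 0 <= x] = `[0, +oo[%classic.
  by apply/seteqP; split=> t /=; rewrite in_itv/= andbT.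
have dF (t : R) : is_derive t 1 (fun t : R => 2 * atan t) (2 / (1 + t ^+ 2)).
  by apply: is_derive_eq; rewrite /GRing.scale /= mulrC.
rewrite (@ge0_continuous_FTC2y _ _ (fun t => 2 * atan t) 0 pi).
- by rewrite atan0 mulr0 sube0 -EFinM.
- by move=> t _; rewrite divr_ge0// ltW.
- exact: continuous_subspaceT.
- have -> : pi = 2 * (pi / 2) :> R by field.
  by apply: cvgM; [exact: cvg_cst|exact: cvgy_atan].
- by move=> t _; apply: ex_derive.
- by apply: cvg_at_right_filter; apply: is_derive_continuous (dF 0).
- by move=> t _; rewrite derive1E; apply: derive_val.
Qed.

End kernel.

(** * The exponential weight and its Fourier transform *)

Section kernel_n.
Context {R : realType}.

Definition dot n (x y : 'rV[R]_n) : R := \sum_(i < n) x ord0 i * y ord0 i.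

Lemma dotC n (x y : 'rV[R]_n) : dot x y = dot y x.
Proof. by apply: eq_bigr => i _; rewrite mulrC. Qed.

Lemma dotDr n (x y z : 'rV[R]_n) : dot x (y + z) = dot x y + dot x z.
Proof. by rewrite /dot -big_split; apply: eq_bigr => i _; rewrite mxE mulrDr. Qed.

Lemma dotZr n c (x y : 'rV[R]_n) : dot x (c *: y) = c * dot x y.
Proof. by rewrite /dot mulr_sumr; apply: eq_bigr => i _; rewrite mxE mulrCA. Qed.

Lemma dotZl n c (x y : 'rV[R]_n) : dot (c *: y) x = c * dot y x.
Proof. by rewrite !(dotC _ x) dotZr. Qed.

Lemma dot_row_cons n a (v : 'rV[R]_n) (w : 'rV[R]_n.+1) :
  dot (row_cons (a, v)) w = a * w ord0 ord0 + dot v (\row_j w ord0 (lift ord0 j)).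
Proof.
rewrite /dot big_ord_recl; congr (_ + _); first by rewrite mxE unlift_none.
by apply: eq_bigr => i _; rewrite !mxE liftK.
Qed.

Lemma dotE n (x : 'rV[R]_n) : dot x x = sqnorm x.
Proof. by apply: eq_bigr => i _; rewrite expr2. Qed.

Lemma measurable_dot n d (T : measurableType d) (f g : T -> 'rV[R]_n) :
  measurable_fun setT f -> measurable_fun setT g ->
  measurable_fun setT (fun x => dot (f x) (g x)).
Proof.
move=> mf mg; apply: measurable_sum => i; apply: measurable_funM.
  by apply: (measurableT_comp (measurable_row_coord i) mf).
by apply: (measurableT_comp (measurable_row_coord i) mg).
Qed.

(** This is exp(- |x_1| - ... - |x_n|), in product form so that
    integrals factor. *)
Definition expw n (x : 'rV[R]_n) : R := \prod_(i < n) expR (- `|x ord0 i|).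

(** The Fourier transform of [expw], by [Rintegral_expw_cos]. As a
    function of w it is a positive integrable kernel of total mass
    (2 pi)^n, by [integral_poisson]. *)
Definition poisson n (w : 'rV[R]_n) : R := \prod_(i < n) (2 / (1 + w ord0 i ^+ 2)).

Lemma poisson_den_gt0 (t : R) : 0 < 1 + t ^+ 2.
Proof. by rewrite ltr_pwDl// sqr_ge0. Qed.

Lemma poisson_ge0 n (w : 'rV[R]_n) : 0 <= poisson w.
Proof. by apply: prodr_ge0 => i _; rewrite divr_ge0// ltW// poisson_den_gt0. Qed.

Lemma poisson_le n (w : 'rV[R]_n) : poisson w <= 2 ^+ n.
Proof.
rewrite -[X in 2 ^+ X]card_ord -prodr_const; apply: ler_prod => i _.
apply/andP; split; first by rewrite divr_ge0// ltW// poisson_den_gt0.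
by rewrite ler_pdivrMr ?poisson_den_gt0// ler_peMr// lerDl sqr_ge0.
Qed.

Lemma expw_ge0 n (x : 'rV[R]_n) : 0 <= expw x.
Proof. by apply: prodr_ge0 => i _; rewrite expR_ge0. Qed.

Lemma expw_le1 n (x : 'rV[R]_n) : expw x <= 1.
Proof.
rewrite -(expr1n R n) -[X in 1 ^+ X]card_ord -prodr_const; apply: ler_prod => i _.
by rewrite expR_ge0/= -expR0 ler_expR oppr_le0.
Qed.

Lemma measurable_expw n : measurable_fun setT (@expw n).
Proof.
apply: measurable_prod => i _; apply: (measurableT_comp (@measurable_expR R)).
apply: (measurableT_comp (@oppr_measurable R setT)).
by apply: (measurableT_comp (@normr_measurable R setT)); exact: measurable_row_coord.
Qed.

Lemma measurable_inv1sq : measurable_fun setT (fun t : R => 2 / (1 + t ^+ 2)).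
Proof.
apply: continuous_measurable_fun => t; apply: cvgM; first exact: cvg_cst.
apply: cvgV; first by rewrite gt_eqF// poisson_den_gt0.
by apply: cvgD; [exact: cvg_cst|exact: exprn_continuous].
Qed.

Lemma measurable_poisson n : measurable_fun setT (@poisson n).
Proof.
apply: measurable_prod => i _; apply: (measurableT_comp measurable_inv1sq).
exact: measurable_row_coord.
Qed.

Lemma measurable_cosR : measurable_fun setT (@cos R).
Proof. by apply: continuous_measurable_fun; exact: continuous_cos. Qed.

Lemma measurable_sinR : measurable_fun setT (@sin R).
Proof. by apply: continuous_measurable_fun; exact: continuous_sin. Qed.

Lemma poisson_cons n (w : 'rV[R]_n.+1) :
  poisson w = 2 / (1 + w ord0 ord0 ^+ 2) * poisson (\row_j w ord0 (lift ord0 j)).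
Proof.
by rewrite /poisson big_ord_recl; congr (_ * _); apply: eq_bigr => i _; rewrite mxE.
Qed.

Lemma expw_cons n a (v : 'rV[R]_n) : expw (row_cons (a, v)) = expR (- `|a|) * expw v.
Proof.
rewrite /expw big_ord_recl; congr (_ * _); first by rewrite mxE unlift_none.
by apply: eq_bigr => i _; rewrite mxE liftK.
Qed.

Lemma measurable_expw_cos n (w : 'rV[R]_n) b :
  measurable_fun setT (fun x : 'rV[R]_n => expw x * (1 + cos (dot x w + b))).
Proof.
apply: measurable_funM; first exact: measurable_expw.
apply: measurable_funD => //; apply: (measurableT_comp measurable_cosR).
by apply: measurable_funD => //; apply: measurable_dot => //; exact: measurable_id.
Qed.

(** The phase b is what makes the induction on the dimension work:
    fixing the first coordinate a of x shifts the phase by a times the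
    first coordinate of w. *)
Lemma integral_expw_cos n (w : 'rV[R]_n) b :
  (\int[lebesgue_row R n]_x (expw x * (1 + cos (dot x w + b)))%:E =
   (2 ^+ n + cos b * poisson w)%:E)%E.
Proof.
elim: n w b => [|n IH] w b.
  rewrite /= integral_dirac//.
    by rewrite diracT mul1e /expw /dot /poisson !big_ord0 add0r mul1r mulr1 expr0.
  by apply/measurable_EFinP; apply: measurable_funTS; exact: measurable_expw_cos.
rewrite ge0_integral_row_cons; last 2 first.
- by apply/measurable_EFinP; exact: measurable_expw_cos.
- by move=> x; rewrite lee_fin mulr_ge0 ?expw_ge0 ?one_cos_ge0.
set w' : 'rV[R]_n := \row_j w ord0 (lift ord0 j).
transitivity (\int[@lebesgue_measure R]_a ((2 ^+ n - poisson w')%:E * (expR (- `|a|))%:E +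
    (poisson w')%:E * (expR (- `|a|) * (1 + cos (a * w ord0 ord0 + b)))%:E))%E.
  apply: eq_integral => a _.
  transitivity (\int[lebesgue_row R n]_v ((expR (- `|a|))%:E *
      (expw v * (1 + cos (dot v w' + (a * w ord0 ord0 + b))))%:E))%E.
    apply: eq_integral => v _; rewrite expw_cons dot_row_cons -EFinM; congr EFin.
    by rewrite -mulrA; congr (_ * (_ * (_ + cos _))); rewrite -/w'; ring.
  rewrite ge0_integralZl//; last 2 first.
  - by apply/measurable_EFinP; exact: measurable_expw_cos.
  - by move=> x _; rewrite lee_fin mulr_ge0 ?expw_ge0 ?one_cos_ge0.
  by rewrite IH -!EFinM -EFinD; congr EFin; ring.
have me : measurable_fun setT (fun a : measurableTypeR R => (expR (- `|a|))%:E).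
  apply/measurable_EFinP; apply: (measurableT_comp (@measurable_expR R)).
  by apply: (measurableT_comp (@oppr_measurable R setT)); exact: normr_measurable.
have mc : measurable_fun setT (fun a : measurableTypeR R =>
    (expR (- `|a|) * (1 + cos (a * w ord0 ord0 + b)))%:E).
  by apply/measurable_EFinP; exact: measurable_expabs_cos.
rewrite ge0_integralD//; last 4 first.
- by move=> a _; rewrite -EFinM lee_fin mulr_ge0 ?expR_ge0// subr_ge0 poisson_le.
- by apply: measurable_funeM.
- by move=> a _; rewrite -EFinM lee_fin !mulr_ge0 ?expR_ge0 ?one_cos_ge0 ?poisson_ge0.
- by apply: measurable_funeM.
rewrite ge0_integralZl//; last by rewrite lee_fin subr_ge0 poisson_le.
rewrite ge0_integralZl//; last by rewrite lee_fin poisson_ge0.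
rewrite integral_expabs integral_expabs_cos -!EFinM -EFinD poisson_cons -/w'; congr EFin.
by rewrite (exprS 2); ring.
Qed.

Lemma integral_expw n : (\int[lebesgue_row R n]_x (expw x)%:E = (2 ^+ n)%:E)%E.
Proof.
rewrite (@ge0_integral_row_prod R n (fun _ t => expR (- `|t|))); last 2 first.
- move=> i; apply: (measurableT_comp (@measurable_expR R)).
  by apply: (measurableT_comp (@oppr_measurable R setT)); exact: normr_measurable.
- by move=> i t; exact: expR_ge0.
rewrite (eq_bigr (fun=> 2%:E)); last by move=> i _; exact: integral_expabs.
by rewrite prodEFin prodr_const card_ord.
Qed.

Lemma integral_poisson n :
  (\int[lebesgue_row R n]_x (poisson x)%:E = ((2 * pi) ^+ n)%:E)%E.
Proof.
rewrite (@ge0_integral_row_prod R n (fun _ t => 2 / (1 + t ^+ 2))); last 2 first.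
- by move=> i; exact: measurable_inv1sq.
- by move=> i t; rewrite divr_ge0// ltW// poisson_den_gt0.
rewrite (eq_bigr (fun=> (2 * pi)%:E)); last by move=> i _; exact: integral_poisson1.
by rewrite prodEFin prodr_const card_ord.
Qed.

Lemma integrable_expw n : (lebesgue_row R n).-integrable setT (EFin \o @expw n).
Proof.
apply/integrableP; split; first by apply/measurable_EFinP; exact: measurable_expw.
rewrite (eq_integral (fun x => (expw x)%:E)).
  by rewrite integral_expw ltry.
by move=> x _ /=; rewrite ger0_norm// expw_ge0.
Qed.

Lemma integrable_poisson n : (lebesgue_row R n).-integrable setT (EFin \o @poisson n).
Proof.
apply/integrableP; split; first by apply/measurable_EFinP; exact: measurable_poisson.
rewrite (eq_integral (fun x => (poisson x)%:E)).
  by rewrite integral_poisson ltry.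
by move=> x _ /=; rewrite ger0_norm// poisson_ge0.
Qed.

Lemma Rintegral_expw_cos n (w : 'rV[R]_n) :
  \int[lebesgue_row R n]_x (expw x * cos (dot x w)) = poisson w.
Proof.
have i1 := integrable_expw n.
have i2 : (lebesgue_row R n).-integrable setT (fun x => (expw x * (1 + cos (dot x w)))%:E).
  apply/integrableP; split.
    apply/measurable_EFinP; have := measurable_expw_cos w 0.
    by under eq_fun do rewrite addr0.
  rewrite (eq_integral (fun x => (expw x * (1 + cos (dot x w + 0)))%:E)).
    by rewrite integral_expw_cos ltry.
  by move=> x _ /=; rewrite addr0 ger0_norm// mulr_ge0 ?expw_ge0 ?one_cos_ge0.
have -> : \int[lebesgue_row R n]_x (expw x * cos (dot x w)) =
   \int[lebesgue_row R n]_x (expw x * (1 + cos (dot x w)) - expw x).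
  by congr Rintegral; apply/funext => x; ring.
rewrite RintegralB//.
rewrite /Rintegral integral_expw.
rewrite (eq_integral (fun x => (expw x * (1 + cos (dot x w + 0)))%:E)); last first.
  by move=> x _; rewrite addr0.
by rewrite integral_expw_cos cos0 mul1r /= addrAC subrr add0r.
Qed.

End kernel_n.

(** * Real-valued integrals and square-integrable functions *)

Section Rintegral_tools.
Context {R : realType} d (T : measurableType d) (mu : {measure set T -> \bar R}).
Variables (D : set T) (mD : measurable D).

Lemma integrable_EFinP (f : T -> R) : measurable_fun D f ->
  (\int[mu]_(x in D) `|f x|%:E < +oo)%E -> mu.-integrable D (EFin \o f).
Proof. by move=> mf h; apply/integrableP; split; [exact/measurable_EFinP|]. Qed.

Lemma EFin_Rintegral (f : T -> R) : mu.-integrable D (EFin \o f) ->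
  (\int[mu]_(x in D) (f x)%:E = (\int[mu]_(x in D) f x)%:E)%E.
Proof. by move=> h; rewrite fineK// integrable_fin_num. Qed.

Lemma integrable_dominated (f g : T -> R) : measurable_fun D f ->
  mu.-integrable D (EFin \o g) -> (forall x, D x -> `|f x| <= g x) ->
  mu.-integrable D (EFin \o f).
Proof.
move=> mf ig fg; apply: (le_integrable mD _ _ ig); first exact/measurable_EFinP.
by move=> x Dx /=; rewrite lee_fin (le_trans (fg x Dx))// ler_norm.
Qed.

Lemma integrable_EFinD (f g : T -> R) : mu.-integrable D (EFin \o f) ->
  mu.-integrable D (EFin \o g) -> mu.-integrable D (EFin \o (fun x => f x + g x)).
Proof. by move=> i1 i2; have := integrableD mD i1 i2; apply: eq_integrable. Qed.

Lemma integrable_EFinB (f g : T -> R) : mu.-integrable D (EFin \o f) ->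
  mu.-integrable D (EFin \o g) -> mu.-integrable D (EFin \o (fun x => f x - g x)).
Proof. by move=> i1 i2; have := integrableB mD i1 i2; apply: eq_integrable. Qed.

Lemma integrable_EFinZ (c : R) (f : T -> R) : mu.-integrable D (EFin \o f) ->
  mu.-integrable D (EFin \o (fun x => c * f x)).
Proof. by move=> i1; have := integrableZl mD c i1; apply: eq_integrable. Qed.

Lemma integrable_EFin_sum (I : Type) (s : seq I) (f : I -> T -> R) :
  (forall i, mu.-integrable D (EFin \o f i)) ->
  mu.-integrable D (EFin \o (fun x => \sum_(i <- s) f i x)).
Proof.
move=> fi; have := @integrable_sum _ _ R mu D mD I s xpredT (fun i => EFin \o f i) (fun i _ => fi i).
by apply: eq_integrable => // x _ /=; rewrite sumEFin.
Qed.

Lemma Rintegral_sum (I : Type) (s : seq I) (f : I -> T -> R) :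
  (forall i, mu.-integrable D (EFin \o f i)) ->
  \int[mu]_(x in D) (\sum_(i <- s) f i x) = \sum_(i <- s) \int[mu]_(x in D) f i x.
Proof.
move=> fi; elim: s => [|i s IH].
  by under eq_Rintegral do rewrite big_nil; rewrite big_nil /Rintegral integral0.
under eq_Rintegral do rewrite big_cons.
by rewrite RintegralD ?IH ?big_cons//; exact: integrable_EFin_sum.
Qed.

Lemma Rintegral_dct (f_ : nat -> T -> R) (f g : T -> R) :
  (forall m, measurable_fun D (f_ m)) ->
  (forall x, D x -> f_ ^~ x @ \oo --> f x) ->
  mu.-integrable D (EFin \o g) ->
  (forall m x, D x -> `|f_ m x| <= g x) ->
  (fun m => \int[mu]_(x in D) f_ m x) @ \oo --> \int[mu]_(x in D) f x.
Proof.
move=> mf cf ig fg.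
have cfE x : D x -> (EFin \o f_^~ x) @ \oo --> (f x)%:E.
  by move=> Dx; apply: cvg_EFin; [exact: nearW|exact: cf].
have := @dominated_cvg _ _ R mu D mD (fun m => EFin \o f_ m) (EFin \o f) (EFin \o g).
move=> /(_ (fun m => proj2 (measurable_EFinP _ _) (mf m)) cfE (fun _ _ => erefl) ig).
have h m x : D x -> (`|(EFin \o f_ m) x| <= (EFin \o g) x)%E.
  by move=> Dx; rewrite lee_fin; exact: fg.
move=> /(_ h).
have mlim : measurable_fun D f.
  by apply: measurable_fun_cvg mf _ => // x Dx; exact: cf.
have fl x : D x -> `|f x| <= g x.
  move=> Dx; have cn : (fun m => `|f_ m x|) @ \oo --> `|f x| by apply: cvg_norm; exact: cf.
  rewrite -(cvg_lim _ cn)//; apply: limr_le; first by apply/cvg_ex; exists `|f x|.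
  by apply: nearW => m; exact: fg.
have i_f := integrable_dominated mlim ig fl.
rewrite [X in _ --> X](EFin_Rintegral i_f) => /fine_cvgP[_].
by [].
Qed.

Definition sqint (f : T -> R) := measurable_fun D f /\
  (\int[mu]_(x in D) (f x ^+ 2)%:E < +oo)%E.

Lemma sqint_sqr (f : T -> R) : sqint f -> mu.-integrable D (EFin \o (fun x => f x ^+ 2)).
Proof.
case=> mf f2; apply: integrable_EFinP; first exact: measurable_funX.
by under eq_integral do rewrite ger0_norm ?sqr_ge0//.
Qed.

Lemma sqint_dominated (f g : T -> R) : measurable_fun D f ->
  mu.-integrable D (EFin \o g) -> (forall x, D x -> f x ^+ 2 <= g x) -> sqint f.
Proof.
move=> mf ig fg; split => //; have : mu.-integrable D (EFin \o (fun x => f x ^+ 2)).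
  apply: (integrable_dominated _ ig); first exact: measurable_funX.
  by move=> x Dx; rewrite ger0_norm ?sqr_ge0// fg.
move=> /integrableP[_]; apply: le_lt_trans; apply: ge0_le_integral => //.
- by move=> x _; rewrite lee_fin sqr_ge0.
- by apply/measurable_EFinP; exact: measurable_funX.
- by apply: measurableT_comp => //; apply/measurable_EFinP; exact: measurable_funX.
- by move=> x _ /=; rewrite lee_fin ler_norm.
Qed.

Lemma sqintM (f g : T -> R) : sqint f -> sqint g ->
  mu.-integrable D (EFin \o (fun x => f x * g x)).
Proof.
move=> sf sg; apply: (@integrable_dominated _ (fun x => f x ^+ 2 + g x ^+ 2)).
- by apply: measurable_funM; [exact: sf.1|exact: sg.1].
- by apply: integrable_EFinD; exact: sqint_sqr.
- move=> x _; rewrite ler_norml; apply/andP; split; last by nra.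
  by nra.
Qed.

Lemma sqintD (f g : T -> R) : sqint f -> sqint g -> sqint (fun x => f x + g x).
Proof.
move=> sf sg; apply: (@sqint_dominated _ (fun x => 2 * (f x ^+ 2 + g x ^+ 2))).
- by apply: measurable_funD; [exact: sf.1|exact: sg.1].
- by apply: integrable_EFinZ; apply: integrable_EFinD; exact: sqint_sqr.
- by move=> x _; have := sqr_ge0 (f x - g x); nra.
Qed.

Lemma sqintZ c (f : T -> R) : sqint f -> sqint (fun x => c * f x).
Proof.
move=> sf; apply: (@sqint_dominated _ (fun x => c ^+ 2 * f x ^+ 2)).
- by apply: measurable_funM => //; exact: sf.1.
- by apply: integrable_EFinZ; exact: sqint_sqr.
- by move=> x _; rewrite exprMn.
Qed.

Lemma sqintB (f g : T -> R) : sqint f -> sqint g -> sqint (fun x => f x - g x).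
Proof.
move=> sf sg; have := sqintD sf (sqintZ (-1) sg).
by congr sqint; apply/funext => x; rewrite mulN1r.
Qed.

Lemma Rintegral_sqr_ge0 (f : T -> R) : 0 <= \int[mu]_(x in D) f x ^+ 2.
Proof. by apply: Rintegral_ge0 => x _; exact: sqr_ge0. Qed.

(** The integral of (s f + t g)^2 is a nonnegative quadratic form in
    (s, t). *)
Lemma Rintegral_CS (f g : T -> R) : sqint f -> sqint g ->
  (\int[mu]_(x in D) (f x * g x)) ^+ 2 <=
  (\int[mu]_(x in D) f x ^+ 2) * (\int[mu]_(x in D) g x ^+ 2).
Proof.
move=> sf sg.
set a := \int[mu]_(x in D) f x ^+ 2; set b := \int[mu]_(x in D) (f x * g x).
set c := \int[mu]_(x in D) g x ^+ 2.
have q (s t : R) : 0 <= s ^+ 2 * a + 2 * s * t * b + t ^+ 2 * c.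
  have : 0 <= \int[mu]_(x in D) (s * f x + t * g x) ^+ 2 by exact: Rintegral_sqr_ge0.
  have -> : \int[mu]_(x in D) (s * f x + t * g x) ^+ 2 =
    \int[mu]_(x in D) (s ^+ 2 * f x ^+ 2 + 2 * s * t * (f x * g x) + t ^+ 2 * g x ^+ 2).
    by congr Rintegral; apply/funext => x; ring.
  have i1 := sqint_sqr sf; have i2 := sqint_sqr sg; have i3 := sqintM sf sg.
  rewrite RintegralD//; last 2 first.
  - by apply: integrable_EFinD; apply: integrable_EFinZ.
  - by apply: integrable_EFinZ.
  rewrite RintegralD//; last 2 first.
  - by apply: integrable_EFinZ.
  - by apply: integrable_EFinZ.
  by rewrite !RintegralZl.
have a0 : 0 <= a by exact: Rintegral_sqr_ge0.
have c0 : 0 <= c by exact: Rintegral_sqr_ge0.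
have [a_gt0|] := ltP 0 a; last first.
  move=> ale0; have aE : a = 0 by apply/eqP; rewrite eq_le ale0.
  (* If a = 0 the form is affine in s, and it is nonnegative only if b = 0. *)
  rewrite aE mul0r; have := q (- (c + 1) * b) 1; have := q (- (c + 1)) b; rewrite aE.
  by nra.
(* The minimum over s of the form at t = 1, up to scaling. *)
have := q b (- a); rewrite (_ : _ + _ = a * (a * c - b ^+ 2)); last by ring.
by rewrite pmulr_rge0// subr_ge0.
Qed.

(** Membership in H^1_0 is stated through extended-real integrals of
    squares, which may be infinite for finitely many m; from some m on
    they are finite, which makes f square integrable. Inner products
    then converge by the Cauchy-Schwarz inequality, and squared norms by
    expanding the square. *)
Lemma sqint_lim (f_ : nat -> T -> R) (f : T -> R) :
  (forall m, sqint (f_ m)) -> measurable_fun D f ->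
  (fun m => \int[mu]_(x in D) ((f_ m x - f x) ^+ 2)%:E)%E @ \oo --> 0%E ->
  [/\ sqint f,
     (fun m => \int[mu]_(x in D) (f_ m x - f x) ^+ 2) @ \oo --> 0,
     forall g, sqint g -> (fun m => \int[mu]_(x in D) (f_ m x * g x)) @ \oo --> \int[mu]_(x in D) (f x * g x) &
     (fun m => \int[mu]_(x in D) (f_ m x ^+ 2)) @ \oo --> \int[mu]_(x in D) (f x ^+ 2)].
Proof.
move=> sf mf /fine_cvgP[fin c0].
have sF : sqint f.
  case: fin => m _ /(_ m (leqnn m)) fm.
  have s1 : sqint (fun x => f_ m x - f x).
    split; first by apply: measurable_funB => //; exact: (sf m).1.
    by rewrite ltey_eq fm.
  have := sqintB (sf m) s1; congr sqint; apply/funext => x; ring.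
have sB m : sqint (fun x => f_ m x - f x) by exact: sqintB.
have weak g : sqint g -> (fun m => \int[mu]_(x in D) (f_ m x * g x)) @ \oo --> \int[mu]_(x in D) (f x * g x).
  move=> sg; apply/subr_cvg0.
  have E m : \int[mu]_(x in D) (f_ m x * g x) - \int[mu]_(x in D) (f x * g x) =
      \int[mu]_(x in D) ((f_ m x - f x) * g x).
    rewrite -RintegralB//; [|exact: sqintM|exact: sqintM].
    by congr Rintegral; apply/funext => x; rewrite mulrBl.
  apply/norm_cvg0P.
  under eq_fun do rewrite E.
  have c1 : (fun m => Num.sqrt ((\int[mu]_(x in D) (f_ m x - f x) ^+ 2) * \int[mu]_(x in D) g x ^+ 2)) @ \oo --> 0.
    have <- : Num.sqrt (0 * \int[mu]_(x in D) g x ^+ 2) = 0 by rewrite mul0r sqrtr0.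
    have c2 : (fun m => (\int[mu]_(x in D) (f_ m x - f x) ^+ 2) * \int[mu]_(x in D) g x ^+ 2) @ \oo -->
        0 * \int[mu]_(x in D) g x ^+ 2.
      by apply: cvgM; [exact: c0|exact: cvg_cst].
    exact: (cvg_comp _ _ c2 (@sqrt_continuous R _)).
  apply: (squeeze_cvgr _ _ c1); last exact: (cvg_cst 0).
  apply: nearW => m; rewrite normr_ge0/= -sqrtr_sqr ler_wsqrtr//.
  exact: Rintegral_CS.
split => //.
have E m : \int[mu]_(x in D) f_ m x ^+ 2 = \int[mu]_(x in D) (f_ m x - f x) ^+ 2 +
   (2 * \int[mu]_(x in D) (f_ m x * f x) - \int[mu]_(x in D) f x ^+ 2).
  rewrite -RintegralZl//; last exact: sqintM.
  rewrite -RintegralB//; last 2 first.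
  - by apply: integrable_EFinZ; exact: sqintM.
  - exact: sqint_sqr.
  rewrite -RintegralD//; last 2 first.
  - exact: sqint_sqr.
  - by apply: integrable_EFinB; [apply: integrable_EFinZ; exact: sqintM|exact: sqint_sqr].
  by congr Rintegral; apply/funext => x; ring.
have EF : \int[mu]_(x in D) f x ^+ 2 = 0 + (2 * \int[mu]_(x in D) (f x * f x) - \int[mu]_(x in D) f x ^+ 2).
  by rewrite (_ : \int[mu]_(x in D) (f x * f x) = \int[mu]_(x in D) f x ^+ 2) ?add0r//; ring.
rewrite [X in _ --> X]EF (funext E); apply: cvgD => //; apply: cvgB; last exact: cvg_cst.
by apply: cvgM; [exact: cvg_cst|exact: weak].
Qed.

(** Expand the square of the distance between H and its projection onto
    the span of the F_j. Functions take values in R^p and the squared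
    norms c_j are arbitrary, because this is applied to the gradients of
    the eigenfunctions, for which p = n and c_j = lam_j. *)
Lemma Bessel (k p : nat) (F : 'I_k -> 'I_p -> T -> R) (H : 'I_p -> T -> R) (c : 'I_k -> R) :
  (forall j l, sqint (F j l)) -> (forall l, sqint (H l)) -> (forall j, 0 < c j) ->
  (forall i j, \sum_l \int[mu]_(x in D) (F i l x * F j l x) = (i == j)%:R * c j) ->
  \sum_j (\sum_l \int[mu]_(x in D) (F j l x * H l x)) ^+ 2 / c j <=
  \sum_l \int[mu]_(x in D) (H l x ^+ 2).
Proof.
move=> sF sH c0 orth.
pose b j := \sum_l \int[mu]_(x in D) (F j l x * H l x).
pose a j := b j / c j.
have pos : 0 <= \sum_l \int[mu]_(x in D) (H l x - \sum_j a j * F j l x) ^+ 2.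
  by apply: sumr_ge0 => l _; exact: Rintegral_sqr_ge0.
have E l : \int[mu]_(x in D) (H l x - \sum_j a j * F j l x) ^+ 2 =
    \int[mu]_(x in D) (H l x ^+ 2) - 2 * (\sum_j a j * \int[mu]_(x in D) (F j l x * H l x)) +
    \sum_i \sum_j a i * a j * \int[mu]_(x in D) (F i l x * F j l x).
  have iFH j : mu.-integrable D (EFin \o (fun x => F j l x * H l x)) by exact: sqintM.
  have iFF i j : mu.-integrable D (EFin \o (fun x => F i l x * F j l x)) by exact: sqintM.
  have i1 j : mu.-integrable D (EFin \o (fun x => a j * (F j l x * H l x))) by exact: integrable_EFinZ.
  have i2 i j : mu.-integrable D (EFin \o (fun x => a i * a j * (F i l x * F j l x))) by exact: integrable_EFinZ.
  have i3 i : mu.-integrable D (EFin \o (fun x => \sum_j a i * a j * (F i l x * F j l x))) by exact: integrable_EFin_sum.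
  have iH := sqint_sqr (sH l).
  have s1 : mu.-integrable D (EFin \o (fun x => \sum_j a j * (F j l x * H l x))) by exact: integrable_EFin_sum.
  have s2 : mu.-integrable D (EFin \o (fun x => \sum_i \sum_j a i * a j * (F i l x * F j l x))) by exact: integrable_EFin_sum.
  have -> : \sum_j a j * \int[mu]_(x in D) (F j l x * H l x) =
     \int[mu]_(x in D) (\sum_j a j * (F j l x * H l x)).
    by rewrite Rintegral_sum//; apply: eq_bigr => j _; rewrite RintegralZl.
  have -> : \sum_i \sum_j a i * a j * \int[mu]_(x in D) (F i l x * F j l x) =
     \int[mu]_(x in D) (\sum_i \sum_j a i * a j * (F i l x * F j l x)).
    rewrite Rintegral_sum//; apply: eq_bigr => i _; rewrite Rintegral_sum//.
    by apply: eq_bigr => j _; rewrite RintegralZl.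
  rewrite -RintegralZl// -RintegralB//; last exact: integrable_EFinZ.
  rewrite -RintegralD//; last by apply: integrable_EFinB => //; exact: integrable_EFinZ.
  congr Rintegral; apply/funext => x.
  rewrite sqrrB (mulrC (H l x)) mulr_suml; congr (_ - _ + _).
    by rewrite -mulr_natl; congr (_ * _); apply: eq_bigr => j _; rewrite mulrA.
  rewrite expr2 mulr_suml; apply: eq_bigr => i _; rewrite mulr_sumr.
  by apply: eq_bigr => j _; rewrite mulrACA.
move: pos; under eq_bigr do rewrite E.
rewrite big_split/= sumrB -mulr_sumr exchange_big/=.
under [X in 2 * X]eq_bigr do rewrite -mulr_sumr.
have -> : \sum_l \sum_i \sum_j a i * a j * \int[mu]_(x in D) (F i l x * F j l x) =
   \sum_j a j * b j.
  rewrite exchange_big/=; apply: eq_bigr => i _; rewrite exchange_big/=.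
  under eq_bigr do rewrite -mulr_sumr orth.
  rewrite (bigD1 i)//= eqxx big1 ?addr0; last first.
    by move=> j; rewrite eq_sym => /negbTE ->; rewrite mul0r mulr0.
  by rewrite mul1r /a -!mulrA; congr (_ * _); field; rewrite gt_eqF.
rewrite -/(b _); under [X in 2 * X]eq_bigr do rewrite -/(b _).
have -> : \sum_j (\sum_l \int[mu]_(x in D) (F j l x * H l x)) ^+ 2 / c j = \sum_j a j * b j.
  by apply: eq_bigr => j _; rewrite -/(b j) /a expr2 mulrAC.
by lra.
Qed.

Lemma Bessel1 (k : nat) (F : 'I_k -> T -> R) (H : T -> R) :
  (forall j, sqint (F j)) -> sqint H ->
  (forall i j, \int[mu]_(x in D) (F i x * F j x) = (i == j)%:R) ->
  \sum_j (\int[mu]_(x in D) (F j x * H x)) ^+ 2 <= \int[mu]_(x in D) (H x ^+ 2).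
Proof.
move=> sF sH orth.
have := @Bessel k 1 (fun j _ => F j) (fun _ => H) (fun=> 1) (fun j _ => sF j) (fun _ => sH) (fun _ => ltr01).
rewrite [\sum_(i < 1) \int[mu]_(x in D) (H x ^+ 2)]big_ord1 => B.
apply: le_trans (B _); last by move=> i j; rewrite big_ord1 orth mulr1.
rewrite le_eqVlt; apply/orP; left; apply/eqP; apply: eq_bigr => j _.
by rewrite big_ord1 divr1.
Qed.

End Rintegral_tools.

(** * Fubini's theorem under a product bound *)

Section fubini_dom.
Context {R : realType} d1 d2 (T1 : measurableType d1) (T2 : measurableType d2).
Variables (m1 : {sigma_finite_measure set T1 -> \bar R}) (m2 : {sigma_finite_measure set T2 -> \bar R}).

Lemma measurable_Rintegral_param (f : T1 * T2 -> R) : measurable_fun setT f ->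
  measurable_fun setT (fun x => \int[m2]_y f (x, y)).
Proof.
move=> mf; have mfE : measurable_fun setT (EFin \o f) by exact/measurable_EFinP.
apply: (measurableT_comp (@fine_measurable R setT measurableT)).
rewrite (_ : (fun x => _) = fun x => (\int[m2]_y ((EFin \o f)^\+ (x, y)) - \int[m2]_y ((EFin \o f)^\- (x, y)))%E); last first.
  by apply/funext => x; rewrite integralE; congr (_ - _)%E; apply: eq_integral => y _; rewrite ?funeposE ?funenegE.
apply: emeasurable_funB.
  by apply: (measurable_fun_fubini_tonelli_F ((EFin \o f)^\+)%E) => //; exact: measurable_funepos.
by apply: (measurable_fun_fubini_tonelli_F ((EFin \o f)^\-)%E) => //; exact: measurable_funeneg.
Qed.

Lemma Rintegral_Fubini_dom (f : T1 * T2 -> R) (g : T1 -> R) (h : T2 -> R) :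
  measurable_fun setT f -> m1.-integrable setT (EFin \o g) -> m2.-integrable setT (EFin \o h) ->
  (forall x y, `|f (x, y)| <= g x * h y) ->
  \int[m1]_x \int[m2]_y f (x, y) = \int[m2]_y \int[m1]_x f (x, y).
Proof.
move=> mf ig ih fgh.
have mfE : measurable_fun setT (EFin \o f) by exact/measurable_EFinP.
have i1 x : m2.-integrable setT (EFin \o (fun y => f (x, y))).
  apply: (@integrable_dominated _ _ _ _ _ measurableT _ (fun y => g x * h y)) => //.
  - by apply: (measurableT_comp mf); exact: pair1_measurable.
  - exact: integrable_EFinZ.
have i2 y : m1.-integrable setT (EFin \o (fun x => f (x, y))).
  apply: (@integrable_dominated _ _ _ _ _ measurableT _ (fun x => h y * g x)) => //.
  - by apply: (measurableT_comp mf); exact: pair2_measurable.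
  - exact: integrable_EFinZ.
  - by move=> x _; rewrite mulrC.
have mg : measurable_fun setT g by apply/measurable_EFinP; exact: measurable_int ig.
have mh : measurable_fun setT h by apply/measurable_EFinP; exact: measurable_int ih.
have ifp : (m1 \x m2)%E.-integrable setT (EFin \o f).
  apply/integrable12ltyP => //.
  apply: (@le_lt_trans _ _ (\int[m1]_x (`|g x|%:E * \int[m2]_y `|h y|%:E))%E).
    apply: ge0_le_integral => //.
    - by move=> x _; exact: integral_ge0.
    - apply: (measurable_fun_fubini_tonelli_F (fun p => `|(f p)%:E|%E)) => //.
      exact: measurableT_comp.
    - apply: emeasurable_funM => //; apply/measurable_EFinP; exact: measurableT_comp.
    move=> x _; rewrite -ge0_integralZl//; last first.
      by apply/measurable_EFinP; exact: measurableT_comp.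
    apply: ge0_le_integral => //.
    - apply: measurableT_comp => //; apply/measurable_EFinP; apply: (measurableT_comp mf).
      exact: pair1_measurable.
    - by apply: measurable_funeM; apply/measurable_EFinP; exact: measurableT_comp.
    - by move=> y _; rewrite -EFinM lee_fin -normrM (le_trans (fgh x y))// ler_norm.
  move/integrableP: (ig) => [_ ig']; move/integrableP: (ih) => [_ ih'].
  rewrite ge0_integralZr//; last 2 first.
  - by apply/measurable_EFinP; exact: measurableT_comp.
  - exact: integral_ge0.
  by rewrite lte_mul_pinfty ?integral_ge0// ge0_fin_numE ?integral_ge0.
have := @Fubini _ _ _ _ R m1 m2 (EFin \o f) ifp.
under eq_integral do rewrite /= EFin_Rintegral//.
under [X in _ = X -> _]eq_integral do rewrite /= EFin_Rintegral//.
by move=> h'; rewrite /Rintegral h'.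
Qed.

End fubini_dom.

(** * Damped Plancherel identity *)

Section fourier.
Context {R : realType} (n : nat).
Notation leb := (lebesgue_row R n).
Implicit Types (phi : 'rV[R]_n -> R) (x xi w : 'rV[R]_n).

Lemma integrable_affine x (c : R) phi : 0 < c -> leb.-integrable setT (EFin \o phi) ->
  leb.-integrable setT (EFin \o (fun w => phi (x + c *: w))).
Proof.
move=> c0 iphi; have /measurable_EFinP mphi := measurable_int _ iphi.
apply: integrable_EFinP.
  by apply: (measurableT_comp mphi); exact: measurable_row_affine.
have /integrableP[_] := iphi.
have mn : measurable_fun setT (fun x => `|phi x|%:E) by apply/measurable_EFinP; exact: measurableT_comp.
have nn y : (0 <= `|phi y|%:E)%E by rewrite lee_fin.
have /= <- := @ge0_integral_affine R n x c (fun x => `|phi x|%:E) c0 mn nn.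
have I0 : (0 <= \int[leb]_w `|phi (x + c *: w)|%:E)%E by exact: integral_ge0.
case: integral I0 => [r _ _||//]; first by rewrite ltry.
by rewrite gt0_muley ?lte_fin ?exprn_gt0.
Qed.

Lemma Rintegral_affine x (c : R) phi : 0 < c -> leb.-integrable setT (EFin \o phi) ->
  \int[leb]_w phi (x + c *: w) = (c ^+ n)^-1 * \int[leb]_y phi y.
Proof.
move=> c0 iphi; have ia := integrable_affine x c0 iphi.
have cn0 : c ^+ n != 0 by rewrite expf_neq0// gt_eqF.
have := measurable_int _ iphi => mphi.
have p := @ge0_integral_affine R n x c _ c0 (measurable_funepos mphi) (fun=> funepos_ge0 _ _).
have q := @ge0_integral_affine R n x c _ c0 (measurable_funeneg mphi) (fun=> funeneg_ge0 _ _).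
apply: (mulfI cn0); rewrite mulrA divff// mul1r.
apply: EFin_inj; rewrite EFinM -!EFin_Rintegral//.
rewrite integralE [RHS]integralE -p -q muleBr//.
  by congr (_ * _ - _ * _)%E; apply: eq_integral => w _; rewrite ?funeposE ?funenegE.
apply: fin_num_adde_defl; rewrite fin_numN.
exact: (integrable_neg_fin_num measurableT ia).
Qed.

Lemma Rintegral_translate x phi : leb.-integrable setT (EFin \o phi) ->
  \int[leb]_w phi (x + w) = \int[leb]_y phi y.
Proof.
move=> iphi; have := Rintegral_affine x ltr01 iphi; rewrite expr1n invr1 mul1r => <-.
by congr Rintegral; apply/funext => w; rewrite scale1r.
Qed.

Lemma integrable_translate x phi : leb.-integrable setT (EFin \o phi) ->
  leb.-integrable setT (EFin \o (fun w => phi (x + w))).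
Proof.
move=> iphi; have := integrable_affine x ltr01 iphi.
by apply: eq_integrable => // w _ /=; rewrite scale1r.
Qed.

(** Up to sign, [FTc] and [FTs] are the real and the imaginary part of
    the Fourier transform of phi restricted to D. *)
Definition FTc (D : set 'rV[R]_n) phi xi := \int[leb]_(x in D) (phi x * cos (dot xi x)).
Definition FTs (D : set 'rV[R]_n) phi xi := \int[leb]_(x in D) (phi x * sin (dot xi x)).

Lemma norm_cos_le1 (t : R) : `|cos t| <= 1.
Proof. by rewrite ler_norml cos_geN1 cos_le1. Qed.

Lemma norm_sin_le1 (t : R) : `|sin t| <= 1.
Proof. by rewrite ler_norml sin_geN1 sin_le1. Qed.

Lemma measurable_cos_dot xi (D : set 'rV[R]_n) : measurable D -> measurable_fun D (fun x => cos (dot xi x)).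
Proof.
move=> mD; apply: measurable_funTS; apply: (measurableT_comp measurable_cosR).
by apply: measurable_dot => //; exact: measurable_id.
Qed.

Lemma measurable_sin_dot xi (D : set 'rV[R]_n) : measurable D -> measurable_fun D (fun x => sin (dot xi x)).
Proof.
move=> mD; apply: measurable_funTS; apply: (measurableT_comp measurable_sinR).
by apply: measurable_dot => //; exact: measurable_id.
Qed.

Lemma integrable_mul_bounded (D : set 'rV[R]_n) phi (psi : 'rV[R]_n -> R) : measurable D ->
  leb.-integrable D (EFin \o phi) -> measurable_fun D psi -> (forall x, `|psi x| <= 1) ->
  leb.-integrable D (EFin \o (fun x => phi x * psi x)).
Proof.
move=> mD iphi mpsi psi1; have /measurable_EFinP mphi := measurable_int _ iphi.
apply: (@integrable_dominated _ _ _ _ _ mD _ (fun x => `|phi x|)).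
- exact: measurable_funM.
- exact: (integrable_norm iphi).
- by move=> x _; rewrite normrM ler_piMr.
Qed.

Lemma norm_FTc_le (D : set 'rV[R]_n) phi xi : measurable D -> leb.-integrable D (EFin \o phi) ->
  `|FTc D phi xi| <= \int[leb]_(x in D) `|phi x|.
Proof.
move=> mD iphi.
have ic : leb.-integrable D (EFin \o (fun x => phi x * cos (dot xi x))).
  by apply: integrable_mul_bounded => //; [exact: measurable_cos_dot|move=> x; exact: norm_cos_le1].
apply: (le_trans (le_normr_Rintegral mD ic)).
apply: le_Rintegral => //.
- exact: (integrable_norm ic).
- exact: (integrable_norm iphi).
- by move=> x _; rewrite normrM ler_piMr// norm_cos_le1.
Qed.

Lemma norm_FTs_le (D : set 'rV[R]_n) phi xi : measurable D -> leb.-integrable D (EFin \o phi) ->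
  `|FTs D phi xi| <= \int[leb]_(x in D) `|phi x|.
Proof.
move=> mD iphi.
have ic : leb.-integrable D (EFin \o (fun x => phi x * sin (dot xi x))).
  by apply: integrable_mul_bounded => //; [exact: measurable_sin_dot|move=> x; exact: norm_sin_le1].
apply: (le_trans (le_normr_Rintegral mD ic)).
apply: le_Rintegral => //.
- exact: (integrable_norm ic).
- exact: (integrable_norm iphi).
- by move=> x _; rewrite normrM ler_piMr// norm_sin_le1.
Qed.

Section regularized.
Variables (phi : 'rV[R]_n -> R) (M : R).
Hypotheses (iphi : leb.-integrable setT (EFin \o phi)) (phiM : forall x, `|phi x| <= M).
Let mphi : measurable_fun setT phi.
Proof. by apply/measurable_EFinP; exact: measurable_int iphi. Qed.
Let Fc := FTc setT phi.
Let Fs := FTs setT phi.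
Let N := \int[leb]_x `|phi x|.

Let ic xi : leb.-integrable setT (EFin \o (fun x => phi x * cos (dot xi x))).
Proof.
by apply: integrable_mul_bounded => //; [exact: measurable_cos_dot|move=> x; exact: norm_cos_le1].
Qed.

Let isn xi : leb.-integrable setT (EFin \o (fun x => phi x * sin (dot xi x))).
Proof.
by apply: integrable_mul_bounded => //; [exact: measurable_sin_dot|move=> x; exact: norm_sin_le1].
Qed.

Let Fc_le xi : `|Fc xi| <= N.
Proof. exact: norm_FTc_le. Qed.

Let Fs_le xi : `|Fs xi| <= N.
Proof. exact: norm_FTs_le. Qed.

Lemma measurable_FTc : measurable_fun setT Fc.
Proof.
apply: (@measurable_Rintegral_param R _ _ _ _ leb (fun p : 'rV[R]_n * 'rV[R]_n => phi p.2 * cos (dot p.1 p.2))).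
apply: measurable_funM; first exact: measurableT_comp mphi _.
by apply: (measurableT_comp measurable_cosR); exact: measurable_dot.
Qed.

Lemma measurable_FTs : measurable_fun setT Fs.
Proof.
apply: (@measurable_Rintegral_param R _ _ _ _ leb (fun p : 'rV[R]_n * 'rV[R]_n => phi p.2 * sin (dot p.1 p.2))).
apply: measurable_funM; first exact: measurableT_comp mphi _.
by apply: (measurableT_comp measurable_sinR); exact: measurable_dot.
Qed.

Lemma integrable_expw_scale (c : R) : 0 < c -> leb.-integrable setT (EFin \o (fun xi => expw (c *: xi))).
Proof.
move=> c0; have := integrable_affine 0 c0 (@integrable_expw R n).
by apply: eq_integrable => // w _ /=; rewrite add0r.
Qed.

Lemma measurable_expw_scale (c : R) : measurable_fun setT (fun xi : 'rV[R]_n => expw (c *: xi)).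
Proof.
have := measurableT_comp (@measurable_expw R n) (@measurable_row_affine R n 0 c).
by under [X in measurable_fun _ X]eq_fun do rewrite /= add0r.
Qed.

Lemma integrable_regularized (c : R) : 0 < c ->
  leb.-integrable setT (EFin \o (fun xi => expw (c *: xi) * (Fc xi ^+ 2 + Fs xi ^+ 2))).
Proof.
move=> c0; apply: (@integrable_dominated _ _ _ _ _ measurableT _ (fun xi => 2 * N ^+ 2 * expw (c *: xi))).
- apply: measurable_funM; first exact: measurable_expw_scale.
  by apply: measurable_funD; apply: measurable_funX; [exact: measurable_FTc|exact: measurable_FTs].
- by apply: integrable_EFinZ => //; exact: integrable_expw_scale.
- move=> xi _; rewrite normrM ger0_norm ?expw_ge0// mulrC ler_wpM2r ?expw_ge0//.
  rewrite ger0_norm ?addr_ge0 ?sqr_ge0// -[X in X <= _]/(Fc xi ^+ 2 + Fs xi ^+ 2).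
  rewrite -(real_normK (num_real (Fc xi))) -(real_normK (num_real (Fs xi))) mulr_natl mulr2n.
  have sq a : `|a| <= N -> `|a| ^+ 2 <= N ^+ 2 by move=> h; rewrite lerXn2r ?nnegrE ?(le_trans _ h).
  by apply: lerD; apply: sq.
Qed.

Lemma Rintegral_expw_cos_scale (c : R) w : 0 < c ->
  \int[leb]_xi (expw (c *: xi) * cos (dot xi (c *: w))) = (c ^+ n)^-1 * poisson w.
Proof.
move=> c0; rewrite -Rintegral_expw_cos -(@Rintegral_affine 0 c _ c0).
  by congr Rintegral; apply/funext => xi; rewrite add0r dotZr dotZl.
apply: integrable_mul_bounded => //; first exact: integrable_expw.
- by apply: (measurableT_comp measurable_cosR); apply: measurable_dot => //; exact: measurable_id.
- by move=> x; exact: norm_cos_le1.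
Qed.

(** The squared Fourier transform is a double integral of phi(x) phi(y)
    cos(xi.(y - x)). With the damping factor, the integral over xi can
    be performed first, and it yields the kernel [poisson] at
    (y - x) / c. *)
Lemma regularizedE (c : R) : 0 < c ->
  \int[leb]_xi (expw (c *: xi) * (Fc xi ^+ 2 + Fs xi ^+ 2)) =
  \int[leb]_x (phi x * \int[leb]_w (phi (x + c *: w) * poisson w)).
Proof.
move=> c0.
(* A xi x is the integral of phi(y) cos(xi.(y - x)) over y. *)
pose A xi x := cos (dot xi x) * Fc xi + sin (dot xi x) * Fs xi.
transitivity (\int[leb]_xi \int[leb]_x (expw (c *: xi) * (phi x * A xi x))).
  congr Rintegral; apply/funext => xi.
  have i1 : leb.-integrable setT (EFin \o (fun x => Fc xi * (phi x * cos (dot xi x)))) by exact: integrable_EFinZ.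
  have i2 : leb.-integrable setT (EFin \o (fun x => Fs xi * (phi x * sin (dot xi x)))) by exact: integrable_EFinZ.
  have E : (fun x => phi x * A xi x) = (fun x => Fc xi * (phi x * cos (dot xi x)) + Fs xi * (phi x * sin (dot xi x))).
    by apply/funext => x; rewrite /A; ring.
  rewrite RintegralZl//; last by rewrite E; exact: integrable_EFinD.
  by congr (_ * _); rewrite E RintegralD// !RintegralZl// !expr2.
rewrite (@Rintegral_Fubini_dom _ _ _ _ _ leb leb (fun p => expw (c *: p.1) * (phi p.2 * A p.1 p.2))
   (fun xi => 2 * N * expw (c *: xi)) (fun x => `|phi x|)); last 4 first.
- apply: measurable_funM; first exact: measurableT_comp (measurable_expw_scale c) _.
  apply: measurable_funM; first exact: measurableT_comp mphi _.
  apply: measurable_funD; apply: measurable_funM.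
  + by apply: (measurableT_comp measurable_cosR); exact: measurable_dot.
  + exact: measurableT_comp measurable_FTc _.
  + by apply: (measurableT_comp measurable_sinR); exact: measurable_dot.
  + exact: measurableT_comp measurable_FTs _.
- by apply: integrable_EFinZ => //; exact: integrable_expw_scale.
- exact: integrable_norm.
- move=> xi x /=; rewrite !normrM (ger0_norm (expw_ge0 _)).
  have -> : 2 * N * expw (c *: xi) * `|phi x| = expw (c *: xi) * (`|phi x| * (2 * N)) by ring.
  rewrite ler_wpM2l ?expw_ge0// ler_wpM2l// (le_trans (ler_normD _ _))// !normrM mulr_natl mulr2n lerD//.
    by rewrite -[leRHS]mul1r ler_pM// norm_cos_le1.
  by rewrite -[leRHS]mul1r ler_pM// norm_sin_le1.
congr Rintegral; apply/funext => x /=.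
transitivity (\int[leb]_xi (phi x * (expw (c *: xi) * A xi x))).
  by congr Rintegral; apply/funext => xi; rewrite mulrCA.
have AE xi : A xi x = \int[leb]_z (phi (x + z) * cos (dot xi z)).
  pose psi y := phi y * cos (dot xi (y - x)).
  have ipsi : leb.-integrable setT (EFin \o psi).
    apply: integrable_mul_bounded => //; last by move=> y; exact: norm_cos_le1.
    apply: (measurableT_comp measurable_cosR); apply: measurable_dot => //.
    have := @measurable_row_affine R n (- x) 1.
    by apply: eq_measurable_fun => y _; rewrite scale1r addrC.
  have -> : \int[leb]_z (phi (x + z) * cos (dot xi z)) = \int[leb]_y psi y.
    rewrite -(Rintegral_translate x ipsi); congr Rintegral; apply/funext => z.
    by rewrite /psi [x + z - x]addrC addKr.
  have i1 : leb.-integrable setT (EFin \o (fun y => cos (dot xi x) * (phi y * cos (dot xi y)))) by exact: integrable_EFinZ.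
  have i2 : leb.-integrable setT (EFin \o (fun y => sin (dot xi x) * (phi y * sin (dot xi y)))) by exact: integrable_EFinZ.
  rewrite /A /Fc /FTc /Fs /FTs -!RintegralZl// -RintegralD//.
  congr Rintegral; apply/funext => y; rewrite /psi dotDr -scaleN1r dotZr mulN1r cosB.
  by ring.
have mdot (f : R -> R) : measurable_fun setT f -> forall xi, measurable_fun setT (fun z => f (dot xi z)).
  by move=> mfu xi; apply: (measurableT_comp mfu); apply: measurable_dot => //; exact: measurable_id.
have mA : measurable_fun setT (A ^~ x).
  apply: measurable_funD; apply: measurable_funM; rewrite ?measurable_FTc ?measurable_FTs//.
  - by apply: (measurableT_comp measurable_cosR); apply: measurable_dot => //; exact: measurable_id.
  - exact: measurable_FTc.
  - by apply: (measurableT_comp measurable_sinR); apply: measurable_dot => //; exact: measurable_id.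
  - exact: measurable_FTs.
rewrite RintegralZl//; last first.
  apply: (@integrable_dominated _ _ _ _ _ measurableT _ (fun xi => 2 * N * expw (c *: xi))).
  - by apply: measurable_funM => //; exact: measurable_expw_scale.
  - by apply: integrable_EFinZ => //; exact: integrable_expw_scale.
  - move=> xi _; rewrite normrM (ger0_norm (expw_ge0 _)) mulrC ler_wpM2r ?expw_ge0//.
    rewrite (le_trans (ler_normD _ _))// !normrM mulr_natl mulr2n lerD//.
      by rewrite -[leRHS]mul1r ler_pM// norm_cos_le1.
    by rewrite -[leRHS]mul1r ler_pM// norm_sin_le1.
congr (_ * _).
transitivity (\int[leb]_xi \int[leb]_z (expw (c *: xi) * (phi (x + z) * cos (dot xi z)))).
  congr Rintegral; apply/funext => xi; rewrite AE RintegralZl//.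
  apply: (integrable_mul_bounded (phi := fun z => phi (x + z))) => //.
  - exact: integrable_translate.
  - exact: measurable_cos_dot.
  - by move=> z; exact: norm_cos_le1.
have mtr : measurable_fun setT (fun z => phi (x + z)).
  by apply/measurable_EFinP; exact: measurable_int (integrable_translate x iphi).
rewrite (@Rintegral_Fubini_dom _ _ _ _ _ leb leb (fun p => expw (c *: p.1) * (phi (x + p.2) * cos (dot p.1 p.2)))
   (fun xi => expw (c *: xi)) (fun z => `|phi (x + z)|)); last 4 first.
- apply: measurable_funM; first exact: measurableT_comp (measurable_expw_scale c) _.
  apply: measurable_funM; first exact: measurableT_comp mtr _.
  by apply: (measurableT_comp measurable_cosR); exact: measurable_dot.
- exact: integrable_expw_scale.
- by apply: integrable_norm; exact: integrable_translate.
- move=> xi z /=; rewrite !normrM (ger0_norm (expw_ge0 _)) ler_wpM2l ?expw_ge0//.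
  by rewrite ler_piMr// norm_cos_le1.
pose Q z := \int[leb]_xi (expw (c *: xi) * cos (dot xi z)).
have ice z : leb.-integrable setT (EFin \o (fun xi => expw (c *: xi) * cos (dot xi z))).
  apply: (integrable_mul_bounded (phi := fun xi => expw (c *: xi))) => //.
  - exact: integrable_expw_scale.
  - by apply: (measurableT_comp measurable_cosR); apply: measurable_dot => //; exact: measurable_id.
  - by move=> y; exact: norm_cos_le1.
have QE w : Q (c *: w) = (c ^+ n)^-1 * poisson w by exact: Rintegral_expw_cos_scale.
transitivity (\int[leb]_z (phi (x + z) * Q z)).
  congr Rintegral; apply/funext => z /=; rewrite -RintegralZl//.
  by congr Rintegral; apply/funext => xi; rewrite mulrCA.
have QE' z : Q z = (c ^+ n)^-1 * poisson (c^-1 *: z).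
  by rewrite -QE scalerA divff ?gt_eqF// scale1r.
have iphiQ : leb.-integrable setT (EFin \o (fun z => phi (x + z) * Q z)).
  apply: (@integrable_dominated _ _ _ _ _ measurableT _ (fun z => (c ^+ n)^-1 * 2 ^+ n * `|phi (x + z)|)).
  - apply: measurable_funM => //; rewrite (_ : Q = fun z => (c ^+ n)^-1 * poisson (c^-1 *: z)); last exact/funext.
    apply: measurable_funM => //; apply: (measurableT_comp (@measurable_poisson R n)).
    by have := @measurable_row_affine R n 0 c^-1; under [X in measurable_fun _ X]eq_fun do rewrite add0r.
  - by apply: integrable_EFinZ => //; apply: integrable_norm; exact: integrable_translate.
  - move=> z _; rewrite normrM mulrC ler_wpM2r// QE' ger0_norm; last first.
      by rewrite mulr_ge0 ?poisson_ge0// invr_ge0 exprn_ge0// ltW.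
    by rewrite ler_wpM2l ?poisson_le// invr_ge0 exprn_ge0// ltW.
have cn0 : c ^+ n != 0 by rewrite expf_neq0// gt_eqF.
apply: (mulfI (invr_neq0 cn0)); rewrite -(Rintegral_affine 0 c0 iphiQ).
transitivity (\int[leb]_w ((c ^+ n)^-1 * (phi (x + c *: w) * poisson w))).
  by congr Rintegral; apply/funext => w; rewrite add0r QE mulrCA.
rewrite RintegralZl//.
apply: (@integrable_dominated _ _ _ _ _ measurableT _ (fun w => M * poisson w)).
- apply: measurable_funM; last exact: measurable_poisson.
  by apply: (measurableT_comp mphi); exact: measurable_row_affine.
- by apply: integrable_EFinZ => //; exact: integrable_poisson.
- by move=> w _; rewrite normrM (ger0_norm (poisson_ge0 w)) ler_wpM2r ?poisson_ge0.
Qed.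

Hypothesis cphi : continuous phi.

(** Plancherel's identity, for bounded continuous integrable phi: the
    inner integral in [regularizedE] averages phi over a kernel that
    concentrates at x, and has (2 pi)^n phi(x) as its limit. *)
Lemma regularized_lim :
  (fun m : nat => \int[leb]_xi (expw (m.+1%:R^-1 *: xi) * (Fc xi ^+ 2 + Fs xi ^+ 2))) @ \oo -->
  (2 * pi) ^+ n * \int[leb]_x (phi x ^+ 2).
Proof.
pose c (m : nat) : R := m.+1%:R^-1.
have c0 m : 0 < c m by rewrite invr_gt0.
have c_cvg : c @ \oo --> 0 by exact: cvg_harmonic.
pose B m x := \int[leb]_w (phi (x + c m *: w) * poisson w).
rewrite (_ : (fun m => _) = fun m => \int[leb]_x (phi x * B m x)); last first.
  by apply/funext => m; rewrite regularizedE.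
have iP := @integrable_poisson R n.
have iMP : leb.-integrable setT (EFin \o (fun w => M * @poisson R n w)) by exact: integrable_EFinZ.
have mB0 m x : measurable_fun setT (fun w => phi (x + c m *: w) * poisson w).
  apply: measurable_funM; last exact: measurable_poisson.
  by apply: (measurableT_comp mphi); exact: measurable_row_affine.
have bB m x w : `|phi (x + c m *: w) * poisson w| <= M * poisson w.
  by rewrite normrM (ger0_norm (poisson_ge0 w)) ler_wpM2r ?poisson_ge0.
have iB m x : leb.-integrable setT (EFin \o (fun w => phi (x + c m *: w) * poisson w)).
  exact: (@integrable_dominated _ _ _ _ _ measurableT _ (fun w => M * poisson w)).
have Pint : \int[leb]_w poisson w = (2 * pi) ^+ n by rewrite /Rintegral integral_poisson.
have Bx x : (fun m => B m x) @ \oo --> (2 * pi) ^+ n * phi x.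
  have -> : (2 * pi) ^+ n * phi x = \int[leb]_w (phi x * poisson w).
    by rewrite RintegralZl// Pint mulrC.
  apply: (Rintegral_dct measurableT (g := fun w => M * poisson w)) => // w _.
  apply: cvgM; last exact: cvg_cst.
  apply: (cvg_comp (fun m => x + c m *: w) phi); last exact: cphi.
  have : (fun m => x + c m *: w) @ \oo --> x + 0 *: w.
    by apply: cvgD; [exact: cvg_cst|apply: cvgZ; [exact: c_cvg|exact: cvg_cst]].
  by rewrite scale0r addr0.
have Bbound m x : `|B m x| <= M * (2 * pi) ^+ n.
  apply: (le_trans (le_normr_Rintegral measurableT (iB m x))).
  rewrite -Pint -RintegralZl//; apply: le_Rintegral => //.
  exact: integrable_norm.
have -> : (2 * pi) ^+ n * \int[leb]_x (phi x ^+ 2) = \int[leb]_x (phi x * ((2 * pi) ^+ n * phi x)).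
  rewrite -RintegralZl//; first by congr Rintegral; apply/funext => x; ring.
  apply: (@integrable_dominated _ _ _ _ _ measurableT _ (fun x => M * `|phi x|)).
  - exact: measurable_funX.
  - by apply: integrable_EFinZ => //; exact: integrable_norm.
  - by move=> x _; rewrite expr2 normrM ler_wpM2r.
apply: (Rintegral_dct measurableT (g := fun x => M * (2 * pi) ^+ n * `|phi x|)) => //.
- move=> m; apply: measurable_funM => //.
  apply: (@measurable_Rintegral_param R _ _ _ _ leb (fun p : 'rV[R]_n * 'rV[R]_n => phi (p.1 + c m *: p.2) * poisson p.2)).
  apply: measurable_funM; last exact: measurableT_comp (@measurable_poisson R n) _.
  apply: (measurableT_comp mphi); apply: measurable_to_row => i.
  rewrite (_ : _ \o _ = fun p : 'rV[R]_n * 'rV[R]_n => (row_coord i p.1 : R) + c m * row_coord i p.2); last first.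
    by apply/funext => p /=; rewrite /row_coord !mxE.
  apply: measurable_funD; first exact: measurableT_comp (measurable_row_coord i) _.
  by apply: measurable_funM => //; exact: measurableT_comp (measurable_row_coord i) _.
- by move=> x _; apply: cvgM; [exact: cvg_cst|exact: Bx].
- by apply: integrable_EFinZ => //; exact: integrable_norm.
- by move=> m x _; rewrite normrM mulrC ler_wpM2r.
Qed.

End regularized.
End fourier.

(** * Test functions and integration by parts *)

Section compact_support.
Context {R : realType} (n : nat).
Notation leb := (lebesgue_row R n).
Implicit Types (phi f : 'rV[R]_n -> R) (x xi : 'rV[R]_n) (l : 'I_n).

Lemma norm_coord_le x l : `|x ord0 l| <= `|x|.
Proof.
rewrite [leRHS]/Num.Def.normr /= mx_normrE; apply/bigmax_geP; right => /=.
by exists (ord0, l).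
Qed.

(** The norm of row vectors is the maximum norm, so this is a cube. *)
Definition sup_ball (r : R) : set 'rV[R]_n := [set x | `|x| <= r].

Lemma measurable_sup_ball r : measurable (sup_ball r).
Proof.
have -> : sup_ball r = (fun x : 'rV[R]_n => `|x|) @^-1` `]-oo, r]%classic.
  by apply/seteqP; split => x /=; rewrite in_itv.
rewrite -[X in measurable X]setTI; apply: continuous_measurable_row => //.
by move=> x; exact: norm_continuous.
Qed.

Lemma sup_ball_lty r : (leb (sup_ball r) < +oo)%E.
Proof.
apply: (@le_lt_trans _ _ (leb [set x | forall i, `[- r, r]%classic (x ord0 i)])).
  apply: le_measure; rewrite ?inE; first exact: measurable_sup_ball.
    by apply: (@measurable_cylinder R n (fun=> `[- r, r]%classic)).
  move=> x /= xr i; rewrite in_itv/= -ler_norml.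
  exact: le_trans (norm_coord_le _ _) xr.
rewrite (@lebesgue_row_box _ _ (fun=> `[- r, r]%classic))//.
rewrite (eq_bigr (fun=> (fine (lebesgue_measure (`[- r, r]%classic : set (measurableTypeR R))))%:E)).
  by rewrite prodEFin ltry.
move=> i _; rewrite fineK// ge0_fin_numE//.
by rewrite lebesgue_measure_itv/=; case: ifP => _; rewrite ?ltry.
Qed.

Lemma integrable_indic_sup_ball r c :
  leb.-integrable setT (EFin \o (fun x => c * \1_(sup_ball r) x)).
Proof.
apply: integrable_EFinZ => //; apply: integrable_EFinP.
  by apply: measurable_indic; exact: measurable_sup_ball.
rewrite (eq_integral (fun x => (\1_(sup_ball r) x)%:E)); last first.
  by move=> x _; rewrite ger0_norm.
by rewrite integral_indic ?setIT ?sup_ball_lty//; exact: measurable_sup_ball.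
Qed.

Lemma integrable_csupp f r M : measurable_fun setT f -> (forall x, r < `|x| -> f x = 0) ->
  (forall x, `|f x| <= M) -> leb.-integrable setT (EFin \o f).
Proof.
move=> mf f0 fM; apply: (@integrable_dominated _ _ _ _ _ measurableT _ (fun x => M * \1_(sup_ball r) x)) => //.
  exact: integrable_indic_sup_ball.
move=> x _; rewrite indicE; case: (leP `|x| r) => xr.
  by rewrite mem_set// mulr1.
by rewrite f0// normr0 memNset ?mulr0//= => /(lt_le_trans xr); rewrite ltxx.
Qed.

Lemma csupp_bounded f (K : set 'rV[R]_n) : compact K -> continuous f ->
  (forall x, ~ K x -> f x = 0) -> exists M, forall x, `|f x| <= M.
Proof.
move=> cK cf f0; have : compact (f @` K).
  by apply: continuous_compact => //; exact: continuous_subspaceT.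
move=> /compact_bounded[M [_ /(_ (`|M| + 1))]].
rewrite (le_lt_trans (ler_norm M)) ?ltrDl// => /(_ isT) h.
exists (`|M| + 1) => x; have [Kx|nKx] := pselect (K x).
  by apply: h; exists x.
by rewrite f0// normr0 addr_ge0.
Qed.

Lemma csupp_radius (K : set 'rV[R]_n) : compact K -> exists r, forall x, K x -> `|x| <= r.
Proof.
move=> /compact_bounded[M [_ /(_ (`|M| + 1))]].
rewrite (le_lt_trans (ler_norm M)) ?ltrDl// => /(_ isT) h.
by exists (`|M| + 1).
Qed.

Section test_function.
Variables (Om : set 'rV[R]_n) (phi : 'rV[R]_n -> R) (tphi : test_function Om phi).
Let K := closure [set x | phi x != 0].

Lemma test_continuous : continuous phi.
Proof. by case: tphi => /(_ [::])[]. Qed.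

Lemma test_derivable x l : derivable phi x (delta_mx ord0 l).
Proof. by case: tphi => /(_ [::])[] _ /(_ x l). Qed.

Lemma test_partial_continuous l : continuous (partial l phi).
Proof. by case: tphi => /(_ [:: l])[]. Qed.

Lemma test_off x : ~ K x -> phi x = 0.
Proof.
move=> nK; apply/eqP; apply: contra_notT nK => h; exact: subset_closure.
Qed.

Lemma test_partial_off l x : ~ K x -> partial l phi x = 0.
Proof.
move=> nK; rewrite /partial (@near_eq_derive _ _ _ _ (cst 0)) ?derive_cst//.
have oK : open (~` K) by apply: closed_openC; exact: closed_closure.
have : nbhs x (~` K) by apply: open_nbhs_nbhs.
by apply: filterS => y; exact: test_off.
Qed.

Lemma test_compact : compact K. Proof. by case: tphi => _ []. Qed.
Lemma test_sub : K `<=` Om. Proof. by case: tphi => _ []. Qed.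

(** The increments of phi along a line are its directional increments at
    the translated point. *)
Lemma is_derive_line x l (t : R) :
  is_derive t 1 (fun t => phi (x + t *: delta_mx ord0 l)) (partial l phi (x + t *: delta_mx ord0 l)).
Proof.
set v := delta_mx ord0 l.
have E : (fun h : R => h^-1 *: (((fun t => phi (x + t *: v)) \o shift t) (h *: 1) - phi (x + t *: v))) =
   (fun h : R => h^-1 *: ((phi \o shift (x + t *: v)) (h *: v) - phi (x + t *: v))).
  apply/funext => h /=; congr (_ *: (phi _ - _)).
  have -> : h%:A = h by exact: mulr1.
  by rewrite scalerDl addrCA.
apply: DeriveDef; first by rewrite /derivable E; exact: test_derivable.
by rewrite /derive E.
Qed.

Lemma is_derive_test_wave x xi l (psi dpsi : R -> R) (t : R) :
  (forall s : R, is_derive s 1 psi (dpsi s)) ->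
  is_derive t 1 (fun t => phi (x + t *: delta_mx ord0 l) * psi (dot xi x + t * xi ord0 l))
   (partial l phi (x + t *: delta_mx ord0 l) * psi (dot xi x + t * xi ord0 l) +
    xi ord0 l * (phi (x + t *: delta_mx ord0 l) * dpsi (dot xi x + t * xi ord0 l))).
Proof.
move=> hpsi; have h1 := is_derive_line x l t.
have h2 : is_derive t 1 (fun t : R => dot xi x + t * xi ord0 l) (xi ord0 l).
  by apply: is_derive_eq; rewrite /GRing.scale /=; ring.
have h3 : is_derive t 1 (psi \o (fun t : R => dot xi x + t * xi ord0 l)) (dpsi (dot xi x + t * xi ord0 l) * xi ord0 l).
  by apply: is_derive1_comp.
rewrite (_ : (fun t => _) = (fun t : R => phi (x + t *: delta_mx ord0 l)) *
  (psi \o (fun t : R => dot xi x + t * xi ord0 l))); last exact/funext.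
apply: (is_derive_eq (is_deriveM h1 h3)).
by rewrite /GRing.scale /=; ring.
Qed.

Lemma dot_delta xi l : dot xi (delta_mx ord0 l) = xi ord0 l.
Proof.
rewrite /dot (bigD1 l)//= mxE !eqxx mulr1 big1 ?addr0// => i il.
by rewrite mxE (negbTE il) andbF mulr0.
Qed.

Lemma norm_delta_le l : `|delta_mx ord0 l : 'rV[R]_n| <= 1.
Proof.
rewrite [leLHS]/Num.Def.normr /= mx_normrE; apply/bigmax_leP; split => // -[i j] _ /=.
by rewrite mxE; case: (_ && _); rewrite ?normr1 ?normr0.
Qed.

Lemma test_integrable : leb.-integrable setT (EFin \o phi).
Proof.
have [M phiM] := csupp_bounded test_compact test_continuous test_off.
have [r rK] := csupp_radius test_compact.
apply: (@integrable_csupp _ r M) => //.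
- exact: continuous_measurable_row test_continuous.
- by move=> x rx; apply: test_off => /rK; rewrite leNgt rx.
Qed.

Lemma test_partial_integrable l : leb.-integrable setT (EFin \o partial l phi).
Proof.
have [M phiM] := csupp_bounded test_compact (@test_partial_continuous l) (@test_partial_off l).
have [r rK] := csupp_radius test_compact.
apply: (@integrable_csupp _ r M) => //.
- exact: continuous_measurable_row (@test_partial_continuous l).
- by move=> x rx; apply: test_partial_off => /rK; rewrite leNgt rx.
Qed.

(** The difference quotients in direction l of phi times the wave have
    integral zero, since Lebesgue measure is invariant under
    translations. By the mean value theorem they are bounded, uniformly
    and on a fixed ball, so that dominated convergence gives integral
    zero to the derivative of the product. *)
Lemma integration_by_parts_wave xi l (psi dpsi : R -> R) :
  (forall s : R, is_derive s 1 psi (dpsi s)) -> continuous dpsi ->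
  (forall s, `|psi s| <= 1) -> (forall s, `|dpsi s| <= 1) ->
  \int[leb]_x (partial l phi x * psi (dot xi x)) = - (xi ord0 l * \int[leb]_x (phi x * dpsi (dot xi x))).
Proof.
move=> hpsi cdpsi psi1 dpsi1.
have cpsi : continuous psi by move=> s; exact: is_derive_continuous (hpsi s).
have [M phiM] := csupp_bounded test_compact test_continuous test_off.
have [M' phiM'] := csupp_bounded test_compact (@test_partial_continuous l) (@test_partial_off l).
have [r rK] := csupp_radius test_compact.
have phi0 x : r < `|x| -> phi x = 0 by move=> rx; apply: test_off => /rK; rewrite leNgt rx.
set e := delta_mx ord0 l : 'rV[R]_n.
have mdot (g : R -> R) : continuous g -> measurable_fun setT (fun x : 'rV[R]_n => g (dot xi x)).
  move=> cg; apply: (measurableT_comp (continuous_measurable_fun cg)).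
  by apply: measurable_dot => //; exact: measurable_id.
pose Psi x := phi x * psi (dot xi x).
have iPsi : leb.-integrable setT (EFin \o Psi).
  by apply: integrable_mul_bounded => //; [exact: test_integrable|exact: mdot].
have i1 : leb.-integrable setT (EFin \o (fun x => partial l phi x * psi (dot xi x))).
  by apply: integrable_mul_bounded => //; [exact: test_partial_integrable|exact: mdot].
have i2 : leb.-integrable setT (EFin \o (fun x => phi x * dpsi (dot xi x))).
  by apply: integrable_mul_bounded => //; [exact: test_integrable|exact: mdot].
have mPsi : measurable_fun setT Psi by apply/measurable_EFinP; exact: measurable_int iPsi.
pose G x t := phi (x + t *: e) * psi (dot xi x + t * xi ord0 l).
pose dG x t := partial l phi (x + t *: e) * psi (dot xi x + t * xi ord0 l) +
    xi ord0 l * (phi (x + t *: e) * dpsi (dot xi x + t * xi ord0 l)).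
have GE x t : G x t = Psi (x + t *: e) by rewrite /G /Psi dotDr dotZr dot_delta.
have hG x (t : R) : is_derive t 1 (G x) (dG x t) by exact: is_derive_test_wave.
pose h (m : nat) : R := m.+1%:R^-1.
have h0 m : 0 < h m by rewrite invr_gt0.
have h1 m : h m <= 1 by rewrite invf_le1// ler1n.
have h_cvg : h @ \oo --> 0 by exact: cvg_harmonic.
(* Difference quotients of phi times the wave, with steps h m <= 1, so
   that their supports stay in the ball of radius r + 1. *)
pose q m x := (h m)^-1 * (G x (h m) - G x 0).
have q_cvg x : (fun m => q m x) @ \oo --> dG x 0.
  have [dv dE] := hG x 0.
  move: dv; rewrite /derivable => /cvg_ex[d hd].
  have dd : d = dG x 0 by rewrite -dE /derive; apply/esym/cvg_lim.
  have hh : (forall m, h m != 0) /\ h @ \oo --> (0 : R) by split => // m; rewrite gt_eqF.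
  move/cvgr_dnbhsP : hd => /(_ h hh); rewrite dd.
  rewrite (_ : (fun m => q m x) = (fun m => (h m)^-1 *: ((G x \o shift 0) ((h m)%:A) - G x 0)))//.
  apply/funext => m; rewrite /q /=; have -> : (h m)%:A = h m by exact: mulr1.
  by rewrite addr0.
have dGM x t : `|dG x t| <= M' + `|xi ord0 l| * M.
  have M0 : 0 <= M by apply: le_trans (phiM 0).
  rewrite (le_trans (ler_normD _ _))// !normrM lerD//.
    by rewrite -[leRHS]mulr1 ler_pM.
  by rewrite ler_wpM2l// -[leRHS]mulr1 ler_pM.
have q_bound m x : `|q m x| <= (M' + `|xi ord0 l| * M) * \1_(sup_ball (r + 1)) x.
  rewrite indicE; case: (leP `|x| (r + 1)) => xr.
    rewrite mem_set// mulr1 /q.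
    have [|c _ ->] := @MVT R (G x) (dG x) 0 (h m) (h0 m) (fun t _ => hG x t).
      by apply: continuous_subspaceT => t; exact: is_derive_continuous (hG x t).
    by rewrite subr0 mulrC mulfK ?gt_eqF.
  rewrite memNset ?mulr0//=; last by move=> /(lt_le_trans xr); rewrite ltxx.
  rewrite /q /G !phi0 ?mul0r ?subr0 ?mulr0 ?normr0//.
    by rewrite scale0r addr0 (lt_trans _ xr)// ltrDl.
  have : `|x| <= `|x + h m *: e| + 1.
    rewrite -{1}[x](addrK (h m *: e)) (le_trans (ler_normB _ _))// lerD2l normrZ.
    by rewrite (ger0_norm (ltW (h0 m))) -[leRHS]mulr1 ler_pM ?norm_delta_le// ltW.
  by move=> /(lt_le_trans xr); rewrite ltrD2r.
have q_int m : \int[leb]_x q m x = 0.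
  have ih (t : R) : leb.-integrable setT (EFin \o (G ^~ t)).
    have := integrable_translate (t *: e) iPsi.
    by apply: eq_integrable => // x _ /=; rewrite GE addrC.
  rewrite /q RintegralZl//; last by apply: integrable_EFinB.
  rewrite RintegralB//.
  have Gt (t : R) : \int[leb]_x G x t = \int[leb]_x Psi x.
    rewrite -(Rintegral_translate (t *: e) iPsi).
    by congr Rintegral; apply/funext => x; rewrite GE addrC.
  by rewrite !Gt subrr mulr0.
have mq m : measurable_fun setT (q m).
  have mG t : measurable_fun setT (G ^~ t).
    apply/measurable_EFinP; have := integrable_translate (t *: e) iPsi.
    move=> /measurable_int; apply: eq_measurable_fun => x _ /=; by rewrite GE addrC.
  by apply: measurable_funM => //; apply: measurable_funB.
have L := @Rintegral_dct _ _ _ leb setT measurableT q (dG ^~ 0) _ mq (fun x _ => q_cvg x) (integrable_indic_sup_ball _ _) (fun m x _ => q_bound m x).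
have : \int[leb]_x dG x 0 = 0.
  move: L; rewrite (_ : (fun m => _) = fun=> 0); last exact/funext.
  move=> /(cvg_unique _); apply => //; exact: cvg_cst.
rewrite (_ : (fun x => dG x 0) = fun x => partial l phi x * psi (dot xi x) + xi ord0 l * (phi x * dpsi (dot xi x))); last first.
  by apply/funext => x; rewrite /dG scale0r addr0 mul0r addr0.
rewrite RintegralD//; last exact: integrable_EFinZ.
by rewrite RintegralZl// => /eqP; rewrite addr_eq0 => /eqP.
Qed.

Lemma FTc_partial l xi : FTc setT (partial l phi) xi = xi ord0 l * FTs setT phi xi.
Proof.
rewrite /FTc (@integration_by_parts_wave _ _ (@cos R) (fun s => - sin s)).
- rewrite /FTs -mulrN; congr (_ * _).
  rewrite -[in LHS]mulN1r -RintegralZl//.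
    by congr Rintegral; apply/funext => x; ring.
  apply: integrable_mul_bounded => //; first exact: test_integrable.
    by apply: measurable_funN; exact: measurable_sin_dot.
  by move=> x; rewrite normrN norm_sin_le1.
- by move=> s; apply: cvgN; exact: continuous_sin.
- exact: norm_cos_le1.
- by move=> s; rewrite normrN norm_sin_le1.
Qed.

Lemma FTs_partial l xi : FTs setT (partial l phi) xi = - (xi ord0 l * FTc setT phi xi).
Proof.
rewrite /FTs (@integration_by_parts_wave _ _ (@sin R) (@cos R))//.
- exact: continuous_cos.
- exact: norm_sin_le1.
- exact: norm_cos_le1.
Qed.

End test_function.
End compact_support.

(** * Berezin's inequality on H^1_0 *)

Section berezin.
Context {R : realType} (n : nat).
Notation leb := (lebesgue_row R n).
Implicit Types (phi f u : 'rV[R]_n -> R) (x xi : 'rV[R]_n) (l : 'I_n) (mu : R).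

Lemma sqnorm_ge0 x : 0 <= sqnorm x.
Proof. by apply: sumr_ge0 => i _; exact: sqr_ge0. Qed.

Lemma measurable_sqnorm : measurable_fun setT (@sqnorm R n).
Proof.
apply: measurable_sum => i; apply: measurable_funX; exact: measurable_row_coord.
Qed.

Lemma norm_le_sqrt_sqnorm x : `|x| <= Num.sqrt (sqnorm x).
Proof.
rewrite [leLHS]/Num.Def.normr /= mx_normrE; apply/bigmax_leP.
split=> [|[i j] _ /=]; first exact: sqrtr_ge0.
rewrite -sqrtr_sqr ler_wsqrtr// /sqnorm (bigD1 j)//= ord1 lerDl.
by apply: sumr_ge0 => l _; exact: sqr_ge0.
Qed.

(** The positive part of mu - |xi|^2. Integrals against it are dual to
    the energy under a mass constraint, mu being the Lagrange
    multiplier. *)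
Definition tweight mu xi : R := Num.max 0 (mu - sqnorm xi).

Lemma measurable_tweight mu : measurable_fun setT (tweight mu).
Proof.
apply: measurable_maxr => //; apply: measurable_funB => //; exact: measurable_sqnorm.
Qed.

Lemma tweight_ge0 mu xi : 0 <= tweight mu xi.
Proof. by rewrite /tweight le_max lexx. Qed.

Lemma tweight_le mu xi : tweight mu xi <= `|mu| * \1_(@sup_ball R n (Num.sqrt mu)) xi.
Proof.
rewrite /tweight ge_max; apply/andP; split; first by rewrite mulr_ge0.
rewrite indicE; have [h|h] := leP mu (sqnorm xi).
  by rewrite (@le_trans _ _ 0) ?subr_le0// mulr_ge0.
rewrite mem_set ?mulr1.
  by rewrite (le_trans _ (ler_norm _))// gerBl sqnorm_ge0.
by rewrite /sup_ball /= (le_trans (norm_le_sqrt_sqnorm _))// ler_wsqrtr// ltW.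
Qed.

Lemma integrable_tweight_mul mu f M : measurable_fun setT f -> (forall x, `|f x| <= M) ->
  leb.-integrable setT (EFin \o (fun xi => tweight mu xi * f xi)).
Proof.
move=> mf fM; have M0 : 0 <= M by apply: le_trans (fM 0).
apply: (@integrable_dominated _ _ _ _ _ measurableT _ (fun x => (M * `|mu|) * \1_(sup_ball (Num.sqrt mu)) x)).
- by apply: measurable_funM => //; exact: measurable_tweight.
- exact: integrable_indic_sup_ball.
- move=> x _; rewrite normrM mulrC (ger0_norm (tweight_ge0 _ _)) -mulrA ler_pM ?tweight_ge0//.
  exact: tweight_le.
Qed.

Lemma cvg_sum_ord (k : nat) (f : 'I_k -> nat -> R) (a : 'I_k -> R) :
  (forall i, f i @ \oo --> a i) -> (fun m => \sum_i f i m) @ \oo --> \sum_i a i.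
Proof.
move=> fa; elim: (index_enum _) => [|i s IH].
  rewrite big_nil (_ : (fun m => _) = fun=> 0); first exact: cvg_cst.
  by apply/funext => m; rewrite big_nil.
rewrite big_cons (_ : (fun m => _) = fun m => f i m + \sum_(i <- s) f i m).
  by apply: cvgD => //; exact: fa.
by apply/funext => m; rewrite big_cons.
Qed.

Definition FTsq D phi xi := FTc D phi xi ^+ 2 + FTs D phi xi ^+ 2.

Lemma FTsq_ge0 D phi xi : 0 <= FTsq D phi xi.
Proof. by rewrite addr_ge0 ?sqr_ge0. Qed.

Lemma FTsq_le D phi xi : measurable D -> leb.-integrable D (EFin \o phi) ->
  `|FTsq D phi xi| <= 2 * (\int[leb]_(x in D) `|phi x|) ^+ 2.
Proof.
move=> mD iphi; rewrite ger0_norm ?FTsq_ge0// /FTsq mulr_natl mulr2n.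
have h1 := norm_FTc_le xi mD iphi; have h2 := norm_FTs_le xi mD iphi.
set N := Rintegral _ _ _ in h1 h2 *.
have sq (a : R) : `|a| <= N -> a ^+ 2 <= N ^+ 2.
  by move=> h; rewrite -(real_normK (num_real a)) lerXn2r ?nnegrE ?(le_trans _ h).
by apply: lerD; apply: sq.
Qed.

(** Derivatives multiply the Fourier transform by coordinates of xi, so
    by Plancherel the left-hand side is the integral of (mu - |xi|^2)
    times the squared transform. The inequality is taken before the
    limit of vanishing damping, where all integrals are finite and the
    damping factor is at most 1. *)
Lemma berezin_test Om phi mu : test_function Om phi ->
  (2 * pi) ^+ n * (mu * (\int[leb]_x phi x ^+ 2) - \sum_l \int[leb]_x partial l phi x ^+ 2) <=
  \int[leb]_xi (tweight mu xi * FTsq setT phi xi).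
Proof.
move=> tphi.
have iphi := test_integrable tphi.
have ipart l := test_partial_integrable tphi l.
have [M phiM] := csupp_bounded (test_compact tphi) (test_continuous tphi) (@test_off _ _ phi).
have bp l : exists M, forall x, `|partial l phi x| <= M.
  exact: (csupp_bounded (test_compact tphi) (@test_partial_continuous _ _ _ _ tphi l) (@test_partial_off _ _ phi l)).
have Ec := regularized_lim iphi phiM (test_continuous tphi).
have Ep l : (fun m : nat => \int[leb]_xi (expw (m.+1%:R^-1 *: xi) * (xi ord0 l ^+ 2 * FTsq setT phi xi))) @ \oo -->
    (2 * pi) ^+ n * \int[leb]_x (partial l phi x ^+ 2).
  have [M' hM'] := bp l.
  have := regularized_lim (ipart l) hM' (@test_partial_continuous _ _ _ _ tphi l).
  apply: cvg_trans; apply: near_eq_cvg; apply: nearW => m.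
  congr Rintegral; apply/funext => xi; congr (_ * _).
  by rewrite (FTc_partial tphi) (FTs_partial tphi) /FTsq; ring.
have iE (c : R) : 0 < c -> leb.-integrable setT (EFin \o (fun xi => expw (c *: xi) * FTsq setT phi xi)).
  by move=> c0; exact: integrable_regularized.
have iEp (c : R) l : 0 < c -> leb.-integrable setT (EFin \o (fun xi => expw (c *: xi) * (xi ord0 l ^+ 2 * FTsq setT phi xi))).
  move=> c0; have := integrable_regularized (ipart l) c0.
  apply: eq_integrable => // xi _ /=; congr (_ * _)%:E.
  by rewrite (FTc_partial tphi) (FTs_partial tphi) /FTsq; ring.
have mW : measurable_fun setT (FTsq setT phi).
  by apply: measurable_funD; apply: measurable_funX; [exact: measurable_FTc|exact: measurable_FTs].
have L : (fun m : nat => mu * (\int[leb]_xi (expw (m.+1%:R^-1 *: xi) * FTsq setT phi xi)) -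
    \sum_l \int[leb]_xi (expw (m.+1%:R^-1 *: xi) * (xi ord0 l ^+ 2 * FTsq setT phi xi))) @ \oo -->
    mu * ((2 * pi) ^+ n * \int[leb]_x (phi x ^+ 2)) -
    \sum_l ((2 * pi) ^+ n * \int[leb]_x (partial l phi x ^+ 2)).
  by apply: cvgB; [apply: cvgM; [exact: cvg_cst|exact: Ec]|exact: cvg_sum_ord].
rewrite mulrBr mulrCA mulr_sumr.
apply: (ler_cvg_to L (cvg_cst _)); apply: nearW => m.
set c : R := m.+1%:R^-1; have c0 : 0 < c by rewrite invr_gt0.
rewrite -RintegralZl//; last exact: iE.
rewrite -Rintegral_sum//; last by move=> l; exact: iEp.
have is1 : leb.-integrable setT (EFin \o (fun xi => \sum_l (expw (c *: xi) * (xi ord0 l ^+ 2 * FTsq setT phi xi)))).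
  by apply: integrable_EFin_sum => // l; exact: iEp.
rewrite -RintegralB//; last by apply: integrable_EFinZ => //; exact: iE.
apply: le_Rintegral => //.
- by apply: integrable_EFinB => //; apply: integrable_EFinZ => //; exact: iE.
- by apply: (integrable_tweight_mul _ mW) => x; apply: FTsq_le.
move=> xi _; rewrite -mulr_sumr -mulr_suml -/(sqnorm xi).
have -> : mu * (expw (c *: xi) * FTsq setT phi xi) - expw (c *: xi) * (sqnorm xi * FTsq setT phi xi) =
  (mu - sqnorm xi) * expw (c *: xi) * FTsq setT phi xi by ring.
rewrite ler_wpM2r ?FTsq_ge0// /tweight.
have [h|h] := leP (mu - sqnorm xi) 0.
  by rewrite mulr_le0_ge0 ?expw_ge0.
by rewrite ler_piMr ?expw_le1// (ltW h).
Qed.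

Lemma Rintegral_offsupp (D : set 'rV[R]_n) f : (forall x, ~ D x -> f x = 0) ->
  \int[leb]_(x in D) f x = \int[leb]_x f x.
Proof.
move=> f0; rewrite Rintegral_mkcond; congr Rintegral; apply/funext => x.
by rewrite patchE; case: ifPn => // /negP xD; rewrite f0// => Dx; apply: xD; rewrite inE.
Qed.

Lemma bounded_integrable_sqint (D : set 'rV[R]_n) f M : measurable D -> leb.-integrable setT (EFin \o f) ->
  (forall x, `|f x| <= M) -> sqint leb D f.
Proof.
move=> mD i_f fM.
have iD : leb.-integrable D (EFin \o f) by apply: integrableS i_f.
have mf : measurable_fun D f by apply/measurable_EFinP; exact: measurable_int iD.
apply: (sqint_dominated mD mf (g := fun x => M * `|f x|)).
  by apply: integrable_EFinZ => //; exact: integrable_norm.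
by move=> x _; rewrite -(real_normK (num_real (f x))) expr2 ler_wpM2r.
Qed.

Section H10.
Variables (Om : set 'rV[R]_n) (mOm : measurable Om) (Omfin : (leb Om < +oo)%E).

Lemma sqint_wave (f : R -> R) xi : continuous f -> (forall t, `|f t| <= 1) ->
  sqint leb Om (fun x => f (dot xi x)).
Proof.
move=> cf f1; have mf : measurable_fun Om (fun x => f (dot xi x)).
  apply: measurable_funTS; apply: (measurableT_comp (continuous_measurable_fun cf)).
  by apply: measurable_dot => //; exact: measurable_id.
apply: (sqint_dominated mOm mf (g := fun=> 1)).
  apply: integrable_EFinP => //; rewrite (eq_integral (fun=> 1%E)); last first.
    by move=> x _; rewrite normr1.
  by rewrite integral_cst// mul1e.
by move=> x _; rewrite -(real_normK (num_real _)) expr_le1.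
Qed.

Lemma sqint_one : sqint leb Om (fun=> 1).
Proof.
split => //; under eq_integral do rewrite expr1n.
by rewrite integral_cst// mul1e.
Qed.

Lemma sqint_integrable f : sqint leb Om f -> leb.-integrable Om (EFin \o f).
Proof.
move=> sf; have := sqintM mOm sf sqint_one.
by apply: eq_integrable => // x _ /=; rewrite mulr1.
Qed.

Lemma sqint_cos xi : sqint leb Om (fun x => cos (dot xi x)).
Proof. by apply: sqint_wave; [exact: continuous_cos|exact: norm_cos_le1]. Qed.

Lemma sqint_sin xi : sqint leb Om (fun x => sin (dot xi x)).
Proof. by apply: sqint_wave; [exact: continuous_sin|exact: norm_sin_le1]. Qed.

Lemma measurable_FTsq u : leb.-integrable Om (EFin \o u) -> measurable_fun setT (FTsq Om u).
Proof.
move=> iu; have iu' : leb.-integrable setT (EFin \o (u \_ Om)).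
  by have := (integrable_mkcond (EFin \o u) mOm).1 iu; rewrite restrict_EFin.
rewrite (_ : FTsq Om u = FTsq setT (u \_ Om)); last first.
  apply/funext => xi; rewrite /FTsq /FTc /FTs !(Rintegral_mkcond _ Om).
  by congr (_ ^+ 2 + _ ^+ 2); congr Rintegral; apply/funext => x; rewrite !patchE; case: ifP; rewrite ?mul0r.
by apply: measurable_funD; apply: measurable_funX; [exact: measurable_FTc|exact: measurable_FTs].
Qed.

Lemma integrable_tweight_FTsq mu u : leb.-integrable Om (EFin \o u) ->
  leb.-integrable setT (EFin \o (fun xi => tweight mu xi * FTsq Om u xi)).
Proof.
move=> iu; apply: (integrable_tweight_mul _ (measurable_FTsq iu)) => x.
exact: FTsq_le.
Qed.

(** Each assertion holds for test functions and survives limits in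
    L^2(Omega). Omega has finite measure, so plane waves are in
    L^2(Omega), Fourier transforms converge pointwise, and the squared
    transforms stay bounded; [tweight] has bounded support, so dominated
    convergence applies to the right-hand side of the last inequality. *)
Lemma H10_properties u g : H10 Om u g ->
  [/\ sqint leb Om u, forall l, sqint leb Om (g l),
    forall l xi, FTc Om (g l) xi = xi ord0 l * FTs Om u xi,
    forall l xi, FTs Om (g l) xi = - (xi ord0 l * FTc Om u xi) &
    forall mu, (2 * pi) ^+ n * (mu * (\int[leb]_(x in Om) u x ^+ 2) - \sum_l \int[leb]_(x in Om) g l x ^+ 2) <=
      \int[leb]_xi (tweight mu xi * FTsq Om u xi)].
Proof.
move=> [mu_ mg [phi [tphi cphi cpart]]].
have off m x : ~ Om x -> phi m x = 0.
  by move=> nO; apply: test_off => /(test_sub (tphi m)).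
have poff m l x : ~ Om x -> partial l (phi m) x = 0.
  by move=> nO; apply: test_partial_off => /(test_sub (tphi m)).
have sphi m : sqint leb Om (phi m).
  have [M phiM] := csupp_bounded (test_compact (tphi m)) (test_continuous (tphi m)) (@test_off _ _ (phi m)).
  by apply: bounded_integrable_sqint phiM => //; exact: test_integrable (tphi m).
have sp m l : sqint leb Om (partial l (phi m)).
  have [M phiM] := csupp_bounded (test_compact (tphi m)) (@test_partial_continuous _ _ _ _ (tphi m) l) (@test_partial_off _ _ (phi m) l).
  by apply: bounded_integrable_sqint phiM => //; exact: test_partial_integrable (tphi m) _.
have [su c0 wu nu] := sqint_lim mOm sphi mu_ cphi.
have G l := sqint_lim mOm (fun m => sp m l) (mg l) (cpart l).
have FTcE m xi : FTc Om (phi m) xi = FTc setT (phi m) xi.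
  by apply: Rintegral_offsupp => x nO; rewrite off// mul0r.
have FTsE m xi : FTs Om (phi m) xi = FTs setT (phi m) xi.
  by apply: Rintegral_offsupp => x nO; rewrite off// mul0r.
have cc xi : (fun m => FTc Om (phi m) xi) @ \oo --> FTc Om u xi by apply: wu; exact: sqint_cos.
have cs xi : (fun m => FTs Om (phi m) xi) @ \oo --> FTs Om u xi by apply: wu; exact: sqint_sin.
split => //.
- by move=> l; have [] := G l.
- move=> l xi; have [_ _ /(_ _ (sqint_cos xi)) h _] := G l.
  apply: (cvg_unique _ h) => //.
  have : (fun m => xi ord0 l * FTs Om (phi m) xi) @ \oo --> xi ord0 l * FTs Om u xi.
    by apply: cvgM; [exact: cvg_cst|exact: cs].
  apply: cvg_trans; apply: near_eq_cvg; apply: nearW => m.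
  rewrite FTsE -(FTc_partial (tphi m)); apply/esym/Rintegral_offsupp => x nO.
  by rewrite poff// mul0r.
- move=> l xi; have [_ _ /(_ _ (sqint_sin xi)) h _] := G l.
  apply: (cvg_unique _ h) => //.
  have : (fun m => - (xi ord0 l * FTc Om (phi m) xi)) @ \oo --> - (xi ord0 l * FTc Om u xi).
    by apply: cvgN; apply: cvgM; [exact: cvg_cst|exact: cc].
  apply: cvg_trans; apply: near_eq_cvg; apply: nearW => m.
  rewrite FTcE -(FTs_partial (tphi m)); apply/esym/Rintegral_offsupp => x nO.
  by rewrite poff// mul0r.
move=> mu.
have L1 : (fun m => (2 * pi) ^+ n * (mu * (\int[leb]_(x in Om) phi m x ^+ 2) -
     \sum_l \int[leb]_(x in Om) partial l (phi m) x ^+ 2)) @ \oo -->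
  (2 * pi) ^+ n * (mu * (\int[leb]_(x in Om) u x ^+ 2) - \sum_l \int[leb]_(x in Om) g l x ^+ 2).
  apply: cvgM; first exact: cvg_cst.
  apply: cvgB; first by apply: cvgM; [exact: cvg_cst|exact: nu].
  by apply: cvg_sum_ord => l; have [] := G l.
have iphi m : leb.-integrable Om (EFin \o phi m) by exact: sqint_integrable.
have V0 : \int[leb]_(x in Om) 1 ^+ 2 = fine (leb Om) :> R.
  by rewrite /Rintegral; under eq_integral do rewrite expr1n; rewrite integral_cst// mul1e.
have [C hC] : exists C, forall m, \int[leb]_(x in Om) phi m x ^+ 2 <= C.
  have /cvg_seq_bounded[C [_ /(_ (`|C| + 1))]] : cvgn (fun m => \int[leb]_(x in Om) phi m x ^+ 2).
    by apply/cvg_ex; eexists; exact: nu.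
  rewrite (le_lt_trans (ler_norm C)) ?ltrDl// => /(_ isT) h.
  by exists (`|C| + 1) => m; apply: le_trans (ler_norm _) (h m I).
have C0 : 0 <= C by apply: le_trans (hC 0%N); exact: Rintegral_sqr_ge0.
have bound m xi : `|FTsq Om (phi m) xi| <= 2 * (C * fine (leb Om)).
  have b (f : R -> R) : continuous f -> (forall t, `|f t| <= 1) ->
      (\int[leb]_(x in Om) (phi m x * f (dot xi x))) ^+ 2 <= C * fine (leb Om).
    move=> cf f1; have sf := sqint_wave xi cf f1.
    apply: (le_trans (Rintegral_CS mOm (sphi m) sf)).
    apply: ler_pM => //; rewrite ?Rintegral_sqr_ge0// -V0.
    apply: le_Rintegral => //; [exact: sqint_sqr|exact: sqint_sqr sqint_one|].
    by move=> x _; rewrite -(real_normK (num_real (f _))) lerXn2r ?nnegrE.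
  rewrite ger0_norm ?FTsq_ge0// mulr_natl mulr2n; apply: lerD.
    by apply: b; [exact: continuous_cos|exact: norm_cos_le1].
  by apply: b; [exact: continuous_sin|exact: norm_sin_le1].
have L2 : (fun m => \int[leb]_xi (tweight mu xi * FTsq Om (phi m) xi)) @ \oo -->
   \int[leb]_xi (tweight mu xi * FTsq Om u xi).
  apply: (Rintegral_dct measurableT (g := fun xi => tweight mu xi * (2 * (C * fine (leb Om))))).
  - by move=> m; apply/measurable_EFinP; exact: measurable_int (integrable_tweight_FTsq mu (iphi m)).
  - move=> xi _; apply: cvgM; first exact: cvg_cst.
    apply: cvgD.
      by apply: (cvg_comp (fun m => FTc Om (phi m) xi) (fun t => t ^+ 2) (cc xi)); exact: exprn_continuous.
    by apply: (cvg_comp (fun m => FTs Om (phi m) xi) (fun t => t ^+ 2) (cs xi)); exact: exprn_continuous.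
  - apply: (@integrable_tweight_mul _ _ (2 * (C * fine (leb Om)))) => // x.
    by rewrite ger0_norm// !mulr_ge0// fine_ge0.
  - by move=> m xi _; rewrite normrM (ger0_norm (tweight_ge0 _ _)) ler_wpM2l ?tweight_ge0.
apply: (ler_cvg_to L1 L2); apply: nearW => m.
have -> : \int[leb]_(x in Om) phi m x ^+ 2 = \int[leb]_x phi m x ^+ 2.
  by apply: Rintegral_offsupp => x nO; rewrite off// expr0n.
have -> : \sum_l \int[leb]_(x in Om) partial l (phi m) x ^+ 2 = \sum_l \int[leb]_x partial l (phi m) x ^+ 2.
  by apply: eq_bigr => l _; apply: Rintegral_offsupp => x nO; rewrite poff// expr0n.
apply: (le_trans (berezin_test mu (tphi m))).
rewrite le_eqVlt; apply/orP; left; apply/eqP; congr Rintegral; apply/funext => xi.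
by rewrite /FTsq FTcE FTsE.
Qed.

End H10.
End berezin.

(** * Dirichlet eigenfunctions and the Berezin-Li-Yau inequality *)

Section eigen.
Context {R : realType} (n : nat).
Notation leb := (lebesgue_row R n).
Implicit Types (phi f u v : 'rV[R]_n -> R) (x xi : 'rV[R]_n) (l : 'I_n) (mu a : R).

Lemma continuous_comb (T : topologicalType) a (f g : T -> R) : continuous f -> continuous g ->
  continuous (fun t => a * f t + g t).
Proof.
move=> cf cg t; apply: cvgD; last exact: cg.
by apply: cvgM; [exact: cvg_cst|exact: cf].
Qed.

Lemma measurable_invR : measurable_fun setT (fun t : R => t^-1).
Proof.
have oD : open [set t : R | t != 0].
  by apply: open_neq.
rewrite (_ : setT = [set t : R | t != 0] `|` [set 0]); last first.
  by apply/seteqP; split => // t _; case: (eqVneq t 0) => [->|?]; [right|left].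
apply/measurable_funU => //; first exact: measurable_realfun.open_measurable.
split; last exact: measurable_fun_set1.
apply: open_continuous_measurable_fun => // t; rewrite inE /= => t0.
exact: inv_continuous.
Qed.

Lemma smooth_comb a phi psi : smooth phi -> smooth psi -> smooth (fun x => a * phi x + psi x).
Proof.
move=> sphi spsi s.
have E : foldr (@partial R n) (fun x => a * phi x + psi x) s =
    (fun x => a * foldr (@partial R n) phi s x + foldr (@partial R n) psi s x).
  elim: s => [//|i s IH] /=; rewrite IH; apply/funext => x; rewrite /partial.
  have [_ d1] := sphi s; have [_ d2] := spsi s.
  rewrite (_ : (fun x0 => _) = (a \*: foldr (@partial R n) phi s) + foldr (@partial R n) psi s); last exact/funext.
  rewrite deriveD//; last by apply: derivableZ; exact: d1.
  by rewrite deriveZ.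
rewrite E; have [c1 d1] := sphi s; have [c2 d2] := spsi s; split.
  exact: continuous_comb.
move=> x i.
rewrite (_ : (fun x0 => _) = (a \*: foldr (@partial R n) phi s) + foldr (@partial R n) psi s); last exact/funext.
by apply: derivableD => //; apply: derivableZ; exact: d1.
Qed.

Lemma test_function_comb Om a phi psi : test_function Om phi -> test_function Om psi ->
  test_function Om (fun x => a * phi x + psi x).
Proof.
move=> [s1 [c1 o1]] [s2 [c2 o2]]; split; first exact: smooth_comb.
have sub : closure [set x | a * phi x + psi x != 0] `<=`
    closure [set x | phi x != 0] `|` closure [set x | psi x != 0].
  rewrite -closureU; apply: closure_subset => x /=.
  by have [->|?] := eqVneq (phi x) 0; [rewrite mulr0 add0r; right|left].
split; last by move=> x /sub[/o1|/o2].
apply: subclosed_compact sub; first exact: closed_closure.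
exact: compactU.
Qed.

Lemma sqnorm_le0 x : (sqnorm x <= 0) = (x == 0).
Proof.
apply/idP/eqP => [h|->]; last by rewrite /sqnorm big1// => i _; rewrite mxE expr0n.
have q0 : sqnorm x = 0 by apply/eqP; rewrite eq_le h sqnorm_ge0.
by have := norm_le_sqrt_sqnorm x; rewrite q0 sqrtr0 normr_le0 => /eqP.
Qed.

Lemma sqnorm_gt0 x : x != 0 -> 0 < sqnorm x.
Proof. by rewrite -sqnorm_le0 -ltNge. Qed.

Lemma measurable_envelope V L : measurable_fun setT (@envelope R n V L).
Proof.
apply: measurable_funM => //.
rewrite (_ : (fun x => _) = fun x => if sqnorm x <= 0 then 1 else Num.min 1 (L / sqnorm x)); last first.
  by apply/funext => x; rewrite sqnorm_le0.
have mq := @measurable_sqnorm R n.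
apply: measurable_fun_ifT => //.
- by apply: measurable_fun_ler.
- apply: measurable_minr => //; apply: measurable_funM => //.
  by apply: (measurableT_comp _ mq); exact: measurable_invR.
Qed.

Lemma envelope_ge0 V L xi : 0 <= V -> 0 <= L -> 0 <= envelope V L xi.
Proof.
move=> V0 L0; rewrite /envelope mulr_ge0//.
  by rewrite divr_ge0// exprn_ge0// mulr_ge0// pi_ge0.
by case: ifP => // _; rewrite le_min ler01 divr_ge0// sqnorm_ge0.
Qed.

Lemma envelope_le V L xi : 0 <= V -> envelope V L xi <= V / (2 * pi) ^+ n.
Proof.
move=> V0; rewrite /envelope ler_piMr//.
  by rewrite divr_ge0// exprn_ge0// mulr_ge0// pi_ge0.
by case: ifP => // _; rewrite ge_min lexx.
Qed.

Section Omega.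
Variables (Om : set 'rV[R]_n) (mOm : measurable Om) (Omfin : (leb Om < +oo)%E).
Notation ip u v := (\int[leb]_(x in Om) (u x * v x)).

Lemma sqint_test phi : test_function Om phi -> sqint leb Om phi /\ forall l, sqint leb Om (partial l phi).
Proof.
move=> tphi; split.
  have [M phiM] := csupp_bounded (test_compact tphi) (test_continuous tphi) (@test_off _ _ phi).
  by apply: bounded_integrable_sqint phiM => //; exact: test_integrable tphi.
move=> l.
have [M phiM] := csupp_bounded (test_compact tphi) (@test_partial_continuous _ _ _ _ tphi l) (@test_partial_off _ _ phi l).
by apply: bounded_integrable_sqint phiM => //; exact: test_partial_integrable tphi _.
Qed.

Lemma cvg_sq_comb a (f_ g_ : nat -> 'rV[R]_n -> R) (f g : 'rV[R]_n -> R) :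
  (forall m, sqint leb Om (f_ m)) -> (forall m, sqint leb Om (g_ m)) ->
  measurable_fun Om f -> measurable_fun Om g ->
  (fun m => \int[leb]_(x in Om) ((f_ m x - f x) ^+ 2)%:E)%E @ \oo --> 0%E ->
  (fun m => \int[leb]_(x in Om) ((g_ m x - g x) ^+ 2)%:E)%E @ \oo --> 0%E ->
  (fun m => \int[leb]_(x in Om) (((a * f_ m x + g_ m x) - (a * f x + g x)) ^+ 2)%:E)%E @ \oo --> 0%E.
Proof.
move=> sf sg mf mg cf cg.
have [sf' cf' _ _] := sqint_lim mOm sf mf cf; have [sg' cg' _ _] := sqint_lim mOm sg mg cg.
have s1 m : sqint leb Om (fun x => f_ m x - f x) by exact: sqintB.
have s2 m : sqint leb Om (fun x => g_ m x - g x) by exact: sqintB.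
have s3 m : sqint leb Om (fun x => (a * f_ m x + g_ m x) - (a * f x + g x)).
  by apply: sqintB => //; apply: sqintD => //; apply: sqintZ.
have -> : (fun m => \int[leb]_(x in Om) (((a * f_ m x + g_ m x) - (a * f x + g x)) ^+ 2)%:E)%E =
   EFin \o (fun m => \int[leb]_(x in Om) ((a * f_ m x + g_ m x) - (a * f x + g x)) ^+ 2).
  by apply/funext => m; rewrite /= -EFin_Rintegral//; exact: sqint_sqr.
apply: cvg_EFin; first exact: nearW.
have up : (fun m => 2 * a ^+ 2 * (\int[leb]_(x in Om) (f_ m x - f x) ^+ 2) +
    2 * (\int[leb]_(x in Om) (g_ m x - g x) ^+ 2)) @ \oo --> 0.
  rewrite -[X in _ --> X]addr0 -[X in _ --> X + _](mulr0 (2 * a ^+ 2)) -[X in _ --> _ + X](mulr0 2).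
  by apply: cvgD; apply: cvgM => //; exact: cvg_cst.
apply: (squeeze_cvgr _ (cvg_cst 0) up); apply: nearW => m.
rewrite Rintegral_sqr_ge0/=.
have i1 := sqint_sqr (s1 m); have i2 := sqint_sqr (s2 m).
rewrite -!RintegralZl// -RintegralD//; last 2 first.
- by apply: integrable_EFinZ.
- by apply: integrable_EFinZ.
apply: le_Rintegral => //.
- exact: sqint_sqr.
- by apply: integrable_EFinD => //; apply: integrable_EFinZ.
move=> x _; have := sqr_ge0 (a * (f_ m x - f x) - (g_ m x - g x)).
nra.
Qed.

Lemma H10_comb a u g v h : H10 Om u g -> H10 Om v h ->
  H10 Om (fun x => a * u x + v x) (fun l x => a * g l x + h l x).
Proof.
move=> [mu_ mg [phi [tphi cphi pphi]]] [mv mh [psi [tpsi cpsi ppsi]]].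
split.
- by apply: measurable_funD => //; apply: measurable_funM.
- by move=> l; apply: measurable_funD => //; apply: measurable_funM.
exists (fun m x => a * phi m x + psi m x); split.
- by move=> m; exact: test_function_comb.
- apply: cvg_sq_comb => // m; first exact: (sqint_test (tphi m)).1.
  exact: (sqint_test (tpsi m)).1.
- move=> l.
  have E m x : partial l (fun x => a * phi m x + psi m x) x = a * partial l (phi m) x + partial l (psi m) x.
    rewrite /partial (_ : (fun x0 => _) = (a \*: phi m) + psi m); last exact/funext.
    rewrite deriveD; [by rewrite deriveZ//; exact: (@test_derivable _ _ _ _ (tphi m) x l)
      |by apply: derivableZ; exact: (@test_derivable _ _ _ _ (tphi m) x l)|exact: (@test_derivable _ _ _ _ (tpsi m) x l)].
  under eq_fun do under eq_integral do rewrite E.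
  apply: cvg_sq_comb => // m; first exact: (sqint_test (tphi m)).2.
  exact: (sqint_test (tpsi m)).2.
Qed.

(** [dirichlet_solution] with the weak gradient as an argument. *)
Definition weak_solution mu u (g : 'I_n -> 'rV[R]_n -> R) :=
  H10 Om u g /\ forall v h, H10 Om v h -> \sum_l ip (g l) (h l) = mu * ip u v.

Lemma H10_sqint u g : H10 Om u g -> sqint leb Om u /\ forall l, sqint leb Om (g l).
Proof. by move=> /(H10_properties mOm Omfin)[]. Qed.

Lemma weak_solution_comb mu a u g v h : weak_solution mu u g -> weak_solution mu v h ->
  weak_solution mu (fun x => a * u x + v x) (fun l x => a * g l x + h l x).
Proof.
move=> [hu su] [hv sv]; split; first exact: H10_comb.
move=> w r hw.
have [s1 t1] := H10_sqint hu; have [s2 t2] := H10_sqint hv; have [s3 t3] := H10_sqint hw.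
have lin (p q s : 'rV[R]_n -> R) : sqint leb Om p -> sqint leb Om q -> sqint leb Om s ->
    \int[leb]_(x in Om) ((a * p x + q x) * s x) = a * ip p s + ip q s.
  move=> sp sq ss; have i1 := sqintM mOm sp ss; have i2 := sqintM mOm sq ss.
  rewrite -RintegralZl// -RintegralD//; last exact: integrable_EFinZ.
  by congr Rintegral; apply/funext => x; ring.
under eq_bigr do rewrite lin//.
by rewrite big_split/= -mulr_sumr (su _ _ hw) (sv _ _ hw) lin//; ring.
Qed.

Lemma weak_solution_sum mu (d : nat) (b : 'I_d -> 'rV[R]_n -> R) (g : 'I_d -> 'I_n -> 'rV[R]_n -> R) (a : 'I_d -> R) :
  (0 < d)%N -> (forall i, weak_solution mu (b i) (g i)) ->
  weak_solution mu (fun x => \sum_i a i * b i x) (fun l x => \sum_i a i * g i l x).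
Proof.
move=> d0 hb; elim: (index_enum _) => [|i s IH].
  have i0 := Ordinal d0.
  (* The empty combination is - b_0 + b_0; this is where d > 0 is used. *)
  have := weak_solution_comb (-1) (hb i0) (hb i0).
  rewrite (_ : (fun x => -1 * b i0 x + b i0 x) = (fun x => \sum_(i <- [::]) a i * b i x)); last first.
    by apply/funext => x; rewrite big_nil mulN1r addNr.
  rewrite (_ : (fun l x => -1 * g i0 l x + g i0 l x) = (fun l x => \sum_(i <- [::]) a i * g i l x))//.
  by apply/funext => l; apply/funext => x; rewrite big_nil mulN1r addNr.
have := weak_solution_comb (a i) (hb i) IH.
rewrite (_ : (fun x => a i * b i x + _) = (fun x => \sum_(i <- i :: s) a i * b i x)); last first.
  by apply/funext => x; rewrite big_cons.
rewrite (_ : (fun l x => a i * g i l x + _) = (fun l x => \sum_(i <- i :: s) a i * g i l x))//.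
by apply/funext => l; apply/funext => x; rewrite big_cons.
Qed.

Lemma ipC u v : ip u v = ip v u.
Proof. by congr Rintegral; apply/funext => x; rewrite mulrC. Qed.

(** The form is symmetric: testing either equation with the other
    solution gives (mu - mu') ip u v = 0. *)
Lemma weak_solution_orth mu mu' u g v h : weak_solution mu u g -> weak_solution mu' v h ->
  mu != mu' -> ip u v = 0.
Proof.
move=> [hu su] [hv sv] neq.
have e1 := su _ _ hv; have e2 := sv _ _ hu.
have e3 : \sum_l ip (g l) (h l) = \sum_l ip (h l) (g l) by apply: eq_bigr => l _; rewrite ipC.
have : (mu - mu') * ip u v = 0 by rewrite mulrBl -e1 (ipC u v) -e2 e3 subrr.
by move/eqP; rewrite mulf_eq0 subr_eq0 (negbTE neq)/= => /eqP.
Qed.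

Lemma sqint_eq0_ae u : sqint leb Om u -> ip u u = 0 -> {ae leb, forall x, Om x -> u x = 0}.
Proof.
move=> su; have i_u := sqintM mOm su su; have mu_ : measurable_fun Om u by case: su.
move=> h; have h' : (\int[leb]_(x in Om) `|(u x * u x)%:E|)%E = 0%E.
  rewrite (eq_integral (fun x => (u x * u x)%:E)); last first.
    by move=> x _ /=; rewrite ger0_norm// -expr2 sqr_ge0.
  by rewrite EFin_Rintegral// h.
have muu : measurable_fun Om (fun x => (u x * u x)%:E).
  by apply/measurable_EFinP; exact: measurable_funM.
have := (ae_eq_integral_abs leb mOm muu).1 h'; apply: filterS => x + Ox => /(_ Ox) /= [] /eqP.
by rewrite mulf_eq0 orbb => /eqP.
Qed.

Variables (lam : nat -> R) (heig : dirichlet_eigenvalues Om lam).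

(** The eigenvalue lam_(m+1) has multiplicity d, and at most d - 1 of
    the indices up to m carry it, since m + 1 does too. So some nonzero
    vector of the d-dimensional solution space is orthogonal to the
    corresponding e_i; the other e_i belong to other eigenvalues and are
    orthogonal to it anyway. *)
Lemma eigen_extend (m : nat) (e : nat -> 'rV[R]_n -> R) (G : nat -> 'I_n -> 'rV[R]_n -> R) :
  (forall i, (1 <= i <= m)%N -> weak_solution (lam i) (e i) (G i)) ->
  exists u g, [/\ weak_solution (lam m.+1) u g, ip u u = 1 &
    forall i, (1 <= i <= m)%N -> ip (e i) u = 0].
Proof.
move=> he; case: heig => _ _ _ /(_ (lam m.+1)) [d [[b [sb _ fb]] cardd]].
(* P lists the indices up to m that carry the eigenvalue lam_(m+1). *)
pose P := [seq i <- iota 1 m | lam i == lam m.+1].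
pose p := size P.
have pd : (p < d)%N.
  set A := [set j | (1 <= j)%N /\ lam j = lam m.+1] in cardd.
  have fA : finite_set A by exists d.
  rewrite -(card_fset_set cardd).
  apply: (@uniq_leq_size _ (m.+1 :: P)) => /=.
    rewrite filter_uniq ?iota_uniq// andbT mem_filter mem_iota.
    by rewrite add1n ltnn andbF andbF.
  move=> j; rewrite inE => /orP[/eqP ->|]; rewrite in_fset_set// inE; first by split.
  by rewrite mem_filter mem_iota => /andP[/eqP lj /andP[j1 _]]; split.
have d0 : (0 < d)%N by exact: leq_ltn_trans pd.
have /choice[g hg] : forall i : 'I_d, exists g, weak_solution (lam m.+1) (b i) g.
  by move=> i; exact: sb i.
pose A : 'M[R]_(d, p) := \matrix_(i, j) ip (b i) (e (nth 0%N P j)).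
have kerA : kermx A != 0.
  rewrite kermx_eq0 /row_free; apply: contraTneq pd => <-.
  by rewrite -leqNgt rank_leq_col.
have [a /sub_kermxP aA a0] := rowV0Pn kerA.
pose u0 x := \sum_i a ord0 i * b i x.
pose g0 l x := \sum_i a ord0 i * g i l x.
have hu0 : weak_solution (lam m.+1) u0 g0 by exact: weak_solution_sum.
have [su0 _] := H10_sqint hu0.1.
have sb' i : sqint leb Om (b i) by exact: (H10_sqint (hg i).1).1.
have uu0 : 0 < ip u0 u0.
  rewrite lt_neqAle; apply/andP; split; last by apply: Rintegral_ge0 => x _; rewrite -expr2 sqr_ge0.
  apply: contra_neq a0 => /esym /(sqint_eq0_ae su0) /fb az.
  by apply/rowP => i; rewrite mxE az.
have orth0 i : (1 <= i <= m)%N -> ip (e i) u0 = 0.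
  move=> hi; have [ei|nei] := eqVneq (lam i) (lam m.+1); last exact: weak_solution_orth (he i hi) hu0 nei.
  have [sei _] := H10_sqint (he i hi).1.
  have iP : i \in P by rewrite mem_filter ei eqxx mem_iota add1n ltnS.
  have jp : (index i P < p)%N by rewrite index_mem.
  have /rowP/(_ (Ordinal jp)) := aA; rewrite !mxE => H.
  rewrite -[RHS]H.
  transitivity (\int[leb]_(x in Om) \sum_(j < d) a ord0 j * (b j x * e i x)).
    congr Rintegral; apply/funext => x; rewrite /u0 mulr_sumr; apply: eq_bigr => j _.
    by rewrite mulrC mulrA.
  rewrite Rintegral_sum//; last by move=> j; apply: integrable_EFinZ => //; exact: sqintM.
  apply: eq_bigr => j _; rewrite mxE /= nth_index// RintegralZl//; exact: sqintM.
(* Normalise u0; c u0 is written as (c - 1) u0 + u0 to reuse the closure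
   under combinations. *)
pose c := (Num.sqrt (ip u0 u0))^-1.
have hcu := weak_solution_comb (c - 1) hu0 hu0.
have cE (f : R) : (c - 1) * f + f = c * f by ring.
exists (fun x => c * u0 x), (fun l x => c * g0 l x); split.
- move: hcu; rewrite (_ : (fun x => (c - 1) * u0 x + u0 x) = (fun x => c * u0 x)); last exact/funext.
  rewrite (_ : (fun l x => (c - 1) * g0 l x + g0 l x) = (fun l x => c * g0 l x))//.
  by apply/funext => l; apply/funext => x; exact: cE.
- have -> : \int[leb]_(x in Om) (c * u0 x * (c * u0 x)) = \int[leb]_(x in Om) (c ^+ 2 * (u0 x * u0 x)).
    by congr Rintegral; apply/funext => x; ring.
  rewrite RintegralZl//; last exact: sqintM.
  by rewrite /c exprVn sqr_sqrtr ?ltW// mulVf// gt_eqF.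
- move=> i hi; have [sei _] := H10_sqint (he i hi).1.
  have -> : \int[leb]_(x in Om) (e i x * (c * u0 x)) = \int[leb]_(x in Om) (c * (e i x * u0 x)).
    by congr Rintegral; apply/funext => x; ring.
  by rewrite RintegralZl ?orth0 ?mulr0//; exact: sqintM.
Qed.

Lemma orthonormal_eigenfunctions (m : nat) :
  exists (e : nat -> 'rV[R]_n -> R) (G : nat -> 'I_n -> 'rV[R]_n -> R),
  (forall i, (1 <= i <= m)%N -> weak_solution (lam i) (e i) (G i)) /\
  (forall i j, (1 <= i <= m)%N -> (1 <= j <= m)%N -> ip (e i) (e j) = (i == j)%:R).
Proof.
elim: m => [|m [e [G [he orth]]]].
  exists (fun _ _ => 0), (fun _ _ _ => 0).
  by split => [i|i j]; rewrite leqn0 => /andP[/lt0n_neq0 /negbTE ->].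
have [u [g [hu uu eu]]] := eigen_extend he.
exists (fun i => if i == m.+1 then u else e i), (fun i => if i == m.+1 then g else G i).
have lt_m i : (1 <= i <= m.+1)%N -> i != m.+1 -> (1 <= i <= m)%N.
  by move=> /andP[-> +] ne; rewrite leq_eqVlt (negbTE ne) ltnS.
split => [i hi|i j hi hj].
  by case: eqVneq => [->//|ne]; apply: he; exact: lt_m.
case: (eqVneq i m.+1) => [ei|ni]; case: (eqVneq j m.+1) => [ej|nj].
- by rewrite ei ej eqxx.
- by rewrite ipC eu ?lt_m// ei eq_sym (negbTE nj).
- by rewrite eu ?lt_m// ej (negbTE ni).
- by rewrite orth ?lt_m.
Qed.

Variables (V : R) (V0 : 0 < V) (VOm : leb Om = V%:E).

(** Sum the last inequality of [H10_properties] over k orthonormal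
    eigenfunctions. The sum S of their squared transforms is at most
    (2 pi)^n times the envelope by two applications of Bessel's
    inequality: to the plane wave, which gives S <= V, and to the
    gradient of the plane wave, which gives S <= V lam_k / |xi|^2. *)
Lemma berezin_li_yau (k : nat) (mu : R) : (1 <= k)%N ->
  mu * k%:R - \sum_(j < k) lam j.+1 <=
  \int[leb]_xi (tweight mu xi * envelope V (lam k) xi).
Proof.
move=> k1.
have [e0 [G0 [he0 orth0]]] := orthonormal_eigenfunctions k.
pose e (j : 'I_k) := e0 j.+1; pose G (j : 'I_k) := G0 j.+1.
have jk (j : 'I_k) : (1 <= j.+1 <= k)%N by rewrite /= ltn_ord.
have he (j : 'I_k) : weak_solution (lam j.+1) (e j) (G j) by exact: he0.
have orth (i j : 'I_k) : ip (e i) (e j) = (i == j)%:R by rewrite orth0//.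
have [lam1 lamnd _ _] := heig.
have lam0 (j : 'I_k) : 0 < lam j.+1 by apply: (lt_le_trans lam1); exact: lamnd.
have lamk (j : 'I_k) : lam j.+1 <= lam k by apply: lamnd; rewrite /= ltn_ord.
have L0 : 0 < lam k by apply: (lt_le_trans lam1); apply: lamnd; rewrite k1 leqnn.
have se j : sqint leb Om (e j) by exact: (H10_sqint (he j).1).1.
have sG j l : sqint leb Om (G j l) by exact: (H10_sqint (he j).1).2.
have orthG i j : \sum_l ip (G i l) (G j l) = (i == j)%:R * lam j.+1.
  by rewrite ((he i).2 _ _ (he j).1) orth mulrC; case: eqP => [->//|]; rewrite !mul0r.
have ae j := H10_properties mOm Omfin (he j).1.
have cs1 xi : \int[leb]_(x in Om) (cos (dot xi x) ^+ 2) + \int[leb]_(x in Om) (sin (dot xi x) ^+ 2) = V.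
  rewrite -RintegralD//; [|exact: sqint_sqr (sqint_cos _ _ _)|exact: sqint_sqr (sqint_sin _ _ _)].
  rewrite (_ : (fun x => _) = cst 1); last by apply/funext => x; rewrite cos2Dsin2.
  by rewrite Rintegral_cst// mul1r; exact: (congr1 fine VOm).
pose S xi := \sum_j FTsq Om (e j) xi.
have S1 xi : S xi <= V.
  rewrite /S big_split/= -(cs1 xi); apply: lerD.
    by apply: (Bessel1 mOm se _ orth); exact: sqint_cos.
  by apply: (Bessel1 mOm se _ orth); exact: sqint_sin.
have S2 xi : xi != 0 -> S xi <= V * (lam k / sqnorm xi).
  move=> xi0.
  have q0 := sqnorm_gt0 xi0.
  have B (f : R -> R) (F : 'I_k -> R) : (forall xi, sqint leb Om (fun x => f (dot xi x))) ->
     (forall j, (\sum_l \int[leb]_(x in Om) (G j l x * (xi ord0 l * f (dot xi x)))) ^+ 2 = (sqnorm xi * F j) ^+ 2) ->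
     \sum_j F j ^+ 2 <= lam k / sqnorm xi * \int[leb]_(x in Om) (f (dot xi x) ^+ 2).
    move=> sf Ff.
    have := @Bessel _ _ _ leb Om mOm k n G (fun l x => xi ord0 l * f (dot xi x)) (fun j => lam j.+1)
      sG (fun l => sqintZ mOm (xi ord0 l) (sf xi)) lam0 orthG.
    under eq_bigr do rewrite Ff.
    have -> : \sum_l \int[leb]_(x in Om) (xi ord0 l * f (dot xi x)) ^+ 2 = sqnorm xi * \int[leb]_(x in Om) (f (dot xi x) ^+ 2).
      rewrite /sqnorm mulr_suml; apply: eq_bigr => l _.
      rewrite -RintegralZl//; last exact: sqint_sqr.
      by congr Rintegral; apply/funext => x; rewrite exprMn.
    set I2 := \int[leb]_(x in Om) _ => H.
    have : sqnorm xi ^+ 2 / lam k * \sum_j F j ^+ 2 <= sqnorm xi * I2.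
      apply: le_trans H; rewrite mulr_sumr; apply: ler_sum => j _.
      rewrite exprMn [leRHS]mulrAC ler_wpM2r ?sqr_ge0// ler_wpM2l ?sqr_ge0//.
      by rewrite lef_pV2 ?posrE.
    move: (\sum_j F j ^+ 2) => X H2.
    have c0 : 0 <= lam k / sqnorm xi ^+ 2 by rewrite divr_ge0 ?sqr_ge0// ltW.
    have := ler_wpM2l c0 H2; congr (_ <= _); field; rewrite ?gt_eqF//.
  rewrite /S big_split/= addrC -(cs1 xi) mulrDl ![_ * (lam k / _)]mulrC; apply: lerD.
    apply: (B cos) => [xi'|j]; first exact: sqint_cos.
    have [_ _ cF _ _] := ae j; congr (_ ^+ 2).
    rewrite /sqnorm mulr_suml; apply: eq_bigr => l _.
    rewrite expr2 -mulrA -cF /FTc -RintegralZl//; last by apply: sqintM => //; exact: sqint_cos.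
    by congr Rintegral; apply/funext => x; rewrite mulrCA.
  apply: (B sin) => [xi'|j]; first exact: sqint_sin.
  have [_ _ _ sF _] := ae j; rewrite -[RHS]sqrrN -mulrN; congr (_ ^+ 2).
  rewrite /sqnorm mulr_suml; apply: eq_bigr => l _.
  rewrite expr2 -mulrA mulrN -sF /FTs -RintegralZl//; last by apply: sqintM => //; exact: sqint_sin.
  by congr Rintegral; apply/funext => x; rewrite mulrCA.
have pn0 : 0 < (2 * pi) ^+ n :> R by rewrite exprn_gt0// mulr_gt0// pi_gt0.
have Senv xi : S xi <= (2 * pi) ^+ n * envelope V (lam k) xi.
  rewrite /envelope mulrA mulrCA mulfV ?gt_eqF// mulr1.
  case: eqVneq => [_|xi0]; first by rewrite mulr1.
  by case: (leP 1 (lam k / sqnorm xi)) => _; rewrite ?mulr1 ?S1 ?S2.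
have ie j : leb.-integrable setT (EFin \o (fun xi => tweight mu xi * FTsq Om (e j) xi)).
  by apply: integrable_tweight_FTsq => //; exact: sqint_integrable.
have ienv : leb.-integrable setT (EFin \o (fun xi => tweight mu xi * envelope V (lam k) xi)).
  apply: (integrable_tweight_mul _ (@measurable_envelope V (lam k)) (M := V / (2 * pi) ^+ n)) => x.
  by rewrite ger0_norm ?envelope_ge0 ?envelope_le// ltW.
rewrite -(ler_pM2l pn0) -RintegralZl//.
have -> : mu * k%:R - \sum_(j < k) lam j.+1 = \sum_(j < k) (mu * ip (e j) (e j) - \sum_l ip (G j l) (G j l)).
  rewrite sumrB; congr (_ - _).
    under eq_bigr do rewrite orth eqxx mulr1.
    by rewrite sumr_const card_ord mulr_natr.
  by apply: eq_bigr => j _; rewrite orthG eqxx mul1r.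
rewrite mulr_sumr.
apply: (@le_trans _ _ (\sum_j \int[leb]_xi (tweight mu xi * FTsq Om (e j) xi))).
  apply: ler_sum => j _; have [_ _ _ _ /(_ mu)] := ae j.
  by under eq_bigr do under eq_Rintegral do rewrite expr2; under [X in _ * (_ * X - _) <= _ -> _]eq_Rintegral do rewrite expr2.
rewrite -Rintegral_sum//; apply: le_Rintegral => //.
- exact: integrable_EFin_sum.
- exact: integrable_EFinZ.
- move=> xi _; rewrite -mulr_sumr mulrCA ler_wpM2l ?tweight_ge0//; exact: Senv.
Qed.

End Omega.
End eigen.

(** * Integrals of radial functions over annuli *)

Section radial.
Context {R : realType} (n : nat).
Notation leb := (lebesgue_row R n).
Implicit Types (x xi : 'rV[R]_n) (a b s r : R).

(** Half-open, so that consecutive annuli are disjoint and fill a larger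
    one. *)
Definition annulus a b : set 'rV[R]_n := [set x | a ^+ 2 <= sqnorm x < b ^+ 2].

Lemma measurable_annulus a b : measurable (annulus a b).
Proof.
have -> : annulus a b = (@sqnorm R n) @^-1` `[a ^+ 2, b ^+ 2[%classic.
  by apply/seteqP; split => x /=; rewrite in_itv.
by rewrite -[X in measurable X]setTI; apply: measurable_sqnorm.
Qed.

Lemma annulus_sub_sup_ball a b : annulus a b `<=` sup_ball `|b|.
Proof.
move=> x /= /andP[_ xb]; rewrite /sup_ball /= (le_trans (norm_le_sqrt_sqnorm x))//.
by rewrite -sqrtr_sqr ler_wsqrtr// ltW.
Qed.

Lemma annulus_lty a b : (leb (annulus a b) < +oo)%E.
Proof.
apply: le_lt_trans (sup_ball_lty n `|b|).
by apply: le_measure; rewrite ?inE; [exact: measurable_annulus|exact: measurable_sup_ball|exact: annulus_sub_sup_ball].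
Qed.

Lemma annulusU a b s : 0 <= s -> s <= a -> a <= b -> annulus s b = annulus s a `|` annulus a b.
Proof.
move=> s0 sa ab; have a0 := le_trans s0 sa.
have sa2 : s ^+ 2 <= a ^+ 2 by rewrite lerXn2r ?nnegrE.
have ab2 : a ^+ 2 <= b ^+ 2 by rewrite lerXn2r ?nnegrE ?(le_trans a0 ab).
apply/seteqP; split => x; rewrite /annulus /=.
  by move=> /andP[h1 h2]; case: (ltP (sqnorm x) (a ^+ 2)) => h; [left; rewrite h1|right].
by case=> /andP[h1 h2]; rewrite ?h1 ?h2 ?(lt_le_trans h2)// ?(le_trans sa2).
Qed.

Lemma annulus_disj a b s : [disjoint annulus s a & annulus a b].
Proof.
rewrite disj_set2E; apply/eqP/seteqP; split => // x [] /= /andP[_ h1] /andP[h2 _].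
by move: (lt_le_trans h1 h2); rewrite ltxx.
Qed.

Let B1 := [set x : 'rV[R]_n | sqnorm x < 1].

Let B1E : B1 = annulus 0 1.
Proof. by apply/seteqP; split => x /=; rewrite /annulus /= expr0n expr1n sqnorm_ge0. Qed.

Lemma omegaE : leb B1 = (omega n)%:E.
Proof. by rewrite /omega fineK// ge0_fin_numE// -/B1 B1E annulus_lty. Qed.

Lemma omega_gt0 : 0 < omega n :> R.
Proof.
rewrite -lte_fin -omegaE.
pose c : R := (n.+1%:R)^-1.
have c0 : 0 < c by rewrite invr_gt0.
apply: (@lt_le_trans _ _ (leb [set x | forall i, `]- c, c[%classic (x ord0 i)])).
  rewrite (@lebesgue_row_box _ _ (fun=> `]- c, c[%classic))//.
  rewrite (eq_bigr (fun=> (c + c)%:E)); last first.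
    by move=> i _; rewrite lebesgue_measure_itv/= lte_fin gtrN// -EFinB opprK.
  by rewrite prodEFin lte_fin prodr_gt0// => i _; rewrite addr_gt0.
apply: le_measure; rewrite ?inE.
- by apply: (@measurable_cylinder R n (fun=> `]- c, c[%classic)).
- by rewrite B1E; exact: measurable_annulus.
move=> x /= h; rewrite /B1 /=.
apply: (@le_lt_trans _ _ (\sum_(i < n) c ^+ 2)).
  apply: ler_sum => i _; have := h i; rewrite /= in_itv/= -ltr_norml => hi.
  rewrite -(real_normK (num_real (x ord0 i))).
  by apply: lerXn2r; rewrite ?nnegrE ?normr_ge0//; apply: ltW.
rewrite sumr_const card_ord -mulr_natr /c exprVn mulrC ltr_pdivrMr ?exprn_gt0// mul1r.
by rewrite -natrX ltr_nat; lia.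
Qed.

(** The ball of radius r is the image of the unit ball under a dilation. *)
Lemma leb_ball r : 0 < r -> leb (annulus 0 r) = (omega n * r ^+ n)%:E.
Proof.
move=> r0.
have mA := measurable_annulus 0 r.
have m1 : measurable_fun setT (fun x => (\1_(annulus 0 r) x : R)%:E).
  by apply/measurable_EFinP; exact: measurable_indic.
have p1 x : (0 <= (\1_(annulus 0 r) x : R)%:E)%E by rewrite lee_fin.
have := @ge0_integral_affine R n 0 r _ r0 m1 p1.
rewrite [X in _ = X -> _]integral_indic// setIT => <-.
rewrite (_ : (fun w => _) = (fun w => (\1_B1 w)%:E)); last first.
  apply/funext => w; rewrite !indicE add0r; congr (_%:R%:E).
  have E : (annulus 0 r (r *: w)) = B1 w.
    rewrite B1E /annulus /= expr0n expr1n !sqnorm_ge0 /=.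
    have -> : sqnorm (r *: w) = r ^+ 2 * sqnorm w by rewrite -!dotE dotZl dotZr mulrA.
    by rewrite gtr_pMr ?exprn_gt0.
  by congr nat_of_bool; apply/idP/idP; rewrite !inE E.
rewrite integral_indic// ?setIT; last by rewrite B1E; exact: measurable_annulus.
transitivity ((r ^+ n)%:E * (omega n)%:E)%E; last by rewrite -EFinM mulrC.
by congr (_ * _)%E; exact: omegaE.
Qed.

Hypothesis n_gt0 : (0 < n)%N.

Lemma leb_annulus a b : 0 <= a -> a <= b -> leb (annulus a b) = (omega n * (b ^+ n - a ^+ n))%:E.
Proof.
have vol r : 0 <= r -> leb (annulus 0 r) = (omega n * r ^+ n)%:E.
  rewrite le_eqVlt => /orP[/eqP <-|]; last exact: leb_ball.
  rewrite expr0n gtn_eqF// mulr0 (_ : annulus 0 0 = set0) ?measure0//.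
  by apply/seteqP; split => // x /= /andP[h1 h2]; move: (le_lt_trans h1 h2); rewrite ltxx.
move=> a0 ab; have := vol b (le_trans a0 ab).
have -> : leb (annulus 0 b) = (leb (annulus 0 a) + leb (annulus a b))%E.
  rewrite (annulusU (lexx 0) a0 ab) measureU//; [exact: measurable_annulus|exact: measurable_annulus|].
  by apply/eqP; rewrite -disj_set2E; exact: annulus_disj.
rewrite vol// mulrBr EFinB => <-.
by rewrite addeAC -EFinB subrr add0e.
Qed.

Lemma integrable_annulus (f : 'rV[R]_n -> R) M a b : measurable_fun setT f ->
  (forall x, annulus a b x -> `|f x| <= M) -> leb.-integrable (annulus a b) (EFin \o f).
Proof.
move=> mf fM; have mA := measurable_annulus a b.
apply: (@integrable_dominated _ _ _ _ _ mA _ (fun=> M)) => //; first exact: measurable_funTS.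
apply: integrable_EFinP => //.
by rewrite integral_cst// lte_mul_pinfty// annulus_lty.
Qed.

Lemma Rintegral_annulus_cst a b c : 0 <= a -> a <= b ->
  \int[leb]_(x in annulus a b) c = c * (omega n * (b ^+ n - a ^+ n)).
Proof.
move=> a0 ab; rewrite (Rintegral_cst _ (measurable_annulus a b)); congr (_ * _).
exact: (congr1 fine (leb_annulus a0 ab)).
Qed.

Lemma Rintegral_annulus_bounds (f : 'rV[R]_n -> R) m M a b : 0 <= a -> a <= b ->
  measurable_fun setT f -> (forall x, annulus a b x -> m <= f x <= M) ->
  m * (omega n * (b ^+ n - a ^+ n)) <= \int[leb]_(x in annulus a b) f x <= M * (omega n * (b ^+ n - a ^+ n)).
Proof.
move=> a0 ab mf fM.
have mA := measurable_annulus a b.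
have ic c : leb.-integrable (annulus a b) (EFin \o (fun=> c)).
  by apply: (@integrable_annulus _ `|c|).
have i_f : leb.-integrable (annulus a b) (EFin \o f).
  apply: (@integrable_annulus _ (Num.max `|m| `|M|)) => // x /fM /andP[h1 h2].
  rewrite le_max; case: (ger0P (f x)) => f0; apply/orP.
    by right; rewrite (le_trans h2)// ler_norm.
  by left; rewrite -normrN (le_trans _ (ler_norm _))// lerN2.
rewrite -!Rintegral_annulus_cst//; apply/andP; split.
  by apply: le_Rintegral => // x /fM /andP[].
by apply: le_Rintegral => // x /fM /andP[].
Qed.

Lemma Rintegral_annulusU (f : 'rV[R]_n -> R) a b s : 0 <= s -> s <= a -> a <= b ->
  leb.-integrable (annulus s b) (EFin \o f) ->
  \int[leb]_(x in annulus s b) f x = \int[leb]_(x in annulus s a) f x + \int[leb]_(x in annulus a b) f x.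
Proof.
move=> s0 sa ab i_f; rewrite (annulusU s0 sa ab) Rintegral_setU//.
- exact: measurable_annulus.
- exact: measurable_annulus.
- by rewrite -annulusU.
- exact: annulus_disj.
Qed.

(** Cut [s, r] into N + 1 equal parts. The increments of D over them sum
    up to at most K (r - s) (phi r - phi s) / (N + 1), which tends to 0. *)
Lemma telescoping_increment (D phi : R -> R) (K s r : R) : s <= r ->
  (forall a b, s <= a -> a <= b -> b <= r -> `|D b - D a| <= (phi b - phi a) * (K * (b - a))) ->
  D r = D s.
Proof.
move=> sr H.
set C := `|(phi r - phi s) * (K * (r - s))|.
have bound (N : nat) : `|D r - D s| <= C * (N.+1%:R)^-1.
  pose h := (r - s) / N.+1%:R; have h0 : 0 <= h by rewrite divr_ge0// subr_ge0.
  pose t (i : nat) := s + h * i%:R.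
  have tN : t N.+1 = r by rewrite /t /h mulfVK ?pnatr_eq0// addrC subrK.
  have t0 : t 0%N = s by rewrite /t mulr0 addr0.
  have tS i : t i.+1 - t i = h by rewrite /t -natr1 mulrDr mulr1; ring.
  have tm i : s <= t i by rewrite /t lerDl mulr_ge0.
  have tmono i j : (i <= j)%N -> t i <= t j by move=> ij; rewrite /t lerD2l ler_wpM2l// ler_nat.
  have tele (f : R -> R) : f r - f s = \sum_(0 <= i < N.+1) (f (t i.+1) - f (t i)).
    by rewrite telescope_sumr// tN t0.
  rewrite tele (le_trans (ler_norm_sum _ _ _))//.
  apply: (@le_trans _ _ (\sum_(0 <= i < N.+1) (phi (t i.+1) - phi (t i)) * (K * h))).
    rewrite !big_mkord; apply: ler_sum => i _; rewrite -[X in K * X](tS i); apply: H => //.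
      by apply: tmono.
    by rewrite -tN; apply: tmono.
  rewrite -mulr_suml -tele /C /h (le_trans (ler_norm _))// !normrM normfV normr_nat.
  by rewrite le_eqVlt; apply/orP; left; apply/eqP; ring.
apply/eqP; rewrite -subr_eq0 -normr_le0.
have lim0 : (fun N : nat => C * (N.+1%:R)^-1) @ \oo --> 0.
  by rewrite -(mulr0 C); apply: cvgM; [exact: cvg_cst|exact: cvg_harmonic].
have := ler_cvg_to (cvg_cst `|D r - D s|) lim0; apply; exact: nearW.
Qed.

Lemma is_derive_monomial (c t : R) m :
  is_derive t 1 (fun t : R => c * t ^+ m) (c * (m%:R * t ^+ m.-1)).
Proof.
have h : is_derive t 1 (fun t : R => t ^+ m) (m%:R * t ^+ m.-1).
  apply: DeriveDef; first exact: exprn_derivable.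
  by rewrite exp_derive; exact: mulr1.
exact: (is_deriveZ c h).
Qed.

(** Polar coordinates for a monotone profile. Over an annulus
    a <= |x| < b of volume v, both the integral and the increment of H
    lie between h(a^2) v and h(b^2) v. So their difference has
    increments as in [telescoping_increment], and it is constant. *)
Lemma radial_nondecreasing (h H : R -> R) s r : 0 <= s -> s <= r ->
  measurable_fun setT h ->
  (forall p q, s ^+ 2 <= p -> p <= q -> q <= r ^+ 2 -> h p <= h q) ->
  (forall t, 0 < t -> s < t -> t < r -> is_derive t 1 H (n%:R * omega n * h (t ^+ 2) * t ^+ n.-1)) ->
  {within `[s, r], continuous H} ->
  \int[leb]_(x in annulus s r) h (sqnorm x) = H r - H s.
Proof.
move=> s0 sr mh hmono dH cH.
have mf : measurable_fun setT (fun x : 'rV[R]_n => h (sqnorm x)) by apply: measurableT_comp => //; exact: measurable_sqnorm.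
pose I t := \int[leb]_(x in annulus s t) h (sqnorm x).
have om := omega_gt0.
have sq (a b : R) : 0 <= a -> a <= b -> a ^+ 2 <= b ^+ 2 by move=> a0 ab; rewrite lerXn2r ?nnegrE ?(le_trans a0 ab).
have i_f (a b : R) : s <= a -> a <= b -> b <= r -> leb.-integrable (annulus a b) (EFin \o (fun x => h (sqnorm x))).
  move=> sa ab br; apply: (@integrable_annulus _ (Num.max `|h (s ^+ 2)| `|h (r ^+ 2)|)) => // x /andP[h1 h2].
  have a0 := le_trans s0 sa; have b0 := le_trans a0 ab.
  have l1 : h (s ^+ 2) <= h (sqnorm x).
    by apply: hmono => //; [rewrite (le_trans _ h1)// sq|rewrite (le_trans (ltW h2))// sq].
  have l2 : h (sqnorm x) <= h (r ^+ 2).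
    by apply: hmono => //; [rewrite (le_trans _ h1)// sq|rewrite (le_trans (ltW h2))// sq].
  rewrite le_max; case: (ger0P (h (sqnorm x))) => f0; apply/orP.
    by right; rewrite (le_trans l2)// ler_norm.
  by left; rewrite -normrN (le_trans _ (ler_norm _))// lerN2.
pose D t := I t - H t.
have IS : I s = 0.
  rewrite /I (_ : annulus s s = set0) ?Rintegral_set0//.
  by apply/seteqP; split => // x /= /andP[h1 h2]; move: (le_lt_trans h1 h2); rewrite ltxx.
suff : D r = D s by rewrite /D IS sub0r => /eqP; rewrite subr_eq addrC => /eqP.
apply: (@telescoping_increment D (fun t => h (t ^+ 2)) (omega n * (n%:R * r ^+ n.-1))) => // a b sa ab br.
have a0 := le_trans s0 sa; have b0 := le_trans a0 ab.
set v := omega n * (b ^+ n - a ^+ n).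
have v0 : 0 <= v by rewrite mulr_ge0 ?(ltW om)// subr_ge0 lerXn2r ?nnegrE.
have vK : v <= omega n * (n%:R * r ^+ n.-1) * (b - a).
  rewrite /v -mulrA ler_wpM2l ?(ltW om)// subrXX mulrC ler_wpM2r ?subr_ge0//.
  have r0 := le_trans b0 br; have ar := le_trans ab br.
  apply: (@le_trans _ _ (\sum_(i < n) r ^+ n.-1)).
    apply: ler_sum => i _; have E : (n.-1 - i + i)%N = n.-1 by rewrite subnK// -ltnS prednK.
    rewrite -[X in _ <= r ^+ X]E exprD; apply: ler_pM; rewrite ?exprn_ge0//.
      by apply: lerXn2r; rewrite ?nnegrE.
    by apply: lerXn2r; rewrite ?nnegrE.
  by rewrite sumr_const card_ord mulr_natl.
have hab : h (a ^+ 2) <= h (b ^+ 2) by apply: hmono; rewrite ?sq.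
have /andP[I1 I2] : h (a ^+ 2) * v <= I b - I a <= h (b ^+ 2) * v.
  rewrite /I (Rintegral_annulusU s0 sa ab (i_f _ _ (lexx s) (le_trans sa ab) br)) addrAC subrr add0r.
  apply: Rintegral_annulus_bounds => // x /andP[h1 h2].
  apply/andP; split; apply: hmono => //; rewrite ?(le_trans (ltW h2))// ?sq// ?(le_trans _ h1)// ?sq//.
(* The sign (-1)^e treats the lower and the upper bound on H at once: H
   minus c omega t^n is monotone. *)
have mono (c : R) (e : bool) : (forall t, a < t -> t < b -> 0 <= (-1) ^+ e * (h (t ^+ 2) - c)) ->
    0 <= (-1) ^+ e * ((H b - H a) - c * v).
  move=> hc; move: ab; rewrite le_eqVlt => /orP[/eqP ab'|ab].
    by rewrite /v -ab' !(subrr, mulr0).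
  have dG t : t \in `]a, b[ -> is_derive t 1 (fun t => H t - c * omega n * t ^+ n)
      (n%:R * omega n * h (t ^+ 2) * t ^+ n.-1 - c * omega n * (n%:R * t ^+ n.-1)).
    rewrite in_itv/= => /andP[at_ tb].
    have h1 := dH t (le_lt_trans a0 at_) (le_lt_trans sa at_) (lt_le_trans tb br).
    have h2 : is_derive t 1 (fun t : R => c * omega n * t ^+ n) (c * omega n * (n%:R * t ^+ n.-1)).
      exact: is_derive_monomial.
    rewrite (_ : (fun t => _) = H - (fun t : R => c * omega n * t ^+ n)); last exact/funext.
    exact: (is_deriveB h1 h2).
  have cG : {within `[a, b], continuous (fun t => H t - c * omega n * t ^+ n)}.
    have cab : {within `[a, b], continuous H}.
      apply: continuous_subspaceW cH => t /=; rewrite !in_itv/= => /andP[h1 h2].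
      by rewrite (le_trans sa)// (le_trans _ br).
    move=> t; apply: cvgB; first exact: cab.
    apply: cvgM; first exact: cvg_cst.
    by have := @continuous_subspaceT _ _ `[a, b]%classic (fun t : R => t ^+ n) (@exprn_continuous R n) t.
  have [u uab E] := MVT ab dG cG.
  have -> : (H b - H a) - c * v = H b - c * omega n * b ^+ n - (H a - c * omega n * a ^+ n) by rewrite /v; ring.
  rewrite E; move: uab; rewrite in_itv/= => /andP[au ub].
  have -> : n%:R * omega n * h (u ^+ 2) * u ^+ n.-1 - c * omega n * (n%:R * u ^+ n.-1) =
    (h (u ^+ 2) - c) * (n%:R * omega n * u ^+ n.-1) by ring.
  rewrite !mulrA mulr_ge0 ?subr_ge0 ?(ltW ab)// -!mulrA mulrA mulr_ge0 ?hc//.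
  by rewrite !mulr_ge0 ?(ltW om)// exprn_ge0// (le_trans a0 (ltW au)).
have H1 : h (a ^+ 2) * v <= H b - H a.
  rewrite -subr_ge0 -[X in 0 <= X]mul1r; apply: (mono _ false) => t at_ tb.
  rewrite expr0 mul1r subr_ge0; have t0 := le_trans a0 (ltW at_).
  by apply: hmono; rewrite ?sq ?(ltW at_) ?(le_trans (ltW tb) br).
have H2 : H b - H a <= h (b ^+ 2) * v.
  rewrite -subr_ge0 -opprB -mulN1r; apply: (mono _ true) => t at_ tb.
  rewrite expr1 mulN1r opprB subr_ge0; have t0 := le_trans a0 (ltW at_).
  by apply: hmono; rewrite ?sq ?(ltW tb)// (le_trans sa (ltW at_)).
apply: (@le_trans _ _ ((h (b ^+ 2) - h (a ^+ 2)) * v)); last by rewrite ler_wpM2l// subr_ge0.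
rewrite /D ler_norml; apply/andP; split.
  by rewrite mulrBl; lra.
by rewrite mulrBl; lra.
Qed.

Lemma radial_nonincreasing (h H : R -> R) s r : 0 <= s -> s <= r ->
  measurable_fun setT h ->
  (forall p q, s ^+ 2 <= p -> p <= q -> q <= r ^+ 2 -> h q <= h p) ->
  (forall t, 0 < t -> s < t -> t < r -> is_derive t 1 H (n%:R * omega n * h (t ^+ 2) * t ^+ n.-1)) ->
  {within `[s, r], continuous H} ->
  \int[leb]_(x in annulus s r) h (sqnorm x) = H r - H s.
Proof.
move=> s0 sr mh hmono dH cH.
have := @radial_nondecreasing (fun t => - h t) (fun t => - H t) s r s0 sr.
have mNh : measurable_fun setT (fun t : R => - h t) by apply: measurable_funN.
have r0 := le_trans s0 sr.
move=> /(_ mNh) E; apply: oppr_inj; rewrite opprB.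
have -> : H s - H r = - H r - - H s by ring.
transitivity (\int[leb]_(x in annulus s r) (- h (sqnorm x))); last apply: E.
- have mA := measurable_annulus s r.
  rewrite -[LHS]mulN1r -RintegralZl//; last first.
    apply: (@integrable_annulus _ (Num.max `|h (s ^+ 2)| `|h (r ^+ 2)|)).
      by apply: measurableT_comp => //; exact: measurable_sqnorm.
    move=> x /andP[h1 h2].
    have l1 : h (sqnorm x) <= h (s ^+ 2) by apply: hmono => //; exact: ltW.
    have l2 : h (r ^+ 2) <= h (sqnorm x) by apply: hmono => //; exact: ltW.
    rewrite le_max; case: (ger0P (h (sqnorm x))) => f0; apply/orP.
      by left; rewrite (le_trans l1)// ler_norm.
    by right; rewrite -normrN (le_trans _ (ler_norm _))// lerN2.
  by congr Rintegral; apply/funext => x; rewrite mulN1r.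
- by move=> p q sp pq qr; rewrite lerN2 hmono.
- move=> t t0 st tr; have h1 := dH t t0 st tr.
  by apply: is_derive_eq; rewrite mulrN mulNr.
- by move=> t; apply: cvgN; exact: cH.
Qed.

End radial.

(** * The bathtub problem for the envelope *)

Section bathtub.
Context {R : realType} (n : nat) (n_ge2 : (2 <= n)%N) (V : R) (V_gt0 : 0 < V).
Notation leb := (lebesgue_row R n).
Implicit Types (xi : 'rV[R]_n) (L r a b : R) (k : nat).
Let n_gt0 : (0 < n)%N. Proof. exact: ltn_trans n_ge2. Qed.
Let C : R := V / (2 * pi) ^+ n.
Let om := @omega R n.
Let om0 : 0 < om. Proof. exact: omega_gt0. Qed.
Let C0 : 0 < C. Proof. by rewrite divr_gt0// exprn_gt0// mulr_gt0// pi_gt0. Qed.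
Notation env := (@envelope R n V).

Let env_ge0 L xi : 0 <= L -> 0 <= env L xi.
Proof. by move=> L0; rewrite envelope_ge0// ltW. Qed.
Let env_le L xi : env L xi <= C.
Proof. by rewrite envelope_le// ltW. Qed.
Let menv L : measurable_fun setT (env L).
Proof. exact: measurable_envelope. Qed.

Lemma envelope_inner L xi : 0 < L -> sqnorm xi <= L -> env L xi = C.
Proof.
move=> L0 qL; rewrite /envelope; case: eqVneq => [_|x0]; first by rewrite mulr1.
have q0 := sqnorm_gt0 x0.
have h : 1 <= L / sqnorm xi by rewrite ler_pdivlMr// mul1r.
by case: (leP 1 _) h => _ h; rewrite ?mulr1// leNgt in h *; move: h; case: ltP.
Qed.

Lemma envelope_outer L xi : 0 < L -> L <= sqnorm xi -> env L xi = C * (L / sqnorm xi).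
Proof.
move=> L0 qL; have q0 : 0 < sqnorm xi by exact: lt_le_trans qL.
have x0 : xi != 0 by rewrite -sqnorm_le0 -ltNge.
rewrite /envelope (negbTE x0).
have h : L / sqnorm xi <= 1 by rewrite ler_pdivrMr// mul1r.
by rewrite min_r.
Qed.

Lemma envelope_mono L L' xi : 0 < L -> L <= L' -> env L xi <= env L' xi.
Proof.
move=> L0 LL'; have [h|h] := leP (sqnorm xi) L'.
  by rewrite (envelope_inner (lt_le_trans L0 LL') h) env_le.
have hL := le_lt_trans LL' h.
rewrite (envelope_outer L0 (ltW hL)) (envelope_outer (lt_le_trans L0 LL') (ltW h)).
by rewrite ler_wpM2l ?(ltW C0)// ler_wpM2r// invr_ge0 sqnorm_ge0.
Qed.

(** The envelope is a constant times the minimum of 1 and a linear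
    function of L. This is what makes the minimal energy convex in L. *)
Lemma envelope_concave L1 L2 (s : R) xi : 0 < L1 -> 0 < L2 -> 0 <= s <= 1 ->
  s * env L1 xi + (1 - s) * env L2 xi <= env (s * L1 + (1 - s) * L2) xi.
Proof.
move=> L10 L20 /andP[s0 s1]; have s1' : 0 <= 1 - s by rewrite subr_ge0.
set L := s * L1 + _.
have L0 : 0 < L.
  have m0 : 0 < Num.min L1 L2 by rewrite lt_min L10 L20.
  rewrite (lt_le_trans m0)// /L.
  have -> : Num.min L1 L2 = s * Num.min L1 L2 + (1 - s) * Num.min L1 L2 by ring.
  by rewrite lerD// ler_wpM2l// ge_min lexx ?orbT.
have up L' : 0 < L' -> xi != 0 -> env L' xi <= C * (L' / sqnorm xi).
  move=> L'0 x0; rewrite /envelope (negbTE x0) ler_wpM2l ?(ltW C0)//.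
  by rewrite ge_min lexx orbT.
have [h|h] := leP (sqnorm xi) L.
  rewrite (envelope_inner L0 h).
  have -> : C = s * C + (1 - s) * C by ring.
  by rewrite lerD// ler_wpM2l// env_le.
rewrite (envelope_outer L0 (ltW h)).
have x0 : xi != 0 by rewrite -sqnorm_le0 -ltNge (lt_trans L0 h).
apply: (@le_trans _ _ (s * (C * (L1 / sqnorm xi)) + (1 - s) * (C * (L2 / sqnorm xi)))).
  by rewrite lerD// ler_wpM2l// up.
by rewrite le_eqVlt; apply/orP; left; apply/eqP; rewrite /L; field; rewrite gt_eqF// sqnorm_gt0.
Qed.

(** [mass] and [energy] are those of the envelope cut off at radius r. *)
Definition mass L r := \int[leb]_(xi in annulus 0 r) env L xi.
Definition energy L r := \int[leb]_(xi in annulus 0 r) (sqnorm xi * env L xi).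

Let env_norm L xi : 0 <= L -> `|env L xi| <= C.
Proof. by move=> L0; rewrite ger0_norm ?env_ge0 ?env_le. Qed.

Let ienv L a b : 0 <= L -> leb.-integrable (annulus a b) (EFin \o env L).
Proof. by move=> L0; apply: (@integrable_annulus _ _ _ C) => // x _; exact: env_norm. Qed.

Let iqenv L a b : 0 <= L -> leb.-integrable (annulus a b) (EFin \o (fun xi => sqnorm xi * env L xi)).
Proof.
move=> L0; apply: (@integrable_annulus _ _ _ (b ^+ 2 * C)).
  by apply: measurable_funM => //; exact: measurable_sqnorm.
move=> x /andP[_ h]; rewrite normrM ger0_norm ?sqnorm_ge0//.
by apply: ler_pM; rewrite ?sqnorm_ge0 ?env_norm// ltW.
Qed.

Lemma mass_increment L a b : 0 <= L -> 0 <= a -> a <= b ->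
  0 <= mass L b - mass L a <= C * (om * (b ^+ n - a ^+ n)).
Proof.
move=> L0 a0 ab.
have E : mass L b - mass L a = \int[leb]_(x in annulus a b) env L x.
  by rewrite /mass (Rintegral_annulusU (lexx 0) a0 ab (ienv _ _ L0)) addrAC subrr add0r.
have /andP[h1 h2] := @Rintegral_annulus_bounds R n n_gt0 (env L) 0 C a b a0 ab (menv L) (fun x _ => introT andP (conj (env_ge0 x L0) (env_le L x))).
by rewrite E h2 andbT; move: h1; rewrite mul0r.
Qed.

Lemma mass_norm L r : mass L `|r| = mass L r.
Proof.
rewrite /mass; suff -> : annulus 0 `|r| = annulus 0 r :> set 'rV[R]_n by [].
by apply/seteqP; split => x; rewrite /annulus /= real_normK ?num_real.
Qed.

Lemma mass_continuous L : 0 <= L -> continuous (mass L).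
Proof.
move=> L0 x.
have b t : `|mass L t - mass L x| <= C * om * `| `|t| ^+ n - `|x| ^+ n|.
  rewrite -(mass_norm L t) -(mass_norm L x).
  wlog : t x / `|x| <= `|t|.
    by move=> H; have [h|/ltW h] := leP `|x| `|t|; [exact: H|rewrite distrC [X in _ <= _ * X]distrC; exact: H].
  move=> xt; have /andP[h1 h2] := mass_increment L0 (normr_ge0 x) xt.
  rewrite ger0_norm// (le_trans h2)// mulrA ler_wpM2l ?ler_norm//.
  by rewrite mulr_ge0 ?(ltW C0) ?(ltW om0).
apply/subr_cvg0; apply/norm_cvg0P.
have c0 : C * om * `| `|t| ^+ n - `|x| ^+ n| @[t --> x] --> 0.
  rewrite -(mulr0 (C * om)); apply: cvgM; first exact: cvg_cst.
  apply/norm_cvg0P/subr_cvg0.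
  apply: (@cvg_comp _ _ _ (fun t : R => `|t|) (fun t : R => t ^+ n)); last exact: exprn_continuous.
  by apply: cvg_norm; exact: cvg_id.
apply: (squeeze_cvgr _ (cvg_cst 0) c0); apply: nearW => t.
by rewrite normr_ge0/=.
Qed.

(** The integral of |y|^-2 over 1 < |y| < x, divided by the volume of
    the unit ball. *)
Definition tail_factor (x : R) : R := if n == 2 then 2 * ln x else n%:R / (n%:R - 2) * (x ^+ (n - 2) - 1).

Lemma Rintegral_inv_annulus a (x : R) : 0 < a -> 1 <= x ->
  \int[leb]_(xi in annulus a (x * a)) (sqnorm xi)^-1 = om * a ^+ (n - 2) * tail_factor x.
Proof.
move=> a0 x1; have x0 : 0 < x by exact: lt_le_trans x1.
(* A primitive of n omega t^-2 t^(n-1), which is logarithmic in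
   dimension 2. *)
pose H (t : R) := if n == 2 then 2 * om * ln t else n%:R * om / (n%:R - 2) * t ^+ (n - 2).
have axa : a <= x * a by rewrite ler_peMl// ltW.
have n2 : n != 2 -> n%:R - 2 != 0 :> R.
  by move=> ne; rewrite subr_eq0 eqr_nat.
have dH (t : R) : 0 < t -> is_derive t 1 H (n%:R * om * (t ^+ 2)^-1 * t ^+ n.-1).
  move=> t0; rewrite /H; case: eqVneq => [n2E|ne].
    have dl := is_derive1_ln t0; apply: is_derive_eq.
    rewrite /GRing.scale /= n2E /=; field; rewrite gt_eqF//.
  apply: (is_derive_eq (is_derive_monomial _ _ _)).
  have -> : n.-1 = (2 + (n - 2).-1)%N by move: n_ge2 ne; case: n => [|[|[|]]].
  rewrite exprD natrB//; field.
  by rewrite n2//= gt_eqF.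
transitivity (H (x * a) - H a); last first.
- rewrite /H /tail_factor; case: eqVneq => [n2E|ne].
    by rewrite n2E subnn expr0 lnM ?posrE//; ring.
  by rewrite exprMn -mulrBr; field; exact: n2.
apply: (@radial_nonincreasing R n n_gt0 (fun p => p^-1) H a (x * a)) => //.
- exact: ltW.
- exact: measurable_invR.
- move=> p q ap pq _; have p0 : 0 < p by rewrite (lt_le_trans _ ap)// exprn_gt0.
  by rewrite lef_pV2 ?posrE// (lt_le_trans p0).
- by move=> t t0 _ _; exact: dH.
- apply: derivable_within_continuous => t; rewrite in_itv/= => /andP[at_ _].
  by have [] := dH t (lt_le_trans a0 at_).
Qed.

Lemma mass_formula L a (x : R) : 0 < a -> a ^+ 2 = L -> 1 <= x ->
  mass L (x * a) = C * om * a ^+ n * (1 + tail_factor x).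
Proof.
move=> a0 aL x1; have L0 : 0 < L by rewrite -aL exprn_gt0.
have axa : a <= x * a by rewrite ler_peMl// ltW.
rewrite /mass (Rintegral_annulusU (lexx 0) (ltW a0) axa (ienv _ _ (ltW L0))).
have -> : \int[leb]_(xi in annulus 0 a) env L xi = C * (om * a ^+ n).
  have := Rintegral_annulus_cst n_gt0 C (lexx 0) (ltW a0).
  rewrite expr0n gtn_eqF// subr0 => <-; apply: eq_Rintegral => xi.
  by rewrite inE => /andP[_ h]; rewrite envelope_inner// -aL ltW.
have -> : \int[leb]_(xi in annulus a (x * a)) env L xi = C * L * (om * a ^+ (n - 2) * tail_factor x).
  rewrite -Rintegral_inv_annulus// -RintegralZl; last 2 first.
  - exact: measurable_annulus.
  - apply: (@integrable_annulus _ _ _ (a ^+ 2)^-1).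
      by apply: (measurableT_comp measurable_invR); exact: measurable_sqnorm.
    move=> xi /andP[h _]; rewrite ger0_norm ?invr_ge0 ?sqnorm_ge0//.
    by rewrite lef_pV2 ?posrE// ?exprn_gt0// (lt_le_trans _ h)// exprn_gt0.
  apply: eq_Rintegral => xi; rewrite inE => /andP[h _].
  by rewrite envelope_outer// -?aL// mulrA.
have -> : a ^+ n = L * a ^+ (n - 2) by rewrite -aL -exprD subnKC.
ring.
Qed.

Lemma energy_formula L a (x : R) : 0 < a -> a ^+ 2 = L -> 1 <= x ->
  energy L (x * a) = C * om * a ^+ n * L * (n%:R / (n%:R + 2) + x ^+ n - 1).
Proof.
move=> a0 aL x1; have L0 : 0 < L by rewrite -aL exprn_gt0.
have axa : a <= x * a by rewrite ler_peMl// ltW.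
have n20 : n%:R + 2 != 0 :> R by rewrite gt_eqF// ltr_wpDl.
rewrite /energy (Rintegral_annulusU (lexx 0) (ltW a0) axa (iqenv _ _ (ltW L0))).
have -> : \int[leb]_(xi in annulus 0 a) (sqnorm xi * env L xi) = C * (n%:R * om / (n%:R + 2) * a ^+ n.+2).
  transitivity (\int[leb]_(xi in annulus 0 a) (C * sqnorm xi)).
    apply: eq_Rintegral => xi; rewrite inE => /andP[_ h].
    by rewrite envelope_inner// -?aL ?ltW// mulrC.
  rewrite RintegralZl; [|exact: measurable_annulus|]; last first.
    apply: (@integrable_annulus _ _ _ (a ^+ 2)); first exact: measurable_sqnorm.
    by move=> xi /andP[_ h]; rewrite ger0_norm ?sqnorm_ge0// ltW.
  congr (_ * _).
  pose H (t : R) := n%:R * om / (n%:R + 2) * t ^+ n.+2.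
  transitivity (H a - H 0); last by rewrite /H expr0n mulr0 subr0.
  apply: (@radial_nondecreasing R n n_gt0 id H 0 a (lexx 0) (ltW a0)).
  - exact: measurable_id.
  - by [].
  - move=> t t0 _ _; apply: (is_derive_eq (is_derive_monomial _ _ _)) => /=.
    have -> : n.+1 = (2 + n.-1)%N by rewrite add2n prednK.
    have -> : (2 + n.-1).+1 = (n + 2)%N by lia.
    rewrite exprD natrD -/om; field.
    by rewrite -natrD addn2 pnatr_eq0.
  - apply: continuous_subspaceT => t; apply: cvgM; first exact: cvg_cst.
    exact: exprn_continuous.
have -> : \int[leb]_(xi in annulus a (x * a)) (sqnorm xi * env L xi) = C * L * (om * ((x * a) ^+ n - a ^+ n)).
  rewrite -(Rintegral_annulus_cst n_gt0 (C * L) (ltW a0) axa); apply: eq_Rintegral => xi.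
  rewrite inE => /andP[h _]; rewrite envelope_outer// -?aL//.
  have q0 : 0 < sqnorm xi by rewrite (lt_le_trans _ h)// exprn_gt0.
  by field; rewrite gt_eqF.
have -> : a ^+ n.+2 = a ^+ n * L by rewrite -aL -exprD addn2.
by rewrite exprMn; field.
Qed.

(** For n >= 2 the tail |xi|^-2 of the envelope is not integrable at
    infinity, so the mass grows from 0 without bound and takes the
    value k. *)
Lemma exists_radius L k : 0 < L -> exists2 r, 0 <= r & mass L r = k%:R.
Proof.
move=> L0; pose a := Num.sqrt L; have a0 : 0 < a by rewrite sqrtr_gt0.
have aL : a ^+ 2 = L by rewrite sqr_sqrtr// ltW.
pose D := C * om * a ^+ n; have D0 : 0 < D.
  by apply: mulr_gt0; [exact: mulr_gt0|exact: exprn_gt0].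
(* D is the mass inside the radius a, and 1 + tail_factor x >= k / D is
   wanted. The choice x = exp(k / D) works: 2 ln x = 2 k / D, and x^(n-2)
   - 1 >= (n - 2) k / D. *)
pose T := k%:R / D; have T0 : 0 <= T by rewrite divr_ge0// ltW.
pose x := expR T; have x1 : 1 <= x by rewrite -expR0 ler_expR.
have hx : T <= tail_factor x.
  rewrite /tail_factor; case: eqVneq => [_|ne].
    by rewrite /x expRK ler_peMl// ler1n.
  have n3 : (3 <= n)%N by rewrite ltn_neqAle eq_sym ne.
  have m0 : 0 < n%:R - 2 :> R by rewrite subr_gt0 ltr_nat.
  have h1 : T * (n%:R - 2) <= x ^+ (n - 2) - 1.
    rewrite lerBrDl /x -expRM_natl; have := expR_ge1Dx ((n - 2)%:R * T).
    by rewrite natrB// [_ * T]mulrC.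
  rewrite (le_trans _ (ler_wpM2l _ h1))//.
    by rewrite mulrCA divfK ?gt_eqF// ler_peMr// ler1n.
  by rewrite divr_ge0// ltW.
have big : k%:R <= mass L (x * a).
  rewrite (mass_formula a0 aL x1) -/D (le_trans _ (ler_wpM2l (ltW D0) (_ : T <= 1 + tail_factor x)))//.
    by rewrite /T mulrC divfK// gt_eqF.
  by rewrite (le_trans hx)// lerDr.
have m00 : mass L 0 = 0.
  rewrite /mass (_ : annulus 0 0 = set0) ?Rintegral_set0//.
  by apply/seteqP; split => // y /andP[h1 h2]; move: (le_lt_trans h1 h2); rewrite ltxx.
have xa0 : 0 <= x * a by rewrite mulr_ge0 ?expR_ge0// ltW.
have := @IVT R (mass L) 0 (x * a) k%:R xa0 (continuous_subspaceT (mass_continuous (ltW L0))).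
have M0 : 0 <= mass L (x * a) by exact: le_trans big.
rewrite m00 min_l// max_r// ler0n big => /(_ isT)[r].
by rewrite in_itv/= => /andP[r0 _] rk; exists r.
Qed.

Definition cutoff L r : 'rV[R]_n -> R := fun xi => if sqnorm xi < r ^+ 2 then env L xi else 0.

Lemma cutoffE L r (w : 'rV[R]_n -> R) : \int[leb]_xi (w xi * cutoff L r xi) = \int[leb]_(xi in annulus 0 r) (w xi * env L xi).
Proof.
rewrite [RHS]Rintegral_mkcond; congr Rintegral; apply/funext => xi.
rewrite patchE /cutoff; have -> : (xi \in annulus 0 r) = (sqnorm xi < r ^+ 2).
  by apply/idP/idP; rewrite inE /annulus /= expr0n sqnorm_ge0.
by case: ifP => _; rewrite ?mulr0.
Qed.

Lemma integrable_cutoff L r (w : 'rV[R]_n -> R) :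
  leb.-integrable (annulus 0 r) (EFin \o (fun xi => w xi * env L xi)) ->
  leb.-integrable setT (EFin \o (fun xi => w xi * cutoff L r xi)).
Proof.
move=> iw; have := (integrable_mkcond _ (measurable_annulus 0 r)).1 iw.
apply: eq_integrable => // xi _ /=.
rewrite patchE /cutoff; have -> : (xi \in annulus 0 r) = (sqnorm xi < r ^+ 2).
  by apply/idP/idP; rewrite inE /annulus /= expr0n sqnorm_ge0.
by case: ifP => _ /=; rewrite ?mulr0.
Qed.

Let icutoff L r : 0 <= L -> leb.-integrable setT (EFin \o cutoff L r).
Proof.
move=> L0; have := @integrable_cutoff L r (fun=> 1).
rewrite (_ : (fun xi => 1 * cutoff L r xi) = cutoff L r); last by apply/funext => xi; rewrite mul1r.
apply; rewrite (_ : (fun xi => 1 * env L xi) = env L); last by apply/funext => xi; rewrite mul1r.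
exact: ienv.
Qed.

Lemma Rintegral_cutoff L r : \int[leb]_xi cutoff L r xi = mass L r.
Proof.
have := cutoffE L r (fun=> 1); rewrite (_ : (fun xi => 1 * cutoff L r xi) = cutoff L r); last by apply/funext => xi; rewrite mul1r.
by rewrite (_ : (fun xi => 1 * env L xi) = env L)//; apply/funext => xi; rewrite mul1r.
Qed.

Lemma cutoff_bounds L r xi : 0 <= L -> 0 <= cutoff L r xi <= env L xi.
Proof. by move=> L0; rewrite /cutoff; case: ifP => _; rewrite ?lexx ?env_ge0. Qed.

Lemma cutoff_admissible L r k : 0 <= L -> mass L r = k%:R -> admissible V k L (cutoff L r).
Proof.
move=> L0 mk; split.
- by apply/measurable_EFinP; exact: measurable_int (icutoff r L0).
- by move=> xi; exact: cutoff_bounds.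
- by rewrite (EFin_Rintegral measurableT (icutoff r L0)) Rintegral_cutoff mk.
Qed.

Lemma energy_cutoff L r : 0 <= L -> (\int[leb]_xi (sqnorm xi * cutoff L r xi)%:E)%E = (energy L r)%:E.
Proof. by move=> L0; rewrite (EFin_Rintegral measurableT (integrable_cutoff (iqenv 0 r L0))) cutoffE. Qed.

(** The factors |xi|^2 - r^2 and f - cutoff never have opposite signs:
    inside the ball the cut-off envelope is the largest possible value,
    outside it vanishes. Integrating their product and using that both
    functions have mass k compares the energies. *)
Lemma bathtub L r k : 0 < L -> mass L r = k%:R -> Mmin n V k L = (energy L r)%:E.
Proof.
move=> L0 mk; apply/eqP; rewrite eq_le; apply/andP; split.
  by apply: ereal_inf_lbound; exists (cutoff L r); [exact: cutoff_admissible (ltW L0) mk|exact: energy_cutoff (ltW L0)].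
apply: le_ereal_inf_tmp => _ [f [mf f01 fk] <-].
have mq := @measurable_sqnorm R n.
have mt : measurable_fun setT (cutoff L r) by apply/measurable_EFinP; exact: measurable_int (icutoff r (ltW L0)).
have f0 xi : 0 <= f xi by have /andP[] := f01 xi.
have t0 xi : 0 <= cutoff L r xi by have /andP[] := cutoff_bounds r xi (ltW L0).
have P : (\int[leb]_xi (sqnorm xi * cutoff L r xi + r ^+ 2 * f xi)%:E <= \int[leb]_xi (sqnorm xi * f xi + r ^+ 2 * cutoff L r xi)%:E)%E.
  apply: ge0_le_integral => //.
  - by move=> xi _; rewrite lee_fin addr_ge0// mulr_ge0 ?sqr_ge0 ?sqnorm_ge0.
  - by apply/measurable_EFinP; apply: measurable_funD; apply: measurable_funM.
  - by apply/measurable_EFinP; apply: measurable_funD; apply: measurable_funM.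
  - move=> xi _; rewrite lee_fin -subr_ge0.
    have -> : sqnorm xi * f xi + r ^+ 2 * cutoff L r xi - (sqnorm xi * cutoff L r xi + r ^+ 2 * f xi) =
       (sqnorm xi - r ^+ 2) * (f xi - cutoff L r xi) by ring.
    rewrite /cutoff; case: ltP => h; last by rewrite subr0 mulr_ge0// subr_ge0.
    by rewrite mulr_le0// subr_le0; [exact: ltW|have /andP[] := f01 xi].
have split (f1 f2 : 'rV[R]_n -> R) : measurable_fun setT f1 -> measurable_fun setT f2 ->
    (forall xi, 0 <= f1 xi) -> (forall xi, 0 <= f2 xi) ->
    (\int[leb]_xi (sqnorm xi * f1 xi + r ^+ 2 * f2 xi)%:E = \int[leb]_xi (sqnorm xi * f1 xi)%:E + (r ^+ 2)%:E * \int[leb]_xi (f2 xi)%:E)%E.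
  move=> m1 m2 p1 p2; rewrite -ge0_integralZl//; last 3 first.
  - exact/measurable_EFinP.
  - by move=> xi _; rewrite lee_fin.
  - by rewrite lee_fin sqr_ge0.
  rewrite -ge0_integralD//.
  - by move=> xi _; rewrite lee_fin mulr_ge0// sqnorm_ge0.
  - by apply/measurable_EFinP; apply: measurable_funM.
  - by move=> xi _; rewrite -EFinM lee_fin mulr_ge0// sqr_ge0.
  - by apply: measurable_funeM; apply/measurable_EFinP.
move: P; rewrite !split// fk energy_cutoff ?(ltW L0)// (EFin_Rintegral measurableT (icutoff r (ltW L0))).
by rewrite Rintegral_cutoff mk leeD2rE.
Qed.

(** At mu = r^2 the dual weight is supported in the ball of radius r,
    where it is r^2 - |xi|^2. *)
Lemma energy_dual L r : 0 < L ->
  \int[leb]_xi (tweight (r ^+ 2) xi * env L xi) = r ^+ 2 * mass L r - energy L r.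
Proof.
move=> L0; rewrite /mass /energy -RintegralZl; [|exact: measurable_annulus|exact: ienv (ltW L0)].
rewrite -RintegralB; [|exact: measurable_annulus|by apply: integrable_EFinZ; [exact: measurable_annulus|exact: ienv (ltW L0)]|exact: iqenv (ltW L0)].
rewrite [RHS]Rintegral_mkcond; congr Rintegral; apply/funext => xi.
rewrite patchE; have -> : (xi \in annulus 0 r) = (sqnorm xi < r ^+ 2).
  by apply/idP/idP; rewrite inE /annulus /= expr0n sqnorm_ge0.
rewrite /tweight; case: ltP => h.
  by rewrite max_r ?subr_ge0 ?ltW// mulrBl.
by rewrite max_l ?subr_le0// mul0r.
Qed.

(** The multiplier mu = r^2, for the radius r at which the mass is k,
    makes the right-hand side equal to r^2 k - M(L). *)
Lemma Mmin_dual_bound L k S : 0 < L ->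
  (forall mu, mu * k%:R - S <= \int[leb]_xi (tweight mu xi * env L xi)) ->
  (Mmin n V k L <= S%:E)%E.
Proof.
move=> L0 H; have [r r0 rk] := exists_radius k L0.
rewrite (bathtub L0 rk) lee_fin; have := H (r ^+ 2).
by rewrite energy_dual// rk; lra.
Qed.

Definition min_energy k L : R := fine (Mmin n V k L).

Lemma MminE k L : 0 < L -> Mmin n V k L = (min_energy k L)%:E.
Proof. by move=> L0; have [r _ rk] := exists_radius k L0; rewrite /min_energy (bathtub L0 rk). Qed.

Lemma min_energy_ge0 k L : 0 <= min_energy k L.
Proof.
rewrite /min_energy; apply: fine_ge0; apply: le_ereal_inf_tmp => _ [f [_ f01 _] <-].
apply: integral_ge0 => xi _; rewrite lee_fin mulr_ge0 ?sqnorm_ge0//.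
by have /andP[] := f01 xi.
Qed.

Lemma min_energy_nonincreasing k L L' : 0 < L -> L <= L' -> min_energy k L' <= min_energy k L.
Proof.
move=> L0 LL'; have L'0 := lt_le_trans L0 LL'.
rewrite -lee_fin -!MminE//; apply: ereal_inf_le_tmp => _ [f [mf f01 fk] <-].
exists f => //; split => // xi; have /andP[-> h] := f01 xi.
exact: le_trans h (envelope_mono _ L0 LL').
Qed.

(** A convex combination of minimisers for L1 and L2 is admissible for
    the convex combination of L1 and L2, by [envelope_concave]. *)
Lemma min_energy_convex k L1 L2 (s : R) : 0 < L1 -> 0 < L2 -> 0 <= s <= 1 ->
  min_energy k (s * L1 + (1 - s) * L2) <= s * min_energy k L1 + (1 - s) * min_energy k L2.
Proof.
move=> L10 L20 /andP[s0 s1]; have s1' : 0 <= 1 - s by rewrite subr_ge0.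
have L0 : 0 < s * L1 + (1 - s) * L2.
  have m0 : 0 < Num.min L1 L2 by rewrite lt_min L10 L20.
  rewrite (lt_le_trans m0)//.
  have -> : Num.min L1 L2 = s * Num.min L1 L2 + (1 - s) * Num.min L1 L2 by ring.
  by rewrite lerD// ler_wpM2l// ge_min lexx ?orbT.
have [r1 _ k1] := exists_radius k L10; have [r2 _ k2] := exists_radius k L20.
have E1 : min_energy k L1 = energy L1 r1 by rewrite /min_energy (bathtub L10 k1).
have E2 : min_energy k L2 = energy L2 r2 by rewrite /min_energy (bathtub L20 k2).
have i1 := icutoff r1 (ltW L10); have i2 := icutoff r2 (ltW L20).
have j1 := integrable_cutoff (iqenv 0 r1 (ltW L10)); have j2 := integrable_cutoff (iqenv 0 r2 (ltW L20)).
rewrite -lee_fin -MminE//; apply: ereal_inf_lbound.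
exists (fun xi => s * cutoff L1 r1 xi + (1 - s) * cutoff L2 r2 xi).
  split.
  - apply/measurable_EFinP; apply: measurable_int (_ : leb.-integrable _ _).
    by apply: integrable_EFinD => //; apply: integrable_EFinZ.
  - move=> xi; have /andP[a1 b1] := cutoff_bounds r1 xi (ltW L10); have /andP[a2 b2] := cutoff_bounds r2 xi (ltW L20).
    rewrite addr_ge0 ?mulr_ge0//=; apply: le_trans (envelope_concave xi L10 L20 (introT andP (conj s0 s1))).
    by rewrite lerD// ler_wpM2l.
  - rewrite (EFin_Rintegral measurableT); last by apply: integrable_EFinD => //; apply: integrable_EFinZ.
    rewrite RintegralD//; [|exact: integrable_EFinZ|exact: integrable_EFinZ].
    by rewrite !RintegralZl// !Rintegral_cutoff k1 k2; congr EFin; ring.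
rewrite (_ : (fun xi => _) = (fun xi => (s * (sqnorm xi * cutoff L1 r1 xi) + (1 - s) * (sqnorm xi * cutoff L2 r2 xi))%:E)); last first.
  by apply/funext => xi; congr EFin; ring.
rewrite (EFin_Rintegral measurableT); last by apply: integrable_EFinD => //; apply: integrable_EFinZ.
rewrite RintegralD//; [|exact: integrable_EFinZ|exact: integrable_EFinZ].
by rewrite !RintegralZl// !cutoffE E1 E2.
Qed.

(** L' is a convex combination of L and c / 2, with a weight on c / 2 of
    order L - L'. *)
Lemma min_energy_lipschitz k (c L L' : R) : 0 < c -> c <= L' -> L' <= L ->
  min_energy k L' - min_energy k L <= 2 / c * min_energy k (c / 2) * (L - L').
Proof.
move=> c0 cL' L'L; have L0 : 0 < L by rewrite (lt_le_trans c0)// (le_trans cL').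
have c20 : 0 < c / 2 by rewrite divr_gt0.
have d0 : c / 2 <= L - c / 2 by lra.
have dpos : 0 < L - c / 2 by exact: lt_le_trans d0.
pose u := (L - L') / (L - c / 2).
have u0 : 0 <= u by apply: divr_ge0; [rewrite subr_ge0|exact: ltW].
have u1 : u <= 1 by rewrite ler_pdivrMr// mul1r; lra.
have s01 : 0 <= 1 - u <= 1 by lra.
have := min_energy_convex k L0 c20 s01.
have -> : (1 - u) * L + (1 - (1 - u)) * (c / 2) = L'.
  by rewrite /u; field; rewrite gt_eqF//; lra.
rewrite subKr => H.
have m0 := min_energy_ge0 k L; have m1 := min_energy_ge0 k (c / 2).
have : u <= 2 / c * (L - L').
  rewrite /u mulrC ler_wpM2r ?subr_ge0//.
  by rewrite -[2 / c]invf_div lef_pV2 ?posrE.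
move=> uc; apply: (@le_trans _ _ (u * min_energy k (c / 2))).
  by have := mulr_ge0 u0 m0; nra.
by rewrite [leRHS]mulrAC ler_wpM2r.
Qed.

End bathtub.

(** * The minimal energy at the closed-form bound *)

Section critical_value.
Context {R : realType}.

Lemma ln_le_subr1 (x : R) : 0 < x -> ln x <= x - 1.
Proof. by move=> x0; have := @le_ln1Dx R (x - 1); rewrite addrCA subrr addr0; apply; lra. Qed.

(** At 1 the function y - ln y is below 3 / 2, and at 4 it is above,
    since ln 4 = 2 ln 2 <= 2. *)
Lemma y_constP : 1 < @y_const R /\ @y_const R - ln y_const = 3 / 2.
Proof.
rewrite /y_const; apply: (@xgetPex R 0 [set y : R | 1 < y /\ y - ln y = 3 / 2]).
have c : {within `[1%R, 4%R], continuous (fun y : R => y - ln y)}.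
  apply: derivable_within_continuous => y; rewrite in_itv/= => /andP[y1 _].
  have dl := is_derive1_ln (lt_le_trans ltr01 y1).
  by apply: derivableB => //; case: dl.
have l4 : ln (4 : R) <= 2.
  have -> : 4 = 2 * 2 :> R by ring.
  by rewrite lnM ?posrE//; have := @ln_le_subr1 2 (ltr0Sn _ 1); lra.
have := IVT (_ : (1 : R) <= 4) c; rewrite ln1 subr0 => H.
have [||y /[!in_itv]/= /andP[y1 y4] yE] := H (3 / 2).
- by lra.
- by rewrite ge_min le_max; apply/andP; split; apply/orP; [left|right]; lra.
exists y; split => //; rewrite lt_neqAle y1 andbT; apply/eqP => y1E.
by move: yE; rewrite -y1E ln1; lra.
Qed.

(** The polynomial is negative at 1 and positive at 2. *)
Lemma x_constP n : (3 <= n)%N -> let x := @x_const R n in 1 < x /\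
    (n%:R - 2) * x ^+ n - n%:R * x ^+ (n - 2) + 8 / (n%:R + 2) = 0.
Proof.
move=> n3; apply: (@xgetPex R 0 [set x : R | 1 < x /\
  (n%:R - 2) * x ^+ n - n%:R * x ^+ (n - 2) + 8 / (n%:R + 2) = 0]).
pose p (x : R) := (n%:R - 2) * x ^+ n - n%:R * x ^+ (n - 2) + 8 / (n%:R + 2).
have n3R : 3 <= n%:R :> R by rewrite ler_nat.
have cp : {within `[1%R, 2%R], continuous p}.
  apply: continuous_subspaceT => x; apply: cvgD; last exact: cvg_cst.
  by apply: cvgB; apply: cvgM; [exact: cvg_cst|exact: exprn_continuous|exact: cvg_cst|exact: exprn_continuous].
have q0 : 0 < 8 / (n%:R + 2) :> R by rewrite divr_gt0//; lra.
have p1 : p 1 < 0.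
  rewrite /p !expr1n !mulr1.
  have : 8 / (n%:R + 2) < 2 :> R by rewrite ltr_pdivrMr; lra.
  lra.
have p2 : 0 < p 2.
  have -> : p 2 = (n%:R - 2) * (2 ^+ (n - 2) * 2 ^+ 2) - n%:R * 2 ^+ (n - 2) + 8 / (n%:R + 2).
    by rewrite /p -exprD subnK// ltnW.
  have : 1 <= 2 ^+ (n - 2) :> R by rewrite exprn_ege1// ler1n.
  by nra.
have v0 : Num.min (p 1) (p 2) <= 0 <= Num.max (p 1) (p 2).
  by rewrite ge_min le_max (ltW p1) (ltW p2) orbT.
have [x /[!in_itv]/= /andP[x1 x2] xE] := IVT (ler1n R 2) cp v0.
exists x; split => //; rewrite lt_neqAle x1 andbT; apply/eqP => x1E.
by move: p1; rewrite x1E xE ltxx.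
Qed.

(** The ratio of the cut-off radius to sqrt L at L = L0. In dimension 2
    the defining equation is written in the square of the ratio. *)
Definition critical_ratio n : R := if n == 2 then Num.sqrt y_const else x_const n.

(** The last two assertions are the factors of [mass_formula] and
    [energy_formula]; the defining equation of the constants is what
    makes them equal. *)
Lemma critical_ratioP n : (2 <= n)%N -> let x := critical_ratio n in
  [/\ 1 <= x, 1 + tail_factor n x = K_const n & n%:R / (n%:R + 2) + x ^+ n - 1 = K_const n].
Proof.
move=> n2; rewrite /critical_ratio /tail_factor /K_const; case: eqVneq => [->|ne] /=.
  have [y1 yE] := y_constP; have y0 : 0 < @y_const R by exact: lt_trans y1.
  split.
  - by rewrite -sqrtr1 ler_sqrt// ltW.
  - congr (1 + _); rewrite -{2}(sqr_sqrtr (ltW y0)) expr2 lnM ?posrE ?sqrtr_gt0//; ring.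
  - rewrite (sqr_sqrtr (ltW y0)); have -> : (2%N%:R : R) / (2%N%:R + 2) = 1 / 2 by field.
    lra.
have n3 : (3 <= n)%N by rewrite ltn_neqAle eq_sym ne.
have [x1 xE] := x_constP n3; set x := x_const n in x1 xE *.
have n3R : 3 <= n%:R :> R by rewrite ler_nat.
have d0 : n%:R - 2 != 0 :> R by rewrite gt_eqF//; lra.
split; first exact: ltW.
- by field.
- apply: (mulIf d0); rewrite divfK//.
  have e : n%:R / (n%:R + 2) = 1 - 2 / (n%:R + 2) :> R by field; rewrite gt_eqF//; lra.
  rewrite e; have e2 : 8 / (n%:R + 2) = 2 - (n%:R - 2) * (2 / (n%:R + 2)) :> R by field; rewrite gt_eqF//; lra.
  by move: xE; rewrite e2 => xE; lra.
Qed.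

Lemma K_const_gt0 n : (2 <= n)%N -> 0 < @K_const R n.
Proof.
move=> n2; have [x1 _ <-] := critical_ratioP n2.
have x1n : 1 <= critical_ratio n ^+ n by exact: exprn_ege1.
have : 0 < n%:R / (n%:R + 2) :> R by rewrite divr_gt0 ?ltr0n ?(ltn_trans _ n2)// addr_gt0 ?ltr0n ?(ltn_trans _ n2).
by lra.
Qed.

Lemma powR_root n (p : R) : (0 < n)%N -> 0 <= p -> (p `^ n%:R^-1) ^+ n = p.
Proof.
move=> n0 p0; rewrite -powR_mulrn ?powR_ge0// -powRrM mulVf ?powRr1//.
by rewrite pnatr_eq0 -lt0n.
Qed.

Lemma powR_2div n (p : R) : p `^ (2 / n%:R) = (p `^ n%:R^-1) ^+ 2.
Proof. by rewrite mulrC powRrM powR_mulrn// powR_ge0. Qed.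

(** With a = sqrt L0 the fractional powers in the definition of L0
    disappear, and the formula for L0 becomes the mass condition of the
    bathtub problem at radius a times the ratio. *)
Lemma L0_square n (V : R) k : (2 <= n)%N -> 0 < V -> (1 <= k)%N ->
  exists a : R, [/\ 0 < a, a ^+ 2 = L0 n V k &
    V / (2 * pi) ^+ n * omega n * a ^+ n * K_const n = k%:R].
Proof.
move=> n2 V0 k1; have n0 : (0 < n)%N by exact: ltn_trans n2.
have K0 := K_const_gt0 n2; have w0 := @omega_gt0 R n.
have k0 : 0 < k%:R :> R by rewrite ltr0n.
have p0 : 0 < 2 * pi :> R by rewrite mulr_gt0// pi_gt0.
have cE : c_const n = (K_const n `^ n%:R^-1) ^- 2 :> R.
  rewrite /c_const -powR_2div; case: eqVneq => [->|_]; last by rewrite powRN.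
  by rewrite divff// powRr1// ltW// K_const_gt0.
pose rt (q : R) := q `^ n%:R^-1.
have rt0 q : 0 < q -> 0 < rt q by move=> q0; exact: powR_gt0.
exists (2 * pi * (rt (omega n))^-1 * (rt V)^-1 * rt k%:R * (rt (K_const n))^-1).
split.
- by do ![apply: mulr_gt0 => //]; rewrite ?invr_gt0 ?rt0 ?pi_gt0.
- rewrite /L0 cE /weyl /weyl_const !powRN !powR_2div -/(rt (omega n)) -/(rt V) -/(rt k%:R) -/(rt (K_const n)).
  by field; rewrite !gt_eqF ?rt0.
- have rE q : 0 < q -> rt q ^+ n = q by move=> q0; rewrite powR_root// ltW.
  move: (2 * pi) p0 => P p0; rewrite !exprMn !exprVn !rE//.
  by field; rewrite !gt_eqF// exprn_gt0.
Qed.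

Lemma L0_gt0 n (V : R) k : (2 <= n)%N -> 0 < V -> (1 <= k)%N -> 0 < L0 n V k.
Proof. by move=> n2 V0 k1; have [a [a0 <- _]] := L0_square n2 V0 k1; rewrite exprn_gt0. Qed.

(** The mass and the energy are C omega a^n K and C omega a^n K L0,
    where C omega a^n K = k. *)
Lemma Mmin_L0 n (V : R) k : (2 <= n)%N -> 0 < V -> (1 <= k)%N ->
  Mmin n V k (L0 n V k) = (k%:R * L0 n V k)%:E.
Proof.
move=> n2 V0 k1; have [a [a0 aL aK]] := L0_square n2 V0 k1.
have [x1 xm xe] := critical_ratioP n2.
rewrite (@bathtub R n V V0 _ (critical_ratio n * a)) ?L0_gt0//.
  by rewrite (energy_formula n2 V0 a0 aL x1) xe -aK; congr EFin; ring.
by rewrite (mass_formula n2 V0 a0 aL x1) xm.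
Qed.

End critical_value.

(** * The integral of the counting function *)

Section counting_integral.
Context {R : realType}.
Notation T := (lebesgueTypeR R).
Notation mu := (@completed_lebesgue_measure R).

Lemma measurable_itv_completed (i : interval R) : measurable ([set` i] : set T).
Proof. by apply: sub_caratheodory; exact: measurable_itv. Qed.

Lemma completed_itv (a b : R) (x y : bool) : a <= b ->
  mu [set` Interval (BSide x a) (BSide y b)] = (b - a)%:E.
Proof.
move=> ab; transitivity (@lebesgue_measure R [set` Interval (BSide x a) (BSide y b)]); first by [].
rewrite lebesgue_measure_itv/= lte_fin; move: ab; rewrite le_eqVlt => /predU1P[->|->//].
by rewrite ltxx subrr.
Qed.

Variables (nu : R -> R) (k : nat).
Hypothesis nu_ge0 : forall t, 0 < t -> 0 <= nu t.
Hypothesis nu_meas : measurable_fun (`]0, +oo[ : set T) (nu : T -> R).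
Hypothesis k_ge1 : (1 <= k)%N.

Let f (t : T) : R := Num.min (k%:R - 1) (nu t).
Let k1 : 0 <= k%:R - 1 :> R. Proof. by rewrite subr_ge0 ler1n. Qed.

Let f_bounds (t : T) : 0 < (t : R) -> 0 <= f t <= k%:R - 1.
Proof. by move=> t0; rewrite /f le_min k1 nu_ge0//= ge_min lexx. Qed.

Let itvS (i : interval R) : (forall t, t \in i -> 0 < t) -> ([set` i] : set T) `<=` `]0, +oo[.
Proof. by move=> H t /H t0; rewrite /= in_itv/= t0. Qed.

Let mf (i : interval R) : (forall t, t \in i -> 0 < t) ->
  measurable_fun ([set` i] : set T) f.
Proof.
move=> H; apply: measurable_minr; first exact: measurable_cst.
by apply: measurable_funS nu_meas; [exact: measurable_itv_completed|exact: itvS].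
Qed.

Let integrable_f (a b : R) (x y : bool) : a <= b ->
  (forall t, t \in Interval (BSide x a) (BSide y b) -> 0 < t) ->
  mu.-integrable [set` Interval (BSide x a) (BSide y b)] (EFin \o f).
Proof.
move=> ab H; apply: measurable_bounded_integrable.
- exact: measurable_itv_completed.
- by apply: (@Order.POrderTheory.le_lt_trans _ _ (b - a)%:E); [rewrite -(completed_itv x y ab)|exact: ltry].
- exact: mf.
- exists (k%:R - 1); split; first exact: num_real.
  move=> M kM t /H t0; have /andP[f0 f1] := f_bounds t0.
  by rewrite /= ger0_norm// (le_trans f1)// ltW.
Qed.

Lemma Jint_ge0 L : 0 <= Jint nu k L.
Proof.
apply: Rintegral_ge0 => t; rewrite /= in_itv/= => /andP[t0 _].
by have /andP[] := f_bounds t0.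
Qed.

Lemma Jint_increment L' L : 0 < L' -> L' <= L ->
  0 <= Jint nu k L - Jint nu k L' <= (k%:R - 1) * (L - L').
Proof.
move=> L'0 LL.
have pos (t : R) : t \in Interval (BSide true L') (BSide true L) -> 0 < t.
  by rewrite in_itv/= => /andP[/(lt_le_trans L'0)].
have U : `]0, L[%classic = `]0, L'[%classic `|` `[L', L[%classic :> set T.
  apply/seteqP; split => t; rewrite /= !in_itv/=.
    by move=> /andP[-> ->]; rewrite andbT; case: (ltP t L'); [left|right].
  move=> [/andP[-> h]|/andP[h ->]]; first by rewrite (lt_le_trans h).
  by rewrite (lt_le_trans L'0).
have E : Jint nu k L = Jint nu k L' + \int[mu]_(t in `[L', L[) f t.
  rewrite /Jint U Rintegral_setU//.
  - exact: measurable_itv_completed.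
  - exact: measurable_itv_completed.
  - rewrite -U; apply: integrable_f; first by rewrite ltW// (lt_le_trans L'0).
    by move=> t; rewrite in_itv/= => /andP[].
  - apply/disj_setPS => t [/=]; rewrite !in_itv/= => /andP[_ h1] /andP[h2 _].
    by move: (lt_le_trans h1 h2); rewrite ltxx.
rewrite E addrAC subrr add0r; apply/andP; split.
  by apply: Rintegral_ge0 => t /pos t0; have /andP[] := f_bounds t0.
have mI : measurable (`[L', L[%classic : set T) by exact: measurable_itv_completed.
have -> : (k%:R - 1) * (L - L') = \int[mu]_(t in `[L', L[) (k%:R - 1).
  rewrite (Rintegral_cst mu mI); congr (_ * _).
  exact: (esym (congr1 fine (completed_itv true true LL))).
apply: le_Rintegral => //.
- exact: integrable_f.
- apply: measurable_bounded_integrable => //; first by apply: (@Order.POrderTheory.le_lt_trans _ _ (L - L')%:E); [rewrite -(completed_itv true true LL)|exact: ltry].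
  exists (k%:R - 1); split; first exact: num_real.
  by move=> M kM t _; rewrite ger0_norm// ltW.
- by move=> t /pos t0; have /andP[] := f_bounds t0.
Qed.

Variable lam : nat -> R.
Hypothesis lam1 : 0 < lam 1%N.
Hypothesis lam_mono : forall i j, (1 <= i <= j)%N -> lam i <= lam j.
Hypothesis nu_le : {ae mu, forall t : T, (0 : R) < t -> ((nu t)%:E <= counting_lt lam t)%E}.

(** Eigenvalues of index above k do not lie below lam_k. *)
Lemma counting_lt_sum t : t <= lam k ->
  (counting_lt lam t <= (\sum_(j < k) (lam j.+1 < t)%R%:R)%R%:E)%E.
Proof.
move=> tk; pose A j : set nat := if lam j.+1 < t then [set j.+1] else set0.
have S : [set j | (1 <= j)%N /\ lam j < t] `<=` \big[setU/set0]_(j < k) A j.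
  move=> [|j] [] //= _ jt; rewrite -bigcup_mkord; exists j; last by rewrite /A jt.
  rewrite /= ltnNge; apply/negP => kj; move: (lt_le_trans jt tk); rewrite ltNge.
  by rewrite lam_mono// k_ge1 ltnW.
apply: (@le_trans _ _ (counting (\big[setU/set0]_(j < k) A j))).
  by apply: le_measure; rewrite ?inE.
apply: (le_trans (Boole_inequality (@counting nat R) _)) => //.
rewrite -sumEFin; apply: lee_sum => j _; rewrite /A; case: ifP => _.
  have c1 : counting [set j.+1 : nat] = 1%:E :> \bar R.
    by rewrite /counting asboolT ?fset_set1 ?finmap.cardfs1.
  exact: (eq_ind_r (fun z => z <= 1%:E)%E (lexx _) c1).
by rewrite measure0.
Qed.

(** The indicator of {t > lam_(j+1)} has integral lam_k - lam_(j+1) over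
    (0, lam_k), and by [counting_lt_sum] the sum of these indicators
    dominates nu almost everywhere there. *)
Lemma Jint_le_eigenvalues :
  Jint nu k (lam k) <= k%:R * lam k - \sum_(j < k) lam j.+1.
Proof.
have lk0 : 0 < lam k by rewrite (lt_le_trans lam1)// lam_mono// k_ge1.
have mI : measurable (`]0, lam k[%classic : set T) by exact: measurable_itv_completed.
have pos (t : R) : t \in `]0, lam k[ -> 0 < t by rewrite in_itv/= => /andP[].
pose B (j : nat) : set T := `]lam j.+1, +oo[%classic.
have mB j : measurable (B j) by exact: measurable_itv_completed.
have E : (\int[mu]_(t in `]0%R, lam k[%classic) (\sum_(j < k) \1_(B j) t)%R%:E = (k%:R * lam k - \sum_(j < k) lam j.+1)%R%:E)%E.
  under eq_integral do rewrite -sumEFin.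
  rewrite ge0_integral_sum; last 3 first.
  - exact: mI.
  - move=> j; apply/measurable_EFinP; apply: measurable_funTS; exact: measurable_indic.
  - by move=> j t _; rewrite lee_fin.
  rewrite (_ : k%:R * lam k - _ = \sum_(j < k) (lam k - lam j.+1)); last first.
    by rewrite sumrB sumr_const card_ord mulr_natl.
  rewrite -sumEFin; apply: eq_bigr => j _.
  have jk : lam j.+1 <= lam k by rewrite lam_mono//=.
  rewrite integral_indic// (_ : B j `&` _ = `]lam j.+1, lam k[%classic); first exact: completed_itv.
  apply/seteqP; split => t; rewrite /B /= !in_itv/= andbT; first by move=> [-> /andP[]].
  move=> /andP[h ->]; split=> //; rewrite andbT (lt_trans _ h)//.
  by rewrite (lt_le_trans lam1)// lam_mono.
rewrite -lee_fin -E /Jint -EFin_Rintegral//; last first.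
  by apply: integrable_f => //; exact: ltW.
apply: ae_ge0_le_integral.
- exact: mI.
- by move=> t /pos t0; rewrite lee_fin; have /andP[] := f_bounds t0.
- by apply/measurable_EFinP; exact: mf.
- by move=> t _; rewrite lee_fin sumr_ge0.
- apply/measurable_EFinP; apply: measurable_sum => j; apply: measurable_funTS; exact: measurable_indic.
- apply: filterS nu_le => t nut tI; have t0 := pos t tI.
  have tk : t < lam k by move: tI; rewrite /= in_itv/= => /andP[].
  rewrite lee_fin ge_min; apply/orP; right; rewrite -lee_fin.
  apply: le_trans (nut t0) _; apply: le_trans (counting_lt_sum (ltW tk)) _.
  rewrite lee_fin; apply: ler_sum => j _; rewrite indicE.
  have -> // : (t \in B j) = (lam j.+1 < t).
  by apply/idP/idP; rewrite inE /B /= in_itv/= andbT.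
Qed.

End counting_integral.

(** * The hybrid bound *)

Lemma lipschitz_right_continuous_at (R : realType) (f : R -> R) (c x A : R) : c < x ->
  (forall s t, c <= s -> s <= t -> `|f s - f t| <= A * (t - s)) ->
  {for x, continuous f}.
Proof.
move=> cx H.
have H2 t : c <= t -> `|f t - f x| <= A * `|t - x|.
  move=> ct; have [tx|/ltW xt] := leP t x.
    by rewrite [`|t - x|]distrC [`|x - t|]ger0_norm ?subr_ge0// H.
  by rewrite distrC [`|t - x|]ger0_norm ?subr_ge0// H// ltW.
apply/subr_cvg0; apply/norm_cvg0P.
have c0 : A * `|t - x| @[t --> x] --> 0.
  rewrite -(mulr0 A); apply: cvgM; first exact: cvg_cst.
  by apply/norm_cvg0P/subr_cvg0; exact: cvg_id.
apply: (squeeze_cvgr _ (cvg_cst 0) c0).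
near=> t; rewrite normr_ge0/= H2//.
by apply: ltW; near: t; exact: lt_nbhsr.
Unshelve. all: by end_near. Qed.

Theorem theorem5p3 (R : realType) (n : nat) (n_ge2 : (2 <= n)%N)
  (Omega : set 'rV[R]_n) (Omega_open : open Omega)
  (V : R) (V_gt0 : 0 < V) (V_def : lebesgue_row R n Omega = V%:E)
  (lam : nat -> R) (lam_eig : dirichlet_eigenvalues Omega lam)
  (nu : R -> R) (nu_ge0 : forall t, 0 < t -> 0 <= nu t)
  (nu_meas : measurable_fun (`]0, +oo[ : set (lebesgueTypeR R))
    (nu : lebesgueTypeR R -> R))
  (nu_le : {ae @completed_lebesgue_measure R,
    forall t : lebesgueTypeR R, (0 : R) < t ->
      ((nu t)%:E <= counting_lt lam t)%E})
  (k : nat) (k_ge1 : (1 <= k)%N) :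
  (exists! L : R, 0 < L /\ Phi n V nu k L = 0%E) /\
  (forall Lhyb : R, 0 < Lhyb -> Phi n V nu k Lhyb = 0%E ->
    [/\ Lhyb <= lam k,
        L0 n V k <= Lhyb,
        (L0 n V k < Lhyb <-> 0 < Jint nu k (L0 n V k)) &
        forall B : R, B <= lam k ->
          let Lstar := Num.max (L0 n V k) B in
          Lstar < Lhyb <->
          ((k%:R * Lstar)%:E < Mmin n V k Lstar + (Jint nu k Lstar)%:E)%E]).
Proof.
have [lam1 lam_mono _ _] := lam_eig.
have lk0 : 0 < lam k by rewrite (lt_le_trans lam1)// lam_mono// k_ge1.
pose L0' := L0 n V k; have L00 : 0 < L0' by exact: L0_gt0.
pose phi L := min_energy n V k L + Jint nu k L - k%:R * L.
have PhiE L : 0 < L -> Phi n V nu k L = (phi L)%:E.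
  by move=> Lpos; rewrite /Phi (MminE n_ge2 V_gt0 k Lpos).
have phi_incr L' L : 0 < L' -> L' <= L -> phi L + (L - L') <= phi L'.
  move=> L'0 LL; have /andP[_ h1] := Jint_increment nu_ge0 nu_meas k_ge1 L'0 LL.
  have h2 := min_energy_nonincreasing n_ge2 V_gt0 k L'0 LL.
  by rewrite /phi; lra.
have phi_anti L' L : 0 < L' -> L' < L -> phi L < phi L'.
  by move=> L'0 LL; have := phi_incr _ _ L'0 (ltW LL); lra.
have sgn L Lh : 0 < L -> 0 < Lh -> phi Lh = 0 -> L < Lh <-> 0 < phi L.
  move=> Lp Lhp Lh0; split => [LL|pL]; first by rewrite -Lh0 phi_anti.
  rewrite ltNge; apply/negP; rewrite le_eqVlt => /predU1P[E|h].
    by move: pL; rewrite -E Lh0 ltxx.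
  by have := phi_anti _ _ Lhp h; rewrite Lh0 ltNge (ltW pL).
have phiL0 : phi L0' = Jint nu k L0'.
  have := Mmin_L0 n_ge2 V_gt0 k_ge1; rewrite (MminE n_ge2 V_gt0 k L00) => -[E].
  by rewrite /phi E /L0'; ring.
have phiL0_ge0 : 0 <= phi L0' by rewrite phiL0; exact: Jint_ge0.
have phi_lam : phi (lam k) <= 0.
  have h1 := Jint_le_eigenvalues nu_ge0 nu_meas k_ge1 lam1 lam_mono nu_le.
  have h2 : min_energy n V k (lam k) <= \sum_(j < k) lam j.+1.
    rewrite -lee_fin -(MminE n_ge2 V_gt0 k lk0).
    apply: (Mmin_dual_bound n_ge2 V_gt0 lk0) => mu.
    have mO := open_measurable_row Omega_open.
    have Oy : (lebesgue_row R n Omega < +oo)%E by rewrite V_def ltry.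
    exact: (berezin_li_yau mO Oy lam_eig V_gt0 V_def mu k_ge1).
  by rewrite /phi; lra.
have L0lam : L0' <= lam k.
  by rewrite leNgt; apply/negP => h; have := phi_anti _ _ lk0 h; lra.
have cphi : {within `[L0', lam k], continuous phi}.
  apply: continuous_in_subspaceT => x; rewrite inE/= in_itv/= => /andP[/(lt_le_trans L00) x0 _].
  have cx : x / 2 < x by lra.
  have c0 : 0 < x / 2 by lra.
  apply: (@lipschitz_right_continuous_at R phi _ x (2 / (x / 2) * min_energy n V k (x / 2 / 2) + k%:R) cx) => s t cs st.
  have s0 : 0 < s by exact: lt_le_trans cs.
  have h0 := phi_incr _ _ s0 st.
  have /andP[h1 _] := Jint_increment nu_ge0 nu_meas k_ge1 s0 st.
  have h2 := min_energy_lipschitz n_ge2 V_gt0 k c0 cs st.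
  by rewrite ger0_norm; [rewrite /phi mulrDl; lra|lra].
have [L LI phiL] : exists2 L, L \in `[L0', lam k] & phi L = 0.
  by apply: IVT => //; rewrite ge_min le_max phiL0_ge0 phi_lam orbT.
have Lpos : 0 < L by move: LI; rewrite in_itv/= => /andP[/(lt_le_trans L00)].
split.
  exists L; split; first by rewrite PhiE// phiL.
  move=> L' [L'0]; rewrite PhiE// => -[phiL'].
  have [h|h|//] := ltgtP L L'.
    by have := phi_anti _ _ Lpos h; rewrite phiL phiL' ltxx.
  by have := phi_anti _ _ L'0 h; rewrite phiL phiL' ltxx.
move=> Lh Lh0; rewrite PhiE// => -[phiLh]; split.
- by rewrite leNgt; apply/negP => /(phi_anti _ _ lk0); rewrite phiLh ltNge phi_lam.
- by rewrite leNgt; apply/negP => /(phi_anti _ _ Lh0); rewrite phiLh ltNge phiL0_ge0.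
- by rewrite -/L0' -phiL0; exact: sgn.
- move=> B _ Ls; have Ls0 : 0 < Ls by rewrite /Ls lt_max L00.
  by rewrite (MminE n_ge2 V_gt0 k Ls0) -EFinD lte_fin -subr_gt0; exact: sgn.
Qed.
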